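(* Let $k$ be a field of characteristic $0$, let $A$ and $B$ be unital associative $k$-algebras, let $R\colon B\otimes A\to A\otimes B$ be an invertible distributive law, and let $V$ be an $A\#_R B$-bimodule. Then there are two spectral sequences whose $E^1$-terms are given by $$E^1_{p,q} = H_q(A,\mathrm{CH}_p(B,V)),\qquad {}'E^1_{p,q} = H_p(B,\mathrm{CH}_q(A,V)),$$ both of which converge to the Hochschild homology $H_{p+q}(A\#_R B,V)$ of the smash biproduct $A\#_R B$ with coefficients in $V$.
   Context: All tensor products are over $k$. A linear map $R\colon B\otimes A\to A\otimes B$, written $R(b\otimes a)={}^Ra\otimes b^R$, is a distributive law if $R(b\otimes 1)=1\otimes b$, $R(1\otimes a)=a\otimes 1$, $R\circ(\mu_B\otimes A)=(A\otimes\mu_B)(R\otimes B)(B\otimes R)$ and $R\circ(B\otimes\mu_A)=(\mu_A\otimes B)(A\otimes R)(R\otimes A)$, where $\mu_A,\mu_B$ are the multiplications. The smash biproduct $A\#_R B$ is then the unital associative algebra $A\otimes B$ with product $(a\otimes b)(a'\otimes b')=a({}^Ra')\otimes (b^R)b'$ and unit $1\otimes 1$; it contains $A$ and $B$ as subalgebras, so an $A\#_RB$-bimodule is both an $A$-bimodule and a $B$-bimodule. For an algebra $C$ and a $C$-bimodule $W$, $\mathrm{CH}_n(C,W)=W\otimes C^{\otimes n}$ is the Hochschild complex with its usual differential, and $H_*(C,W)$ is its homology. Bimodule structures: $\mathrm{CH}_p(B,V)=V\otimes B^{\otimes p}$ is an $A$-bimodule via $a\cdot(v\otimes b_1\otimes\cdots\otimes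 b_p)=(a v)\otimes b_1\otimes\cdots\otimes b_p$ and $(v\otimes b_1\otimes\cdots\otimes b_p)\cdot a=v\cdot{}^{R_1\cdots R_p}a\otimes b_1^{R_1}\otimes\cdots\otimes b_p^{R_p}$, obtained by moving $a$ to the left across $b_p,\dots,b_1$ by successive applications of $R$. Writing $\mathrm{CH}_q(A,V)$ as $A^{\otimes q}\otimes V$, it is a $B$-bimodule via $(a_1\otimes\cdots\otimes a_q\otimes v)\cdot b=a_1\otimes\cdots\otimes a_q\otimes vb$ and $b\cdot(a_1\otimes\cdots\otimes a_q\otimes v)={}^{R_1}a_1\otimes\cdots\otimes{}^{R_q}a_q\otimes b^{R_1\cdots R_q}v$, obtained by moving $b$ to the right across $a_1,\dots,a_q$ by successive applications of $R$. *)

(* Defs.v *)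
From HB Require Import structures.
From mathcomp Require Import all_boot all_algebra.
From mathcomp Require Import boolp finmap.
From mathcomp Require Import -(notations) monalg.

Set Implicit Arguments.
Unset Strict Implicit.
Unset Printing Implicit Defensive.

Import GRing.Theory.
Local Open Scope ring_scope.
Local Open Scope quotient_scope.

(* A unital associative algebra over a field. Contrary to algType, the zero
   algebra is allowed; every algType is an instance. *)
HB.mixin Record isUnitalAlgebra (k : fieldType) A of GRing.Lmodule k A := {
  aone : A;
  amul : A -> A -> A;
  amulA : associative amul;
  amul1l : left_id aone amul;
  amul1r : right_id aone amul;
  amulDl : left_distributive amul +%R;
  amulDr : right_distributive amul +%R;
  ascaleAl : forall (c : k) (x y : A), c *: amul x y = amul (c *: x) y;
  ascaleAr : forall (c : k) (x y : A), c *: amul x y = amul x (c *: y)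
}.
#[short(type="unitalAlgType")]
HB.structure Definition UnitalAlgebra (k : fieldType) :=
  {A of GRing.Lmodule k A & isUnitalAlgebra k A}.
HB.instance Definition _ (k : fieldType) (A : unitalAlgType k) :=
  GRing.Zmodule_isPzRing.Build (UnitalAlgebra.sort A)
   (@amulA k A) (@amul1l k A) (@amul1r k A) (@amulDl k A) (@amulDr k A).
HB.instance Definition _ (k : fieldType) (A : algType k) :=
  isUnitalAlgebra.Build k (GRing.Algebra.sort A) (@mulrA A) (@mul1r A) (@mulr1 A)
  (@mulrDl A) (@mulrDr A) (@scalerAl k A) (@scalerAr k A).

Section Quotient.
Variables (k : fieldType) (V : lmodType k) (S : submodClosed V).

Definition quot_pred : {pred V} := S.
Fact quot_pred_closed : zmod_closed quot_pred.
Proof. exact: GRing.submod_closedB (submodClosedP S). Qed.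
HB.instance Definition _ := GRing.isZmodClosed.Build V quot_pred quot_pred_closed.

Definition lquot : Type := (Quotient.quot quot_pred).
HB.instance Definition _ := GRing.Zmodule.on lquot.
Definition lpi (x : V) : lquot := \pi_(Quotient.quot quot_pred) x.
Definition lrepr (x : lquot) : V := repr (x : (Quotient.quot quot_pred)).

Lemma lreprK : cancel lrepr lpi. Proof. exact: reprK. Qed.
Lemma lpi_eq x y : (lpi x == lpi y) = (x - y \in S).
Proof. by rewrite /lpi -[LHS](Quotient.idealrBE quot_pred). Qed.
Fact lpi_zmod_morphism : zmod_morphism lpi.
Proof. exact: (@pi_is_zmod_morphism _ _ _ (Quotient.quot quot_pred)). Qed.
HB.instance Definition _ := GRing.isZmodMorphism.Build V lquot lpi lpi_zmod_morphism.

Definition lquot_scale (c : k) (x : lquot) : lquot := lpi (c *: lrepr x).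
Lemma lpiZ c x : lpi (c *: x) = lquot_scale c (lpi x).
Proof.
apply/eqP; rewrite lpi_eq -scalerBr rpredZ // -lpi_eq lreprK; exact: eqxx.
Qed.
Fact lquot_scaleA a b x : lquot_scale a (lquot_scale b x) = lquot_scale (a * b) x.
Proof. by rewrite -[x]lreprK -!lpiZ scalerA. Qed.
Fact lquot_scale1 : left_id 1 lquot_scale.
Proof. by move=> x; rewrite -[x]lreprK -!lpiZ scale1r. Qed.
Fact lquot_scaleDr : right_distributive lquot_scale +%R.
Proof.
by move=> a x y; rewrite -[x]lreprK -[y]lreprK -raddfD -!lpiZ -raddfD scalerDr.
Qed.
Fact lquot_scaleDl x : {morph lquot_scale^~ x : a b / a + b}.
Proof. by move=> a b; rewrite -[x]lreprK -!lpiZ -raddfD scalerDl. Qed.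
HB.instance Definition _ := GRing.Zmodule_isLmodule.Build k lquot
  lquot_scaleA lquot_scale1 lquot_scaleDr lquot_scaleDl.
Fact lpi_scalable : scalable lpi. Proof. exact: lpiZ. Qed.
HB.instance Definition _ := GRing.isScalable.Build k V lquot *:%R lpi lpi_scalable.

Lemma lpi_eq0 x : (lpi x == 0) = (x \in S).
Proof. by rewrite -(raddf0 lpi) lpi_eq subr0. Qed.
End Quotient.

Section Submodule.
Variables (k : fieldType) (V : lmodType k) (S : submodClosed V).
Record submod := Submod { submod_val :> V; _ : submod_val \in S }.
HB.instance Definition _ := [isSub of submod for submod_val].
HB.instance Definition _ := [Choice of submod by <:].
HB.instance Definition _ := [SubChoice_isSubLmodule of submod by <:].
End Submodule.

(* The subquotient S / (S :&: T), i.e. S / T when T is contained in S. *)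
Section Subquotient.
Variables (k : fieldType) (V : lmodType k) (S T : submodClosed V).
Definition sub_in : {pred submod S} := fun x => val x \in T.
Fact sub_in_closed : submod_closed sub_in.
Proof.
have E x : (x \in sub_in) = (val x \in T) by [].
split=> [|a x y]; first by rewrite E raddf0 rpred0.
by rewrite !E linearP /= => xT yT; rewrite rpredD ?rpredZ.
Qed.
HB.instance Definition _ := GRing.isSubmodClosed.Build k (submod S) sub_in sub_in_closed.
Definition subquot : lmodType k := lquot sub_in.
End Subquotient.

Section KerIm.
Variables (k : fieldType) (U V : lmodType k).
Definition lin_ker (f : {linear U -> V}) : {pred U} := fun x => f x == 0.
Fact lin_ker_closed f : submod_closed (lin_ker f).
Proof.
have E x : (x \in lin_ker f) = (f x == 0) by [].
split=> [|a x y]; first by rewrite E raddf0.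
by rewrite !E linearP => /eqP-> /eqP->; rewrite scaler0 addr0.
Qed.
HB.instance Definition _ f := GRing.isSubmodClosed.Build k U (lin_ker f) (lin_ker_closed f).
Definition lin_im (f : {linear U -> V}) : {pred V} := fun y => `[< exists x, f x = y >].
Fact lin_im_closed f : submod_closed (lin_im f).
Proof.
split; first by apply/asboolP; exists 0; rewrite raddf0.
move=> a _ _ /asboolP[x <-] /asboolP[y <-]; apply/asboolP.
by exists (a *: x + y); rewrite linearP.
Qed.
HB.instance Definition _ f := GRing.isSubmodClosed.Build k V (lin_im f) (lin_im_closed f).
End KerIm.

(* ker g / im f; as above, only the part of im f inside ker g is divided out,
   so that g \o f = 0 need not be supplied. *)
Definition homology (k : fieldType) (U V W : lmodType k)
  (f : {linear U -> V}) (g : {linear V -> W}) : lmodType k :=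
  subquot (lin_ker g) (lin_im f).

Definition bilin (k : fieldType) (U V W : lmodType k) (f : U -> V -> W) :=
  (forall v, linear (f^~ v)) /\ (forall u, linear (f u)).

Section Free.
Variables (k : fieldType) (X : choiceType).
Notation F := (monalg.malg X k).
Definition free_gen (x : X) : F := monalg.mkmalgU x 1.

Variables (W : lmodType k) (h : X -> W).
Definition free_lift (g : F) : W :=
  \sum_(x <- monalg.msupp g) monalg.mcoeff x g *: h x.
Lemma free_liftEw (d : {fset X}) (g : F) : (monalg.msupp g `<=` d)%fset ->
  free_lift g = \sum_(x <- d) monalg.mcoeff x g *: h x.
Proof.
move=> le; rewrite /free_lift (big_fset_incl _ le) // => x _ xg.
by rewrite monalg.mcoeff_outdom // scale0r.
Qed.
Fact free_lift_linear : linear free_lift.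
Proof.
move=> a x y.
pose d := (monalg.msupp x `|` monalg.msupp y `|` monalg.msupp (a *: x + y))%fset.
rewrite !(@free_liftEw d);
  try by apply/fsubsetP => z; rewrite !in_fsetU => ->; rewrite ?orbT.
rewrite scaler_sumr -big_split; apply: eq_bigr => i _ /=.
by rewrite monalg.mcoeffD monalg.mcoeffZ scalerDl scalerA.
Qed.
HB.instance Definition _ := GRing.isLinear.Build k F W *:%R free_lift free_lift_linear.
Lemma free_liftU x : free_lift (free_gen x) = h x.
Proof.
rewrite (@free_liftEw [fset x]%fset) ?big_seq_fset1 ?monalg.mcoeffUU ?scale1r //.
exact: monalg.msuppU_le.
Qed.
End Free.
Lemma free_ext (k : fieldType) (X : choiceType) (W : lmodType k)
   (f g : {linear monalg.malg X k -> W}) :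
  (forall x, f (free_gen k x) = g (free_gen k x)) -> f =1 g.
Proof.
move=> fg x; rewrite [x]monalg.monalgE !raddf_sum /=; apply: eq_bigr => i _.
have -> : monalg.mkmalgU i (monalg.mcoeff i x) = monalg.mcoeff i x *: free_gen k i.
  apply/monalg.malgP => j; rewrite monalg.mcoeffZ !monalg.mcoeffU.
  by case: eqP; rewrite ?mulr1 ?mulr0.
by rewrite !linearZ /= fg.
Qed.

(* V ⊗ W is the free vector space on V * W modulo the bilinearity relations. It
   is sealed below behind its universal property: unfolding the quotient makes
   unification diverge. *)
Section TensorConstruction.
Variables (k : fieldType) (V W : lmodType k).
Notation F := (monalg.malg (V * W)%type k).
Notation e v w := (@free_gen k (V * W)%type (v, w)).

Inductive bilinear_relation : F -> Prop :=
| BilRel0 : bilinear_relation 0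
| BilRelP c x y : bilinear_relation x -> bilinear_relation y ->
    bilinear_relation (c *: x + y)
| BilRelL c v v' w : bilinear_relation (e (c *: v + v') w - (c *: e v w + e v' w))
| BilRelR c v w w' : bilinear_relation (e v (c *: w + w') - (c *: e v w + e v w')).

Definition bilrel : {pred F} := fun x => `[< bilinear_relation x >].
Fact bilrel_closed : submod_closed bilrel.
Proof.
split; first by apply/asboolP; constructor.
by move=> a x y /asboolP ? /asboolP ?; apply/asboolP; constructor.
Qed.
HB.instance Definition _ := GRing.isSubmodClosed.Build k F bilrel bilrel_closed.

Definition free_tensor : Type := lquot bilrel.
HB.instance Definition _ := GRing.Lmodule.on free_tensor.
Definition free_tens (v : V) (w : W) : free_tensor := lpi bilrel (e v w).

Lemma free_tens_bilin : bilin free_tens.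
Proof.
split=> [w a v v'|v a w w']; apply/eqP.
- rewrite /free_tens -linearP lpi_eq; apply/asboolP; exact: BilRelL.
- rewrite /free_tens -linearP lpi_eq; apply/asboolP; exact: BilRelR.
Qed.

Section Lift.
Variables (U : lmodType k) (f : V -> W -> U).
Definition tlift_fun of bilin f := fun x : free_tensor =>
  free_lift (fun p : V * W => f p.1 p.2) (lrepr x).
Hypothesis bf : bilin f.
Lemma bilrel_lift x : bilinear_relation x -> free_lift (fun p : V * W => f p.1 p.2) x = 0.
Proof.
elim=> {x} [|c x y _ x0 _ y0|c v v' w|c v w w'].
- exact: raddf0.
- by rewrite linearP /= x0 y0 scaler0 addr0.
- by rewrite linearB linearP /= !free_liftU /= bf.1 subrr.
- by rewrite linearB linearP /= !free_liftU /= bf.2 subrr.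
Qed.
Lemma tlift_pi x : tlift_fun bf (lpi bilrel x) = free_lift (fun p : V * W => f p.1 p.2) x.
Proof.
apply/eqP; rewrite /tlift_fun -subr_eq0 -linearB; apply/eqP/bilrel_lift/asboolP.
have := lpi_eq bilrel (lrepr (lpi bilrel x)) x.
by rewrite lreprK eqxx.
Qed.
Fact tlift_linear : linear (tlift_fun bf).
Proof.
move=> a x y; rewrite -[x]lreprK -[y]lreprK -linearP !tlift_pi; exact: linearP.
Qed.
HB.instance Definition _ := GRing.isLinear.Build k free_tensor U *:%R (tlift_fun bf) tlift_linear.
Definition free_tlift : {linear free_tensor -> U} := tlift_fun bf.
Lemma free_tliftE v w : free_tlift (free_tens v w) = f v w.
Proof. by rewrite /free_tlift /= tlift_pi free_liftU. Qed.
End Lift.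

End TensorConstruction.
Lemma free_tens_ind (k : fieldType) (V W : lmodType k) (P : free_tensor V W -> Prop) :
  (forall v w, P (free_tens v w)) -> (forall x y, P x -> P y -> P (x + y)) ->
  forall x, P x.
Proof.
move=> Pt PD x; rewrite -[x]lreprK [lrepr x]monalgE raddf_sum /=.
have P0 : P 0.
  suff <- : free_tens (0 : V) (0 : W) = 0 by [].
  have := (free_tens_bilin V W).1 0 (-1) 0 0.
  by rewrite scaler0 addr0 scaleN1r addNr.
elim/big_rec: _ => [//|[v w] y _ Py]; apply: PD => //.
set c := mcoeff _ _.
have -> : mkmalgU (v, w) c = c *: free_gen k ((v, w) : V * W).
  apply/malgP => j; rewrite mcoeffZ !mcoeffU.
  by case: eqP; rewrite ?mulr1 ?mulr0.
rewrite linearZ /=.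
suff -> : c *: lpi (bilrel (W:=W)) (free_gen k (v, w)) = free_tens (c *: v) w by [].
have := (free_tens_bilin V W).1 w c v 0; rewrite addr0 => ->.
have := (free_tens_bilin V W).1 w (-1) 0 0.
by rewrite scaler0 addr0 scaleN1r addNr => ->; rewrite addr0.
Qed.

Record tensor_product (k : fieldType) (V W : lmodType k) := TensorProduct {
  tp_sort : lmodType k;
  tp_tens : V -> W -> tp_sort;
  tp_bilin : bilin tp_tens;
  tp_lift : forall (U : lmodType k) (f : V -> W -> U), bilin f ->
    {linear tp_sort -> U};
  tp_liftE : forall (U : lmodType k) (f : V -> W -> U) (bf : bilin f) v w,
    tp_lift bf (tp_tens v w) = f v w;
  tp_ind : forall P : tp_sort -> Prop,
    (forall v w, P (tp_tens v w)) -> (forall x y, P x -> P y -> P (x + y)) ->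
    forall x, P x
}.

Fact tensor_key : unit. Proof. exact: tt. Qed.
Definition the_tensor_product (k : fieldType) (V W : lmodType k) :
    tensor_product V W := locked_with tensor_key
  (@TensorProduct k V W (free_tensor V W : lmodType k) _ (@free_tens_bilin k V W)
    (@free_tlift k V W) (@free_tliftE k V W) (@free_tens_ind k V W)).

Section Tensor.
Variables (k : fieldType) (V W : lmodType k).
Definition tensor : lmodType k := tp_sort (the_tensor_product V W).
Definition tens (v : V) (w : W) : tensor := tp_tens (the_tensor_product V W) v w.
Lemma tens_bilin : bilin tens. Proof. exact: tp_bilin. Qed.
Definition tlift (U : lmodType k) (f : V -> W -> U) (bf : bilin f) :
  {linear tensor -> U} := tp_lift (the_tensor_product V W) bf.
Lemma tliftE (U : lmodType k) (f : V -> W -> U) (bf : bilin f) v w :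
  tlift bf (tens v w) = f v w.
Proof. exact: tp_liftE. Qed.
Lemma tens_ind (P : tensor -> Prop) :
  (forall v w, P (tens v w)) -> (forall x y, P x -> P y -> P (x + y)) ->
  forall x, P x.
Proof. exact: tp_ind. Qed.
Lemma tens_ext (U : lmodType k) (f g : {linear tensor -> U}) :
  (forall v w, f (tens v w) = g (tens v w)) -> f =1 g.
Proof.
by move=> fg; elim/tens_ind=> // x y fgx fgy; rewrite !raddfD; congr (_ + _).
Qed.
End Tensor.

Notation "v ⊗ w" := (tens v w) (at level 39, left associativity).

Section TensorMaps.
Variable k : fieldType.

Section Linear.
Variables V W : lmodType k.
Lemma tensPl c (v v' : V) (w : W) : (c *: v + v') ⊗ w = c *: (v ⊗ w) + v' ⊗ w.
Proof. exact: (tens_bilin V W).1. Qed.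
Lemma tensPr c (v : V) (w w' : W) : v ⊗ (c *: w + w') = c *: (v ⊗ w) + v ⊗ w'.
Proof. exact: (tens_bilin V W).2. Qed.
Lemma tensDl (v v' : V) (w : W) : (v + v') ⊗ w = v ⊗ w + v' ⊗ w.
Proof. by rewrite -[v]scale1r tensPl !scale1r. Qed.
Lemma tensDr (v : V) (w w' : W) : v ⊗ (w + w') = v ⊗ w + v ⊗ w'.
Proof. by rewrite -[w]scale1r tensPr !scale1r. Qed.
Lemma tensZl c (v : V) (w : W) : (c *: v) ⊗ w = c *: (v ⊗ w).
Proof. exact: (scalable_linear ((tens_bilin V W).1 w)). Qed.
Lemma tensZr c (v : V) (w : W) : v ⊗ (c *: w) = c *: (v ⊗ w).
Proof. exact: (scalable_linear ((tens_bilin V W).2 v)). Qed.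
End Linear.

Section Map.
Variables (V V' W W' : lmodType k) (f : {linear V -> V'}) (g : {linear W -> W'}).
Fact tmap_bilin : bilin (fun v w => f v ⊗ g w).
Proof. by split=> [w a v v'|v a w w']; rewrite linearP /= ?tensPl ?tensPr. Qed.
Definition tmap : {linear tensor V W -> tensor V' W'} := tlift tmap_bilin.
Lemma tmapE v w : tmap (v ⊗ w) = f v ⊗ g w.
Proof. exact: tliftE. Qed.
End Map.

Section Assoc.
Variables U V W : lmodType k.
Fact tassoc_bilin0 (w : W) : bilin (fun (u : U) (v : V) => u ⊗ (v ⊗ w)).
Proof. by split=> [v a u u'|u a v v']; rewrite ?tensPl ?tensPr. Qed.
Fact tassoc_bilin : bilin (fun x w => tlift (tassoc_bilin0 w) x).
Proof.
split=> [w|x] a y z; first exact: linearP.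
elim/tens_ind: x => [u v|x x' IH IH'].
  by rewrite !tliftE !tensPr.
by rewrite !raddfD /= IH IH' addrACA.
Qed.
Definition tassoc : {linear tensor (tensor U V) W -> tensor U (tensor V W)} :=
  tlift tassoc_bilin.
Lemma tassocE u v w : tassoc (u ⊗ v ⊗ w) = u ⊗ (v ⊗ w).
Proof. by rewrite /tassoc !tliftE. Qed.

Fact tassocV_bilin0 (u : U) : bilin (fun (v : V) (w : W) => u ⊗ v ⊗ w).
Proof. by split=> [w a v v'|v a w w']; rewrite ?tensPl ?tensPr ?tensPl. Qed.
Fact tassocV_bilin : bilin (fun u x => tlift (tassocV_bilin0 u) x).
Proof.
split=> [x|u] a y z; last exact: linearP.
elim/tens_ind: x => [v w|x x' IH IH'].
  by rewrite !tliftE !tensPl.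
by rewrite !raddfD /= IH IH' addrACA.
Qed.
Definition tassocV : {linear tensor U (tensor V W) -> tensor (tensor U V) W} :=
  tlift tassocV_bilin.
Lemma tassocVE u v w : tassocV (u ⊗ (v ⊗ w)) = u ⊗ v ⊗ w.
Proof. by rewrite /tassocV !tliftE. Qed.
End Assoc.
End TensorMaps.

Section AlgebraMul.
Variables (k : fieldType) (A : unitalAlgType k).
Fact amul_bilin : bilin (fun x y : A => x * y).
Proof.
split=> [y c x x'|x c y y'].
- by rewrite mulrDl; congr (_ + _); rewrite [RHS]ascaleAl.
- by rewrite mulrDr; congr (_ + _); rewrite [RHS]ascaleAr.
Qed.
Definition tmul : {linear tensor A A -> A} := tlift amul_bilin.
Lemma tmulE x y : tmul (x ⊗ y) = x * y.
Proof. exact: tliftE. Qed.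
End AlgebraMul.
Arguments tmul {k} A.

Section OneSidedMul.
Variables (k : fieldType) (A : unitalAlgType k) (a : A).
Definition amull (x : A) : A := a * x.
Definition amulr (x : A) : A := x * a.
Fact amull_linear : linear amull. Proof. exact: (amul_bilin A).2. Qed.
Fact amulr_linear : linear amulr. Proof. exact: (amul_bilin A).1. Qed.
HB.instance Definition _ := GRing.isLinear.Build k A A *:%R amull amull_linear.
HB.instance Definition _ := GRing.isLinear.Build k A A *:%R amulr amulr_linear.
End OneSidedMul.

(* distrMl: R o (mu_B ⊗ A) = (A ⊗ mu_B)(R ⊗ B)(B ⊗ R);
   distrMr: R o (B ⊗ mu_A) = (mu_A ⊗ B)(A ⊗ R)(R ⊗ A). *)
Record distr_law (k : fieldType) (A B : unitalAlgType k) := DistrLaw {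
  distr_map :> {linear tensor B A -> tensor A B};
  distr1r : forall b : B, distr_map (b ⊗ (1 : A)) = (1 : A) ⊗ b;
  distr1l : forall a : A, distr_map ((1 : B) ⊗ a) = a ⊗ (1 : B);
  distrMl : forall x : tensor (tensor B B) A,
    distr_map (tmap (tmul B) idfun x) =
    tmap idfun (tmul B)
      (tassoc A B B (tmap distr_map idfun
        (tassocV B A B (tmap idfun distr_map (tassoc B B A x)))));
  distrMr : forall x : tensor B (tensor A A),
    distr_map (tmap idfun (tmul A) x) =
    tmap (tmul A) idfun
      (tassocV A A B (tmap idfun distr_map
        (tassoc A B A (tmap distr_map idfun (tassocV B A A x)))))
}.

Section SmashMul.
Variables (k : fieldType) (A B : unitalAlgType k) (R : distr_law A B).

(* (mu_A ⊗ mu_B)(A ⊗ R ⊗ B) *)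
Definition smash_mul_map :
    {linear tensor (tensor A B) (tensor A B) -> tensor A B} :=
  tmap (tmul A) (tmul B)
  \o tassocV A A (tensor B B)
  \o tmap idfun (tassoc A B B \o tmap R idfun \o tassocV B A B)
  \o tassoc A B (tensor A B).
Definition smash_mul (x y : tensor A B) : tensor A B := smash_mul_map (x ⊗ y).

Definition smash_act (a : A) (b : B) : {linear tensor A B -> tensor A B} :=
  tmap (amull a) (amulr b).

Lemma smash_mulE a b a' b' :
  smash_mul (a ⊗ b) (a' ⊗ b') = smash_act a b' (R (b ⊗ a')).
Proof.
rewrite /smash_mul /smash_mul_map /= tassocE tmapE /= tassocVE tmapE /=.
elim/tens_ind: (R _) => [x y|x y IHx IHy].
  by rewrite tassocE tassocVE tmapE !tmulE tmapE.
by rewrite tensDl raddfD tensDr !raddfD; congr (_ + _).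
Qed.

Lemma smash_mulDl x y z : smash_mul (x + y) z = smash_mul x z + smash_mul y z.
Proof. by rewrite /smash_mul tensDl raddfD. Qed.
Lemma smash_mulDr x y z : smash_mul x (y + z) = smash_mul x y + smash_mul x z.
Proof. by rewrite /smash_mul tensDr raddfD. Qed.

Lemma smash_mulZl c x y : c *: smash_mul x y = smash_mul (c *: x) y.
Proof. by rewrite /smash_mul tensZl linearZ. Qed.
Lemma smash_mulZr c x y : c *: smash_mul x y = smash_mul x (c *: y).
Proof. by rewrite /smash_mul tensZr linearZ. Qed.

Lemma smash_actE a b a' b' : smash_act a b (a' ⊗ b') = (a * a') ⊗ (b' * b).
Proof. exact: tmapE. Qed.
Lemma smash_actA a b a' b' x :
  smash_act a b (smash_act a' b' x) = smash_act (a * a') (b' * b) x.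
Proof.
elim/tens_ind: x => [v w|x y IHx IHy]; last by rewrite !raddfD; congr (_ + _).
by rewrite !smash_actE !mulrA.
Qed.
Lemma smash_act1 x : smash_act 1 1 x = x.
Proof.
elim/tens_ind: x => [v w|x y IHx IHy]; last by rewrite raddfD; congr (_ + _).
by rewrite smash_actE mul1r mulr1.
Qed.
Lemma smash_act_mul a b x y :
  smash_act a b (smash_mul x y) = smash_mul (smash_act a 1 x) (smash_act 1 b y).
Proof.
elim/tens_ind: x => [a1 b1|x x' IH IH']; last first.
  by rewrite smash_mulDl !raddfD smash_mulDl; congr (_ + _).
elim/tens_ind: y => [a2 b2|y y' IH IH']; last first.
  by rewrite smash_mulDr !raddfD smash_mulDr; congr (_ + _).
by rewrite smash_mulE !smash_actE smash_mulE smash_actA mulr1 mul1r.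
Qed.

Lemma distrMlE (b b' : B) (a : A) : R ((b * b') ⊗ a) = smash_mul ((1 : A) ⊗ b) (R (b' ⊗ a)).
Proof.
have := distrMl R (b ⊗ b' ⊗ a).
rewrite tmapE tmulE tassocE tmapE => ->.
elim/tens_ind: (R (b' ⊗ a)) => [x y|x y IHx IHy]; last first.
  by rewrite smash_mulDr -IHx -IHy /= tensDr !raddfD.
rewrite /= smash_mulE tassocVE tmapE.
elim/tens_ind: (R (b ⊗ x)) => [u v|u v IHu IHv].
  by rewrite tassocE tmapE tmulE smash_actE mul1r.
by rewrite tensDl !raddfD; congr (_ + _).
Qed.
Lemma distrMrE (b : B) (a a' : A) : R (b ⊗ (a * a')) = smash_mul (R (b ⊗ a)) (a' ⊗ (1 : B)).
Proof.
have := distrMr R (b ⊗ (a ⊗ a')).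
rewrite tmapE tmulE tassocVE tmapE => ->.
elim/tens_ind: (R (b ⊗ a)) => [x y|x y IHx IHy]; last first.
  by rewrite smash_mulDl -IHx -IHy /= tensDl !raddfD.
rewrite /= smash_mulE tassocE tmapE.
elim/tens_ind: (R (y ⊗ a')) => [u v|u v IHu IHv].
  by rewrite tassocVE tmapE tmulE smash_actE mulr1.
by rewrite tensDr !raddfD; congr (_ + _).
Qed.

Lemma smash_mul_tens (a1 : A) (b1 : B) y :
  smash_mul (a1 ⊗ b1) y = smash_act a1 1 (smash_mul ((1 : A) ⊗ b1) y).
Proof.
rewrite smash_act_mul smash_act1; congr smash_mul.
by rewrite smash_actE !mulr1.
Qed.
Lemma smash_mul_tensr y (a1 : A) (b1 : B) :
  smash_mul y (a1 ⊗ b1) = smash_act 1 b1 (smash_mul y (a1 ⊗ (1 : B))).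
Proof.
rewrite smash_act_mul smash_act1; congr smash_mul.
by rewrite smash_actE !mul1r.
Qed.

Fact smash_mulA : associative smash_mul.
Proof.
move=> x y z.
elim/tens_ind: x => [a b|x x' IH IH']; last by rewrite !smash_mulDl IH IH'.
elim/tens_ind: y => [a' b'|y y' IH IH']; last first.
  by rewrite !smash_mulDl !smash_mulDr smash_mulDl IH IH'.
elim/tens_ind: z => [a'' b''|z z' IH IH']; last by rewrite !smash_mulDr IH IH'.
rewrite (smash_mulE a') (smash_mulE a).
transitivity (smash_act a b'' (smash_mul (R (b ⊗ a')) (R (b' ⊗ a'')))).
  elim/tens_ind: (R (b' ⊗ a'')) => [a2 b2|s s' IH IH']; last first.
    by rewrite smash_mulDr !raddfD smash_mulDr; congr (_ + _).
  rewrite smash_actE smash_mulE distrMrE (smash_mul_tensr (R _) a2 b2).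
  by rewrite smash_actA mulr1.
elim/tens_ind: (R (b ⊗ a')) => [a1 b1|s s' IH IH']; last first.
  by rewrite smash_mulDl !raddfD smash_mulDl; congr (_ + _).
rewrite smash_actE smash_mulE distrMlE (smash_mul_tens a1).
by rewrite smash_actA mul1r.
Qed.
Fact smash_mul1l : left_id ((1 : A) ⊗ (1 : B)) smash_mul.
Proof.
move=> x; elim/tens_ind: x => [a b|x y IHx IHy]; last by rewrite smash_mulDr IHx IHy.
by rewrite smash_mulE distr1l smash_actE !mul1r.
Qed.
Fact smash_mul1r : right_id ((1 : A) ⊗ (1 : B)) smash_mul.
Proof.
move=> x; elim/tens_ind: x => [a b|x y IHx IHy]; last by rewrite smash_mulDl IHx IHy.
by rewrite smash_mulE distr1r smash_actE !mulr1.
Qed.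

Definition smash of distr_law A B : Type := tensor A B.
Local Notation S := (smash R).
HB.instance Definition _ := GRing.Lmodule.on S.
HB.instance Definition _ := isUnitalAlgebra.Build k S
  smash_mulA smash_mul1l smash_mul1r smash_mulDl smash_mulDr smash_mulZl smash_mulZr.
End SmashMul.

Record bimodule (k : fieldType) (C : unitalAlgType k) := Bimodule {
  bim_sort :> lmodType k;
  lact : C -> bim_sort -> bim_sort;
  ract : bim_sort -> C -> bim_sort;
  lact_bilin : bilin lact;
  ract_bilin : bilin ract;
  lact1 : forall w, lact 1 w = w;
  ract1 : forall w, ract w 1 = w;
  lactM : forall c d w, lact (c * d) w = lact c (lact d w);
  ractM : forall w c d, ract w (c * d) = ract (ract w c) d;
  lractA : forall c w d, ract (lact c w) d = lact c (ract w d)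
}.

Section LinearAct.
Variables (k : fieldType) (C : unitalAlgType k) (W : bimodule C) (c : C).
Definition lact_by (w : W) : W := lact c w.
Fact lact_by_linear : linear lact_by. Proof. exact: (lact_bilin W).2. Qed.
HB.instance Definition _ := GRing.isLinear.Build k W W *:%R lact_by lact_by_linear.
Definition ract_by (w : W) : W := ract w c.
Fact ract_by_linear : linear ract_by. Proof. exact: (ract_bilin W).1. Qed.
HB.instance Definition _ := GRing.isLinear.Build k W W *:%R ract_by ract_by_linear.
End LinearAct.
Arguments lact_by {k C} W c w.
Arguments ract_by {k C} W c w.

Section Chains.
Variables (k : fieldType) (C W : lmodType k).

(* W ⊗ C^n, nested to the left: ((w ⊗ c_1) ⊗ c_2) ⊗ ... *)
Fixpoint CH (n : nat) : lmodType k :=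
  if n is m.+1 then tensor (CH m) C else W.

(* C^n ⊗ W, nested to the right: c_1 ⊗ (c_2 ⊗ (... ⊗ w)) *)
Fixpoint CHr (n : nat) : lmodType k :=
  if n is m.+1 then tensor C (CHr m) else W.

Fixpoint CH_map (f : {linear W -> W}) n : {linear CH n -> CH n} :=
  if n is m.+1 then tmap (CH_map f m) idfun else f.

Fixpoint CHr_map (f : {linear W -> W}) n : {linear CHr n -> CHr n} :=
  if n is m.+1 then tmap idfun (CHr_map f m) else f.

Lemma CH_map_linear (D : lmodType k) (f : D -> {linear W -> W}) n x :
  (forall w, linear (fun d => f d w)) -> linear (fun d => CH_map (f d) n x).
Proof.
move=> lf; elim: n x => [|n IH] x; first exact: lf.
move=> a d d'; elim/tens_ind: x => [y c|y y' IHy IHy'].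
  by rewrite /= !tmapE IH tensPl.
by rewrite !raddfD addrACA; congr (_ + _).
Qed.
Lemma CHr_map_linear (D : lmodType k) (f : D -> {linear W -> W}) n x :
  (forall w, linear (fun d => f d w)) -> linear (fun d => CHr_map (f d) n x).
Proof.
move=> lf; elim: n x => [|n IH] x; first exact: lf.
move=> a d d'; elim/tens_ind: x => [c y|y y' IHy IHy'].
  by rewrite /= !tmapE IH tensPr.
by rewrite !raddfD addrACA; congr (_ + _).
Qed.
End Chains.

Section Hochschild.
Variables (k : fieldType) (C : unitalAlgType k) (W : bimodule C).
Local Notation CH := (CH C W).

(* w ⊗ ... ⊗ c_n ⊗ c |-> w ⊗ ... ⊗ c_n c (and w ⊗ c |-> w c when n = 0) *)
Fixpoint mul_last n : {linear tensor (CH n) C -> CH n} :=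
  if n is m.+1 then tmap idfun (tmul C) \o tassoc (CH m) C C
  else tlift (ract_bilin W).

(* w ⊗ c_1 ⊗ ... ⊗ c_n ⊗ c |-> c w ⊗ c_1 ⊗ ... ⊗ c_n *)
Fact cyclic_face_bilin n : bilin (fun (x : CH n) (c : C) => CH_map C (lact_by W c) n x).
Proof.
split=> [c|x]; first exact: linearP.
by apply: CH_map_linear => w; apply: (lact_bilin W).1.
Qed.
Definition cyclic_face n : {linear tensor (CH n) C -> CH n} :=
  tlift (cyclic_face_bilin n).

(* The i-th face, meaningful for i <= n.+1; see face_chain and hoch_diff_chain
   for its values on pure tensors. *)
Fixpoint face n (i : nat) : {linear tensor (CH n) C -> CH n} :=
  match n with
  | 0 => if i == 0 then mul_last 0 else cyclic_face 0
  | m.+1 => if (i < m.+1)%N then tmap (face m i) idfun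
            else if i == m.+1 then mul_last m.+1 else cyclic_face m.+1
  end.

Definition hoch_diff n (x : CH n.+1) : CH n :=
  \sum_(i < n.+2) (-1) ^+ i *: face n i x.
Fact hoch_diff_linear n : linear (@hoch_diff n).
Proof.
move=> a x y; rewrite /hoch_diff scaler_sumr -big_split; apply: eq_bigr => i _ /=.
by rewrite linearP scalerDr !scalerA mulrC.
Qed.
HB.instance Definition _ n :=
  GRing.isLinear.Build k (CH n.+1) (CH n) *:%R (@hoch_diff n) (@hoch_diff_linear n).

Definition hoch_out n : {linear CH n -> CH n.-1} :=
  if n is m.+1 then (@hoch_diff m : {linear _ -> _}) else \0.

Definition HH n : lmodType k :=
  homology (@hoch_diff n : {linear CH n.+1 -> CH n}) (hoch_out n).

(* chain w c n = w ⊗ c 0 ⊗ ... ⊗ c n.-1 *)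
Fixpoint chain (w : W) (c : nat -> C) n : CH n :=
  if n is m.+1 then chain w c m ⊗ c m else w.
Definition hoch_merge (i : nat) (c : nat -> C) (j : nat) : C :=
  if (j < i)%N then c j else if j == i then c i * c i.+1 else c j.+1.

Lemma eq_chain w c c' n : (forall i, (i < n)%N -> c i = c' i) -> chain w c n = chain w c' n.
Proof.
elim: n => //= n IH cc'; rewrite cc' // IH // => i lt_in.
by apply: cc'; apply: ltnW.
Qed.
Lemma CH_map_chain f w c n : CH_map C f n (chain w c n) = chain (f w) c n.
Proof. by elim: n => //= n IH; rewrite tmapE IH. Qed.
Lemma face_chain n i w c : (i <= n.+1)%N ->
  face n i (chain w c n.+1) =
    if i == 0%N then chain (ract w (c 0%N)) (fun j => c j.+1) n
    else if (i <= n)%N then chain w (hoch_merge i.-1 c) n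
    else chain (lact (c n) w) c n.
Proof.
elim: n i => [|n IH] i le_in.
  by case: i le_in => [|[|//]] _ /=; rewrite /cyclic_face tliftE.
rewrite [face _ _]/=.
case: (ltngtP i n.+1) le_in => [lt_in _|gt_in le_in|eq_i _].
- rewrite [chain _ _ _.+2]/= tmapE (IH _ (ltnW lt_in)) -ltnS lt_in /=.
  case: (eqVneq i 0%N) => [//|i0]; rewrite /= /hoch_merge.
  have lt1 : (i.-1 < n)%N by case: i i0 lt_in.
  by rewrite ltnNge (ltnW lt1) /= gtn_eqF.
- have {gt_in le_in} -> : i = n.+2 by apply/eqP; rewrite eqn_leq le_in.
  by rewrite /= /cyclic_face tliftE CH_map_chain.
- rewrite eq_i /= tassocE tmapE tmulE /= /hoch_merge /= ltnn eqxx.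
  by congr (_ ⊗ _); apply: eq_chain => j ->.
Qed.
Lemma hoch_diff_chain n w c :
  hoch_diff (chain w c n.+1) =
    chain (ract w (c 0%N)) (fun j => c j.+1) n
    + \sum_(i < n) (-1) ^+ i.+1 *: chain w (hoch_merge i c) n
    + (-1) ^+ n.+1 *: chain (lact (c n) w) c n.
Proof.
rewrite /hoch_diff big_ord_recr big_ord_recl /= !face_chain // ltnn expr0 scale1r.
congr (_ + _ + _); apply: eq_bigr => i _.
have lt_in := ltn_ord i; rewrite face_chain /= /bump /= add1n.
  by rewrite /= lt_in.
by rewrite ltnW.
Qed.
End Hochschild.

Section Restriction.
Variables (k : fieldType) (C D : unitalAlgType k) (f : C -> D).
Hypotheses (fL : linear f) (f1 : f 1 = 1) (fM : forall c d, f (c * d) = f c * f d).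
Variable W : bimodule D.
Fact res_lact_bilin : bilin (fun c (w : W) => lact (f c) w).
Proof.
split=> [w a c c'|c]; last exact: (lact_bilin W).2.
by rewrite fL (lact_bilin W).1.
Qed.
Fact res_ract_bilin : bilin (fun (w : W) c => ract w (f c)).
Proof.
split=> [c|w a c c']; first exact: (ract_bilin W).1.
by rewrite fL (ract_bilin W).2.
Qed.
Fact res_lact1 (w : W) : lact (f 1) w = w. Proof. by rewrite f1 lact1. Qed.
Fact res_ract1 (w : W) : ract w (f 1) = w. Proof. by rewrite f1 ract1. Qed.
Fact res_lactM c d (w : W) : lact (f (c * d)) w = lact (f c) (lact (f d) w).
Proof. by rewrite fM lactM. Qed.
Fact res_ractM (w : W) c d : ract w (f (c * d)) = ract (ract w (f c)) (f d).
Proof. by rewrite fM ractM. Qed.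
Definition res_bimodule : bimodule C :=
  Bimodule res_lact_bilin res_ract_bilin res_lact1 res_ract1 res_lactM res_ractM
    (fun c w d => lractA (f c) w (f d)).
End Restriction.

Section SmashSub.
Variables (k : fieldType) (A B : unitalAlgType k) (R : distr_law A B).
Local Notation S := (smash R : unitalAlgType k).
Definition smash_inl (a : A) : smash R := a ⊗ (1 : B).
Definition smash_inr (b : B) : smash R := (1 : A) ⊗ b.
Fact smash_inl_linear : linear smash_inl. Proof. exact: (tens_bilin A B).1. Qed.
Fact smash_inr_linear : linear smash_inr. Proof. exact: (tens_bilin A B).2. Qed.
Fact smash_inl1 : smash_inl 1 = (1 : S). Proof. by []. Qed.
Fact smash_inr1 : smash_inr 1 = (1 : S). Proof. by []. Qed.
Fact smash_inlM a a' : smash_inl (a * a') = (smash_inl a : S) * smash_inl a'.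
Proof. by rewrite [RHS]smash_mulE distr1l smash_actE mulr1. Qed.
Fact smash_inrM b b' : smash_inr (b * b') = (smash_inr b : S) * smash_inr b'.
Proof. by rewrite [RHS]smash_mulE distr1r smash_actE mulr1. Qed.
Definition resA (V : bimodule (smash R)) : bimodule A :=
  res_bimodule smash_inl_linear smash_inl1 smash_inlM V.
Definition resB (V : bimodule (smash R)) : bimodule B :=
  res_bimodule smash_inr_linear smash_inr1 smash_inrM V.
End SmashSub.

(* The A-bimodule CH_p(B, W): a acts on the left of W; on the right, a is moved
   by R to the left across b_p, ..., b_1 before acting on the right of W. *)
Section ABimodule.
Variables (k : fieldType) (A B : unitalAlgType k) (R : distr_law A B).
Variable W : bimodule A.
Local Notation CH := (CH B W).

Fixpoint CH_ract_map p : {linear tensor (CH p) A -> CH p} :=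
  if p is n.+1 then
    tmap (CH_ract_map n) idfun \o tassocV (CH n) A B
    \o tmap idfun R \o tassoc (CH n) B A
  else tlift (ract_bilin W).

Definition CH_ract p (x : CH p) (a : A) : CH p := CH_ract_map p (x ⊗ a).
Definition CH_lact p (a : A) (x : CH p) : CH p := CH_map B (lact_by W a) p x.

Fact CH_ract_bilin p : bilin (@CH_ract p).
Proof. by split=> [a c x y|x c a a']; rewrite /CH_ract ?tensPl ?tensPr linearP. Qed.
Fact CH_lact_bilin p : bilin (@CH_lact p).
Proof.
split=> [x|a]; last exact: linearP.
by apply: CH_map_linear => w; apply: (lact_bilin W).1.
Qed.

Definition CH_slide p (x : CH p) (t : tensor A B) : tensor (CH p) B :=
  tmap (CH_ract_map p) idfun (tassocV (CH p) A B (x ⊗ t)).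
Lemma CH_slideE p (x : CH p) (a : A) (b : B) : CH_slide x (a ⊗ b) = CH_ract x a ⊗ b.
Proof. by rewrite /CH_slide tassocVE tmapE. Qed.
Lemma CH_slideD p (x : CH p) t t' : CH_slide x (t + t') = CH_slide x t + CH_slide x t'.
Proof. by rewrite /CH_slide tensDr !raddfD. Qed.
Lemma CH_ractS p (x : CH p) (b : B) (a : A) :
  @CH_ract p.+1 (x ⊗ b) a = CH_slide x (R (b ⊗ a)).
Proof. by rewrite /CH_ract /= tassocE tmapE. Qed.
Lemma CH_ractD p (x y : CH p) a : CH_ract (x + y) a = CH_ract x a + CH_ract y a.
Proof. by rewrite /CH_ract tensDl raddfD. Qed.
Lemma CH_lactD p a (x y : CH p) : CH_lact a (x + y) = CH_lact a x + CH_lact a y.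
Proof. exact: raddfD. Qed.
Lemma CH_lactS p (x : CH p) (b : B) (a : A) :
  @CH_lact p.+1 a (x ⊗ b) = CH_lact a x ⊗ b.
Proof. by rewrite /CH_lact /= tmapE. Qed.
Lemma CH_ract0 (x : W) a : @CH_ract 0 x a = ract x a.
Proof. exact: tliftE. Qed.

Fact CH_lact1 p (x : CH p) : CH_lact 1 x = x.
Proof.
elim: p x => [|p IH] x; first exact: lact1.
elim/tens_ind: x => [x b|x y IHx IHy]; first by rewrite CH_lactS IH.
by rewrite CH_lactD IHx IHy.
Qed.
Fact CH_ract1 p (x : CH p) : CH_ract x 1 = x.
Proof.
elim: p x => [|p IH] x; first by rewrite CH_ract0 ract1.
elim/tens_ind: x => [x b|x y IHx IHy]; last by rewrite CH_ractD IHx IHy.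
by rewrite CH_ractS distr1r CH_slideE IH.
Qed.
Fact CH_lactM p a a' (x : CH p) : CH_lact (a * a') x = CH_lact a (CH_lact a' x).
Proof.
elim: p x => [|p IH] x; first exact: lactM.
elim/tens_ind: x => [x b|x y IHx IHy]; first by rewrite !CH_lactS IH.
by rewrite !CH_lactD IHx IHy.
Qed.
Fact CH_ractM p (x : CH p) a a' : CH_ract x (a * a') = CH_ract (CH_ract x a) a'.
Proof.
elim: p x a a' => [|p IH] x a a'; first by rewrite !CH_ract0 ractM.
elim/tens_ind: x => [x b|x y IHx IHy]; last by rewrite !CH_ractD IHx IHy.
rewrite !CH_ractS distrMrE.
elim/tens_ind: (R (b ⊗ a)) => [a1 b1|s s' IHs IHs']; last first.
  by rewrite smash_mulDl !CH_slideD CH_ractD; congr (_ + _).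
rewrite CH_slideE CH_ractS smash_mulE.
elim/tens_ind: (R (b1 ⊗ a')) => [a2 b2|s s' IHs IHs']; last first.
  by rewrite raddfD !CH_slideD; congr (_ + _).
by rewrite smash_actE !CH_slideE IH mulr1.
Qed.
Fact CH_lractA p a (x : CH p) a' : CH_ract (CH_lact a x) a' = CH_lact a (CH_ract x a').
Proof.
elim: p x a' => [|p IH] x a'; first by rewrite !CH_ract0; exact: lractA.
elim/tens_ind: x => [x b|x y IHx IHy]; last first.
  by rewrite CH_lactD !CH_ractD CH_lactD IHx IHy.
rewrite CH_lactS !CH_ractS.
elim/tens_ind: (R (b ⊗ a')) => [a1 b1|s s' IHs IHs']; last first.
  by rewrite !CH_slideD CH_lactD IHs IHs'.
by rewrite !CH_slideE CH_lactS IH.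
Qed.

Definition CH_bimodule p : bimodule A :=
  Bimodule (@CH_lact_bilin p) (@CH_ract_bilin p) (@CH_lact1 p) (@CH_ract1 p)
    (@CH_lactM p) (@CH_ractM p) (@CH_lractA p).
End ABimodule.

(* The B-bimodule CH_q(A, W), written A^q ⊗ W: b acts on the right of W; on the
   left, b is moved by R to the right across a_1, ..., a_q before acting on the
   left of W. *)
Section BBimodule.
Variables (k : fieldType) (A B : unitalAlgType k) (R : distr_law A B).
Variable W : bimodule B.
Local Notation CHr := (CHr A W).

Fixpoint CHr_lact_map q : {linear tensor B (CHr q) -> CHr q} :=
  if q is n.+1 then
    tmap idfun (CHr_lact_map n) \o tassoc A B (CHr n)
    \o tmap R idfun \o tassocV B A (CHr n)
  else tlift (lact_bilin W).

Definition CHr_lact q (b : B) (x : CHr q) : CHr q := CHr_lact_map q (b ⊗ x).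
Definition CHr_ract q (x : CHr q) (b : B) : CHr q := CHr_map A (ract_by W b) q x.

Fact CHr_lact_bilin q : bilin (@CHr_lact q).
Proof. by split=> [x c b b'|b c x x']; rewrite /CHr_lact ?tensPl ?tensPr linearP. Qed.
Fact CHr_ract_bilin q : bilin (@CHr_ract q).
Proof.
split=> [b|x]; first exact: linearP.
by apply: CHr_map_linear => w; apply: (ract_bilin W).2.
Qed.

Definition CHr_slide q (t : tensor A B) (x : CHr q) : tensor A (CHr q) :=
  tmap idfun (CHr_lact_map q) (tassoc A B (CHr q) (t ⊗ x)).
Lemma CHr_slideE q (a : A) (b : B) (x : CHr q) :
  CHr_slide (a ⊗ b) x = a ⊗ CHr_lact b x.
Proof. by rewrite /CHr_slide tassocE tmapE. Qed.
Lemma CHr_slideD q (x : CHr q) t t' :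
  CHr_slide (t + t') x = CHr_slide t x + CHr_slide t' x.
Proof. by rewrite /CHr_slide tensDl !raddfD. Qed.
Lemma CHr_lactS q (x : CHr q) (b : B) (a : A) :
  @CHr_lact q.+1 b (a ⊗ x) = CHr_slide (R (b ⊗ a)) x.
Proof. by rewrite /CHr_lact /= tassocVE tmapE. Qed.
Lemma CHr_lactD q b (x y : CHr q) : CHr_lact b (x + y) = CHr_lact b x + CHr_lact b y.
Proof. by rewrite /CHr_lact tensDr raddfD. Qed.
Lemma CHr_ractD q (x y : CHr q) b : CHr_ract (x + y) b = CHr_ract x b + CHr_ract y b.
Proof. exact: raddfD. Qed.
Lemma CHr_ractS q (x : CHr q) (a : A) (b : B) :
  @CHr_ract q.+1 (a ⊗ x) b = a ⊗ CHr_ract x b.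
Proof. by rewrite /CHr_ract /= tmapE. Qed.
Lemma CHr_lact0 b (x : W) : @CHr_lact 0 b x = lact b x.
Proof. exact: tliftE. Qed.

Fact CHr_ract1 q (x : CHr q) : CHr_ract x 1 = x.
Proof.
elim: q x => [|q IH] x; first exact: ract1.
elim/tens_ind: x => [a x|x y IHx IHy]; first by rewrite CHr_ractS IH.
by rewrite CHr_ractD IHx IHy.
Qed.
Fact CHr_lact1 q (x : CHr q) : CHr_lact 1 x = x.
Proof.
elim: q x => [|q IH] x; first by rewrite CHr_lact0 lact1.
elim/tens_ind: x => [a x|x y IHx IHy]; last by rewrite CHr_lactD IHx IHy.
by rewrite CHr_lactS distr1l CHr_slideE IH.
Qed.
Fact CHr_ractM q (x : CHr q) b b' : CHr_ract x (b * b') = CHr_ract (CHr_ract x b) b'.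
Proof.
elim: q x => [|q IH] x; first exact: ractM.
elim/tens_ind: x => [a x|x y IHx IHy]; first by rewrite !CHr_ractS IH.
by rewrite !CHr_ractD IHx IHy.
Qed.
Fact CHr_lactM q b b' (x : CHr q) : CHr_lact (b * b') x = CHr_lact b (CHr_lact b' x).
Proof.
elim: q x b b' => [|q IH] x b b'; first by rewrite !CHr_lact0 lactM.
elim/tens_ind: x => [a x|x y IHx IHy]; last by rewrite !CHr_lactD IHx IHy.
rewrite !CHr_lactS distrMlE.
elim/tens_ind: (R (b' ⊗ a)) => [a1 b1|s s' IHs IHs']; last first.
  by rewrite smash_mulDr !CHr_slideD CHr_lactD; congr (_ + _).
rewrite CHr_slideE CHr_lactS smash_mulE.
elim/tens_ind: (R (b ⊗ a1)) => [a2 b2|s s' IHs IHs']; last first.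
  by rewrite raddfD !CHr_slideD; congr (_ + _).
by rewrite smash_actE !CHr_slideE IH mul1r.
Qed.
Fact CHr_lractA q b (x : CHr q) b' :
  CHr_ract (CHr_lact b x) b' = CHr_lact b (CHr_ract x b').
Proof.
elim: q x b => [|q IH] x b; first by rewrite !CHr_lact0; exact: lractA.
elim/tens_ind: x => [a x|x y IHx IHy]; last first.
  by rewrite CHr_ractD !CHr_lactD CHr_ractD IHx IHy.
rewrite CHr_ractS !CHr_lactS.
elim/tens_ind: (R (b ⊗ a)) => [a1 b1|s s' IHs IHs']; last first.
  by rewrite !CHr_slideD CHr_ractD IHs IHs'.
by rewrite !CHr_slideE CHr_ractS IH.
Qed.

Definition CHr_bimodule q : bimodule B :=
  Bimodule (@CHr_lact_bilin q) (@CHr_ract_bilin q) (@CHr_lact1 q) (@CHr_ract1 q)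
    (@CHr_lactM q) (@CHr_ractM q) (@CHr_lractA q).
End BBimodule.

Definition lin_iso (k : fieldType) (U V : lmodType k) : Prop :=
  exists f : {linear U -> V}, bijective f.

(* A homological spectral sequence, with pages r >= 1 (page 0 is irrelevant) and
   d^r of bidegree (-r, r - 1), the first index p being the filtration degree.
   A spectral sequence filtered by its second degree, with d^r of bidegree
   (r - 1, -r), is represented with its two indices exchanged.
   The differential is given between all pairs of positions and required to
   vanish outside of this bidegree, which avoids casts along equations of
   indices. *)
Record spectral_sequence (k : fieldType) := SpectralSequence {
  page :> nat -> int -> int -> lmodType k;
  diff : forall r p q p' q', {linear page r p q -> page r p' q'};
  diff_shape : forall r p q p' q', (0 < r)%N ->
    ~ (p' = p - r%:Z /\ q' = q + r%:Z - 1) ->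
    forall x, diff r p q p' q' x = 0;
  diff_diff : forall r p q p' q' p'' q'', (0 < r)%N ->
    forall x, diff r p' q' p'' q'' (diff r p q p' q' x) = 0;
  page_next : forall r p q, (0 < r)%N ->
    lin_iso (page r.+1 p q)
      (homology (diff r (p + r%:Z) (q - r%:Z + 1) p q)
                (diff r p q (p - r%:Z) (q + r%:Z - 1)))
}.

Definition first_quadrant (k : fieldType) (E : spectral_sequence k) : Prop :=
  forall p q : int, (p < 0) || (q < 0) -> forall x : E 1%N p q, x = 0.

(* All differentials into and out of position (p, q) vanish from page r on, so
   that E^r_{p,q} is E^oo_{p,q}. *)
Definition stationary (k : fieldType) (E : spectral_sequence k)
    (r : nat) (p q : int) : Prop :=
  forall s, (r <= s)%N -> forall p' q' : int,
    (forall x, @diff k E s p q p' q' x = 0) /\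
    (forall x, @diff k E s p' q' p q x = 0).

(* Bounded convergence to a graded space H: each H_n has a finite exhaustive
   increasing filtration F with E^oo_{p,n-p} = F_p H_n / F_{p-1} H_n. *)
Definition converges_to (k : fieldType) (E : spectral_sequence k)
    (H : nat -> lmodType k) : Prop :=
  forall n : nat, exists F : int -> submodClosed (H n),
    [/\ forall p x, x \in F p -> x \in F (p + 1),
        exists s, forall x, x \in F s -> x = 0,
        exists t, forall x, x \in F t &
        forall p : int, exists r : nat,
          [/\ (0 < r)%N, stationary E r p (n%:Z - p) &
              lin_iso (E r p (n%:Z - p)) (subquot (F p) (F (p - 1)))]].

(* Main.v *)
Require Import Defs.
From HB Require Import structures.
From mathcomp Require Import all_boot all_algebra.
From mathcomp Require Import boolp.
From mathcomp Require Import zify ring.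
Set Implicit Arguments.
Unset Strict Implicit.
Unset Printing Implicit Defensive.
Import GRing.Theory.
Local Open Scope ring_scope.

(** Write [C] for the smash biproduct. Both spectral sequences come from one
    double complex [D(V)], with [D_{p,q}(V) = V ⊗ B^p ⊗ A^q] ([smash_dc]). Its
    [q]-direction is the Hochschild complex of [A] with coefficients in
    [CH_p(B, V)]. Its [p]-direction is, after rotating the factors
    ([row_iso_d]), the Hochschild complex of [B] with coefficients in
    [CH_q(A, V)]: all faces but the last are induced by maps of [A]-bimodules
    between the coefficients, and the last one carries [b_p] across
    [a_1, ..., a_q] by [R] before it acts on [V]. That the two directions are
    compatible is the content of [bbar_ract] and [last_face_hoch]; it comes
    down to the compatibility of [R] with the two products and to the product
    of [C].

    The total complex has two filtrations, by [p] and by [q]. Each gives a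
    first-quadrant spectral sequence whose [E^1] is the homology in one
    direction ([tot_ss_E1]) and which converges to the total homology
    ([tot_ss_converges]). What remains is that the total homology of [D(V)] is
    [H(C, V)] ([smash_tot_hoch]).

    For this, resolve [V] by the bimodules [F_m = V ⊗ C^(m+1)], with [C] acting
    on the left of [V] and on the right of the last factor, and with the bar
    differential; [y |-> y ⊗ 1] contracts this resolution. Consider the triple
    complex [D(F_m)], as a double complex [res_dc] with entries [Tot_n D(F_m)].
    - For fixed [n] it is exact in [m], since [D] is additive and the
      contraction is linear; what it resolves is [Tot_n D(V)].
    - For fixed [m] it is exact in [n]: as a right module
      [F_m = M ⊗ C = (M ⊗ A) ⊗ B] with [M = V ⊗ C^m], so inserting a unit
      contracts first the [B]-direction, leaving [CH(A, M ⊗ A)], and then the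
      [A]-direction, leaving [M] in degree [0]. The map [F_m -> M] is the last,
      cyclic face of Hochschild chains, so the differential that the bar
      differential induces on [V ⊗ C^m] is the Hochschild differential.
    The total homology of [res_dc] is therefore at once that of [D(V)] and
    [H(C, V)]. *)

(** * Isomorphisms of subquotients *)

Section LinearIsomorphisms.
Variable k : fieldType.
Implicit Types U V W : lmodType k.

Lemma lin_iso_sym U V : lin_iso U V -> lin_iso V U.
Proof.
case=> f [g fK gK].
have gL : linear g.
  by move=> a x y; apply: (can_inj fK); rewrite linearP !gK.
pose h := GRing.isLinear.Build k V U *:%R g gL.
pose g' : {linear V -> U} := HB.pack g h.
by exists g'; exists f.
Qed.

Lemma lin_iso_trans U V W : lin_iso U V -> lin_iso V W -> lin_iso U W.
Proof.
case=> f bf [g bg]; exists (g \o f : {linear U -> W}); exact: bij_comp.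
Qed.

(** Two quotients of one space by the same kernel are isomorphic. Subquotients
    of different spaces are compared in this way when no linear map between
    the ambient spaces is at hand. *)
Lemma lin_iso_surj W U V (f : {linear W -> U}) (g : {linear W -> V}) :
  (forall y, exists x, f x = y) -> (forall y, exists x, g x = y) ->
  (forall x, f x = 0 <-> g x = 0) -> lin_iso U V.
Proof.
move=> /choice[f' f'K] /choice[g' g'K] fg.
have E x x' : f x = f x' -> g x = g x'.
  move=> e; apply/eqP; rewrite -subr_eq0 -linearB; apply/eqP/fg.
  by rewrite linearB e subrr.
have E' x x' : g x = g x' -> f x = f x'.
  move=> e; apply/eqP; rewrite -subr_eq0 -linearB; apply/eqP/fg.
  by rewrite linearB e subrr.
have hL : linear (g \o f').
  by move=> a x y; rewrite /= -linearP; apply: E; rewrite linearP !f'K.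
pose h := GRing.isLinear.Build k U V *:%R (g \o f') hL.
pose h' : {linear U -> V} := HB.pack (g \o f') h.
exists h'; exists (f \o g') => [x|y] /=.
  by rewrite -[RHS]f'K; apply: E'; rewrite g'K.
by rewrite -[RHS]g'K; apply: E; rewrite f'K.
Qed.

End LinearIsomorphisms.

Section SubmodClosed.
Variables (k : fieldType) (U : lmodType k) (S : submodClosed U).
Lemma submodN x : (- x \in S) = (x \in S).
Proof. by apply/idP/idP => xS; [rewrite -[x]opprK|]; rewrite -scaleN1r rpredZ. Qed.
Lemma submodB x y : x \in S -> y \in S -> x - y \in S.
Proof. by move=> xS yS; rewrite rpredD ?submodN. Qed.
End SubmodClosed.

Section SubquotientMaps.
Variables (k : fieldType) (U U' : lmodType k).
Variables (S T : submodClosed U) (S' T' : submodClosed U').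

Definition cls (x : submod S) : subquot S T := lpi (sub_in T) x.
HB.instance Definition _ :=
  GRing.isLinear.Build k (submod S) (subquot S T) *:%R cls (fun a x y => linearP (lpi (sub_in T)) a x y).

Lemma cls_surj y : exists x, cls x = y.
Proof. by exists (lrepr y); apply: lreprK. Qed.
Lemma cls0P (x : submod S) : cls x = 0 <-> val x \in T.
Proof. by split=> [/eqP|xT]; [|apply/eqP]; rewrite /cls lpi_eq0. Qed.

Section Restrict.
Variables (f : {linear U -> U'}) (fS : forall x, x \in S -> f x \in S').
Definition restr (x : submod S) : submod S' := Submod (fS (valP x)).
Fact restr_linear : linear restr.
Proof. by move=> a x y; apply: val_inj; rewrite /= !linearP. Qed.
HB.instance Definition _ :=
  GRing.isLinear.Build k (submod S) (submod S') *:%R restr restr_linear.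
End Restrict.
End SubquotientMaps.
Arguments cls {k U} S T x.

Section SubquotientIso.
Variables (k : fieldType) (U U' : lmodType k).
Variables (S T : submodClosed U) (S' T' : submodClosed U').

Lemma subquot_iso (f : {linear U -> U'}) :
  (forall x, x \in S -> f x \in S') ->
  (forall x, x \in S -> (f x \in T' <-> x \in T)) ->
  (forall y, y \in S' -> exists2 x, x \in S & y - f x \in T') ->
  lin_iso (subquot S T) (subquot S' T').
Proof.
move=> fS fT surj.
apply: (@lin_iso_surj _ (submod S) _ _ (cls S T) (cls S' T' \o restr fS)).
- exact: cls_surj.
- move=> y; have [y' <-] := cls_surj y.
  have [x xS yx] := surj _ (valP y'); exists (Submod xS).
  apply/eqP; rewrite -subr_eq0 /= -linearB; apply/eqP/cls0P => /=.
  by rewrite -opprB submodN.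
- by move=> x; rewrite /= !cls0P /= fT ?(valP x).
Qed.

Section Map.
Variables (f : {linear U -> U'}) (fS : forall x, x \in S -> f x \in S').
Hypothesis fT : forall x, x \in S -> x \in T -> f x \in T'.
Definition subquot_map_fun (x : subquot S T) : subquot S' T' :=
  cls S' T' (restr fS (lrepr x)).
Lemma subquot_map_cls x : subquot_map_fun (cls S T x) = cls S' T' (restr fS x).
Proof.
apply/eqP; rewrite -subr_eq0 -!linearB; apply/eqP/cls0P; apply: fT; first exact: valP.
by apply/cls0P; rewrite linearB; apply/eqP; rewrite subr_eq0; apply/eqP/lreprK.
Qed.
Fact subquot_map_linear : linear subquot_map_fun.
Proof.
move=> a x y; have [x' <-] := cls_surj x; have [y' <-] := cls_surj y.
by rewrite -linearP !subquot_map_cls !linearP.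
Qed.
HB.instance Definition _ := GRing.isLinear.Build k _ _ *:%R subquot_map_fun subquot_map_linear.
Definition subquot_map : {linear subquot S T -> subquot S' T'} := subquot_map_fun.
End Map.
End SubquotientIso.

(** * The spectral sequence of a filtered complex *)

Section Filtered.
Variables (k : fieldType) (T : lmodType k) (d : {linear T -> T}).
Variables (G F : int -> submodClosed T).
Hypothesis dd : forall x, d (d x) = 0.
Hypothesis dG : forall n x, x \in G n -> d x \in G (n - 1).
Hypothesis FS : forall (p p' : int) x, p <= p' -> x \in F p -> x \in F p'.
Hypothesis F_neg : forall (p : int) x, p < 0 -> x \in F p -> x = 0.
Hypothesis F_full : forall n x, x \in G n -> x \in F n.

(** The pages are subquotients of the single space [T], so a differential
    between positions whose indices agree only up to an equation is still a map
    induced by [d]. The submodule [ssB] need not lie in [ssZ]: a subquotient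
    only divides by the intersection. *)
Definition ssZ (r : nat) (p q : int) : {pred T} :=
  fun x => [&& x \in F p, x \in G (p + q) & d x \in F (p - r%:Z)].
Definition ssB (r : nat) (p q : int) : {pred T} := fun x =>
  `[< exists y, [/\ y \in F (p + r%:Z - 1), y \in G (p + q + 1)
                  & x - d y \in F (p - 1)] >].

Lemma ssZP r p q x :
  reflect [/\ x \in F p, x \in G (p + q) & d x \in F (p - r%:Z)] (x \in ssZ r p q).
Proof. exact: and3P. Qed.
Lemma ssBP r p q x :
  reflect (exists y, [/\ y \in F (p + r%:Z - 1), y \in G (p + q + 1)
                  & x - d y \in F (p - 1)]) (x \in ssB r p q).
Proof. exact: asboolP. Qed.

Fact ssZ_closed r p q : submod_closed (ssZ r p q).
Proof.
split; first by apply/ssZP; rewrite raddf0 !rpred0.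
move=> a x y /ssZP[? ? ?] /ssZP[? ? ?]; apply/ssZP.
by rewrite linearP; split; rewrite rpredD ?rpredZ.
Qed.
HB.instance Definition _ r p q :=
  GRing.isSubmodClosed.Build k T (ssZ r p q) (ssZ_closed r p q).
Fact ssB_closed r p q : submod_closed (ssB r p q).
Proof.
split; first by apply/ssBP; exists 0; rewrite raddf0 subr0 !rpred0.
move=> a x y /ssBP[x' [? ? ?]] /ssBP[y' [? ? ?]]; apply/ssBP; exists (a *: x' + y').
rewrite linearP opprD addrACA -scalerBr.
by split; rewrite rpredD ?rpredZ.
Qed.
HB.instance Definition _ r p q :=
  GRing.isSubmodClosed.Build k T (ssB r p q) (ssB_closed r p q).

Definition ss_page r p q : lmodType k := subquot (ssZ r p q) (ssB r p q).
Notation scls r p q := (cls (ssZ r p q) (ssB r p q)).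

Section Diff.
Variables (r : nat) (p q p' q' : int).
Definition diff_cond : Prop := p' = p - r%:Z /\ q' = q + r%:Z - 1.
Lemma ss_dZ (h : diff_cond) x : x \in ssZ r p q -> d x \in ssZ r p' q'.
Proof.
case: h => -> -> /ssZP[xF xG dxF]; apply/ssZP; rewrite dd rpred0; split=> //.
have -> : p - r%:Z + (q + r%:Z - 1) = p + q - 1 by ring.
exact: dG.
Qed.
Lemma ss_dB (h : diff_cond) x : x \in ssZ r p q -> x \in ssB r p q -> d x \in ssB r p' q'.
Proof.
case: h => -> -> /ssZP[xF xG dxF] /ssBP[y [yF yG xyF]]; apply/ssBP; exists (x - d y).
have -> : p - r%:Z + r%:Z - 1 = p - 1 by ring.
have -> : p - r%:Z + (q + r%:Z - 1) + 1 = p + q by ring.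
rewrite linearB dd subr0 subrr rpred0; split=> //.
by rewrite submodB // -[p + q](addrK 1) dG.
Qed.
Definition ss_diff : {linear ss_page r p q -> ss_page r p' q'} :=
  match pselect diff_cond with
  | left h => subquot_map (ss_dZ h) (ss_dB h)
  | right _ => \0
  end.
Lemma ss_diff_cls (h : diff_cond) x : ss_diff (scls r p q x) = scls r p' q' (restr (ss_dZ h) x).
Proof.
rewrite /ss_diff; case: pselect => [h1|//].
rewrite [LHS](subquot_map_cls (ss_dZ h1) (ss_dB h1)).
by congr cls; apply: val_inj.
Qed.
Lemma ss_diff_shape : ~ diff_cond -> forall x, ss_diff x = 0.
Proof. by move=> nh x; rewrite /ss_diff; case: pselect. Qed.
End Diff.

Lemma ss_diff_diff r p q p' q' p'' q'' x :
  ss_diff r p' q' p'' q'' (ss_diff r p q p' q' x) = 0.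
Proof.
have [h|nh] := pselect (diff_cond r p q p' q'); last by rewrite (ss_diff_shape nh) raddf0.
have [h'|nh] := pselect (diff_cond r p' q' p'' q''); last exact: ss_diff_shape.
have [y <-] := cls_surj x; rewrite !ss_diff_cls; apply/cls0P; rewrite /= dd.
exact: rpred0.
Qed.

Lemma ssZS r p q x : x \in ssZ r.+1 p q -> x \in ssZ r p q.
Proof. by case/ssZP=> ? ? ?; apply/ssZP; split=> //; apply: FS; last eassumption; lia. Qed.

(** A class of [E^r] represented by [x] is killed by [d^r] exactly when [d x]
    can be moved into [F (p - r - 1)] by subtracting [d w] with [w] in
    [F (p - 1)]; then [x - w] represents the same class and lies in
    [Z^(r+1)]. *)
Lemma ss_page_next r p q : lin_iso (ss_page r.+1 p q)
  (homology (ss_diff r (p + r%:Z) (q - r%:Z + 1) p q)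
            (ss_diff r p q (p - r%:Z) (q + r%:Z - 1))).
Proof.
set fi := ss_diff r (p + r%:Z) _ p q; set fo := ss_diff r p q _ _.
have ci : diff_cond r (p + r%:Z) (q - r%:Z + 1) p q by split; ring.
have co : diff_cond r p q (p - r%:Z) (q + r%:Z - 1) by [].
have kerP x : (x \in lin_ker fo) = (fo x == 0) by [].
pose lift (x : submod (ssZ r.+1 p q)) : submod (ssZ r p q) :=
  restr (f := idfun) (@ssZS r p q) x.
have liftL : linear lift by move=> a x y; apply: val_inj.
pose h := GRing.isLinear.Build k _ _ *:%R lift liftL.
pose lift' : {linear submod (ssZ r.+1 p q) -> submod (ssZ r p q)} := HB.pack lift h.
pose f : {linear submod (ssZ r.+1 p q) -> ss_page r p q} := scls r p q \o lift'.
have fP x : f x \in lin_ker fo.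
  rewrite kerP; apply/eqP; rewrite /fo /f /= ss_diff_cls; apply/cls0P => /=.
  apply/ssBP; exists 0; rewrite raddf0 subr0 !rpred0; split=> //.
  have /ssZP[_ _] := valP x; apply: FS; lia.
pose g (x : submod (ssZ r.+1 p q)) : submod (lin_ker fo) := Submod (fP x).
have gL : linear g by move=> a x y; apply: val_inj; exact: (linearP f).
pose hg := GRing.isLinear.Build k _ _ *:%R g gL.
pose g' : {linear submod (ssZ r.+1 p q) -> submod (lin_ker fo)} := HB.pack g hg.
apply: (@lin_iso_surj _ _ _ _ (scls r.+1 p q) (cls (lin_ker fo) (lin_im fi) \o g')).
- exact: cls_surj.
- move=> y; have [[x xK] <-] := cls_surj y; have [[z zZ] ez] := cls_surj x.
  have /cls0P/ssBP[w [wF wG dF']] : scls r (p - r%:Z) (q + r%:Z - 1) (restr (ss_dZ co) (Submod zZ)) = 0.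
    by rewrite -ss_diff_cls ez; apply/eqP; rewrite -kerP.
  have /ssZP[zF zG dz] := zZ.
  have zw : z - w \in ssZ r.+1 p q.
    apply/ssZP; split.
    + by rewrite submodB //; apply: FS wF; lia.
    + rewrite submodB //; move: wG; congr (_ \in G _); ring.
    + by rewrite linearB; move: dF'; congr (_ \in F _); rewrite -addn1 PoszD; ring.
  exists (Submod zw); congr cls; apply: val_inj => /=; rewrite -ez /f.
  apply/eqP; rewrite -subr_eq0 /= -linearB; apply/eqP/cls0P => /=.
  apply/ssBP; exists 0; rewrite raddf0 subr0 !rpred0; split=> //.
  by rewrite addrAC subrr add0r submodN; apply: FS wF; lia.
- move=> x; rewrite /= !cls0P /=; have /ssZP[xF xG dxF] := valP x; split.
  + case/ssBP=> y [yF yG xyF]; apply/asboolP.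
    have yZ : y \in ssZ r (p + r%:Z) (q - r%:Z + 1).
      apply/ssZP; split.
      * by apply: FS yF; lia.
      * by move: yG; congr (_ \in G _); ring.
      * have -> : d y = val x - (val x - d y) by rewrite subKr.
        by rewrite submodB //; [apply: FS xF|apply: FS xyF]; lia.
    exists (scls _ _ _ (Submod yZ)); rewrite /fi ss_diff_cls.
    apply/eqP; rewrite -subr_eq0 /= -linearB; apply/eqP/cls0P => /=.
    by apply/ssBP; exists 0; rewrite raddf0 subr0 -(opprB (val x)) submodN !rpred0.
  + case/asboolP=> y; have [[y' yZ] <-] := cls_surj y; rewrite /fi ss_diff_cls.
    move=> /esym/eqP; rewrite -subr_eq0 /= -linearB => /eqP/cls0P/= /ssBP[z [zF zG xyF]].
    have /ssZP[yF yG dyF] := yZ.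
    apply/ssBP; exists (y' + z); split.
    * by rewrite rpredD //; [apply: FS yF|apply: FS zF]; lia.
    * by rewrite rpredD //; move: yG; congr (_ \in G _); ring.
    * by move: xyF; rewrite linearD opprD addrA.
Qed.

Definition filtered_ss : spectral_sequence k :=
  @SpectralSequence k ss_page ss_diff
    (fun r p q p' q' _ nh x => ss_diff_shape nh x)
    (fun r p q p' q' p'' q'' _ x => ss_diff_diff p' q' p'' q'' x)
    (fun r p q _ => ss_page_next r p q).

(** Outside the first quadrant the degree bound [F_full] puts all of [Z^r] in
    [F (p - 1)], hence in [B^r]. *)
Lemma ss_page0 r (p q : int) : (p < 0) || (q < 0) -> forall x : ss_page r p q, x = 0.
Proof.
move=> pq x; have [[y yZ] <-] := cls_surj x; apply/cls0P => /=.
have /ssZP[yF yG _] := yZ; apply/ssBP; exists 0; rewrite raddf0 subr0 !rpred0; split=> //.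
case/orP: pq => [p0|q0]; first by rewrite (F_neg p0 yF) rpred0.
by apply: FS (F_full yG); lia.
Qed.

Lemma ss_first_quadrant : first_quadrant filtered_ss.
Proof. by move=> p q pq x; apply: ss_page0. Qed.

Definition cycles (n : int) : {pred T} := fun x => (x \in G n) && (d x == 0).
Fact cycles_closed n : submod_closed (cycles n).
Proof.
have E x : (x \in cycles n) = (x \in G n) && (d x == 0) by [].
split=> [|a x y]; first by rewrite E raddf0 rpred0 eqxx.
rewrite !E linearP => /andP[xG /eqP->] /andP[yG /eqP->].
by rewrite scaler0 addr0 eqxx andbT rpredD ?rpredZ.
Qed.
HB.instance Definition _ n := GRing.isSubmodClosed.Build k T (cycles n) (cycles_closed n).
Lemma cyclesP n x : reflect (x \in G n /\ d x = 0) (x \in cycles n).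
Proof. by apply: (iffP andP) => -[? /eqP]. Qed.
Definition bounds (n : int) : {pred T} := fun x => `[< exists2 y, y \in G (n + 1) & x = d y >].
Fact bounds_closed n : submod_closed (bounds n).
Proof.
split; first by apply/asboolP; exists 0; rewrite ?raddf0 ?rpred0.
move=> a _ _ /asboolP[x xG ->] /asboolP[y yG ->]; apply/asboolP.
by exists (a *: x + y); rewrite ?linearP ?rpredD ?rpredZ.
Qed.
HB.instance Definition _ n := GRing.isSubmodClosed.Build k T (bounds n) (bounds_closed n).
Lemma boundsP n x : reflect (exists2 y, y \in G (n + 1) & x = d y) (x \in bounds n).
Proof. exact: asboolP. Qed.

Section Convergence.
Variables (n : nat) (H : lmodType k) (pi : {linear submod (cycles n%:Z) -> H}).
Hypothesis pi_surj : forall y, exists x, pi x = y.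
Hypothesis pi0 : forall x, pi x = 0 <-> val x \in bounds n%:Z.

Definition hfilt (p : int) : {pred H} :=
  fun y => `[< exists2 x, val x \in F p & pi x = y >].
Lemma hfiltP p y : reflect (exists2 x, val x \in F p & pi x = y) (y \in hfilt p).
Proof. exact: asboolP. Qed.
Fact hfilt_closed p : submod_closed (hfilt p).
Proof.
split; first by apply/hfiltP; exists 0; rewrite ?raddf0 ?rpred0.
move=> a _ _ /hfiltP[x xG <-] /hfiltP[y yG <-]; apply/hfiltP.
by exists (a *: x + y); rewrite /= ?linearP // rpredD ?rpredZ.
Qed.
HB.instance Definition _ p := GRing.isSubmodClosed.Build k H (hfilt p) (hfilt_closed p).

(** For large [r], an element of [Z^r] has its boundary in [F (p - r) = 0] and is
    a cycle, while [F (p + r - 1)] contains everything of degree [n + 1], so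
    that [B^r] contains all boundaries. *)
Lemma ss_limit (p : int) r : p < r%:Z -> n%:Z < p + r%:Z - 1 ->
  lin_iso (ss_page r p (n%:Z - p)) (subquot (hfilt p) (hfilt (p - 1))).
Proof.
move=> pr nr; have En : p + (n%:Z - p) = n%:Z by ring.
have xC x : x \in ssZ r p (n%:Z - p) -> idfun x \in cycles n%:Z.
  case/ssZP; rewrite En => _ xG dx; apply/cyclesP; split=> //.
  by apply: F_neg dx; lia.
pose f : {linear submod (ssZ r p (n%:Z - p)) -> H} := pi \o restr xC.
have fP x : f x \in hfilt p.
  by apply/hfiltP; exists (restr xC x) => //; have /ssZP[] := valP x.
pose g (x : submod (ssZ r p (n%:Z - p))) : submod (hfilt p) := Submod (fP x).
have gL : linear g by move=> a x y; apply: val_inj; exact: (linearP f).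
pose hg := GRing.isLinear.Build k _ _ *:%R g gL.
pose g' : {linear _ -> submod (hfilt p)} := HB.pack g hg.
apply: (@lin_iso_surj _ _ _ _ (scls r p (n%:Z - p)) (cls (hfilt p) (hfilt (p - 1)) \o g')).
- exact: cls_surj.
- move=> y; have [[z zF] <-] := cls_surj y; have /hfiltP[x xF exz] := zF.
  have /cyclesP[xG dx] := valP x.
  have xZ : val x \in ssZ r p (n%:Z - p) by apply/ssZP; rewrite dx rpred0 En.
  exists (Submod xZ); congr cls; apply: val_inj; rewrite /= -exz /f /=.
  congr (pi _); exact: val_inj.
- move=> x; rewrite /= !cls0P /=; have /ssZP[xF xG dxF] := valP x; rewrite En in xG.
  have dx : d (val x) = 0 by apply: F_neg dxF; lia.
  have xc : val x \in cycles n%:Z by apply/cyclesP.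
  split.
  + case/ssBP=> y; rewrite En => -[yF yG xyF]; apply/hfiltP.
    have zC : val x - d y \in cycles n%:Z.
      apply/cyclesP; rewrite linearB dx dd subr0; split=> //.
      by rewrite submodB // -[n%:Z](addrK 1) dG.
    exists (Submod zC) => //; rewrite /f /=.
    apply/eqP; rewrite -subr_eq0 -linearB; apply/eqP/pi0 => /=.
    rewrite addrAC subrr add0r submodN; apply/boundsP; by exists y.
  + case/hfiltP=> y yF /esym/eqP; rewrite -subr_eq0 /f /= -linearB => /eqP/pi0/= /boundsP[z zG xy].
    apply/ssBP; exists z; rewrite En; split=> //.
      by apply: FS (F_full zG); lia.
    by rewrite -xy opprB addrC subrK.
Qed.
End Convergence.

Lemma ss_converges (H : nat -> lmodType k) :
  (forall n, lin_iso (subquot (cycles n%:Z) (bounds n%:Z)) (H n)) ->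
  converges_to filtered_ss H.
Proof.
move=> iso n; have [f [g fK gK]] := iso n.
pose pi : {linear submod (cycles n%:Z) -> H n} := f \o cls _ (bounds n%:Z).
have pi_surj y : exists x, pi x = y.
  by have [x ex] := cls_surj (g y); exists x; rewrite /pi /= ex.
have pi0 x : pi x = 0 <-> val x \in bounds n%:Z.
  rewrite -cls0P /pi /=; split=> [e|->]; last exact: raddf0.
  by apply: (can_inj fK); rewrite e raddf0.
exists (hfilt pi : int -> submodClosed _); split.
- move=> p _ /hfiltP[x xF <-]; apply/hfiltP; exists x => //; apply: FS xF; lia.
- exists (-1) => _ /hfiltP[x xF <-]; have -> : x = 0 by apply: val_inj; apply: F_neg xF.
  exact: raddf0.
- exists n%:Z => y; have [x <-] := pi_surj y; apply/hfiltP; exists x => //.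
  by apply: F_full; have /cyclesP[] := valP x.
- move=> p; exists (`|p| + n + 2)%N; split; [lia| |apply: ss_limit => //; lia].
  move=> s le p' q'; split=> x /=.
    have [[E1 E2]|nh] := pselect (diff_cond s p (n%:Z - p) p' q').
      by apply: ss_page0; apply/orP; left; lia.
    exact: ss_diff_shape.
  have [[E1 E2]|nh] := pselect (diff_cond s p' q' p (n%:Z - p)).
    suff -> : x = 0 by rewrite raddf0.
    by apply: ss_page0; apply/orP; right; lia.
  exact: ss_diff_shape.
Qed.

End Filtered.

(** * Complexes and quasi-isomorphisms *)

Record ccomplex (k : fieldType) := CComplex {
  cc :> nat -> lmodType k;
  ccd : forall n, {linear cc n.+1 -> cc n};
  ccdd : forall n x, ccd n (ccd n.+1 x) = 0
}.

Section Complexes.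
Variable k : fieldType.

Definition cout (K : ccomplex k) n : {linear K n -> K n.-1} :=
  if n is m.+1 then ccd K m else \0.
Definition chom (K : ccomplex k) n : lmodType k := homology (ccd K n) (cout K n).

(** Bijectivity on homology, spelled out on representatives. *)
Definition quasi_iso (K L : ccomplex k) (f : forall n, {linear K n -> L n}) : Prop :=
  [/\ forall n x, f n (ccd K n x) = ccd L n (f n.+1 x),
      forall n x, cout K n x = 0 -> (exists y, f n x = ccd L n y) ->
        exists y, x = ccd K n y &
      forall n z, cout L n z = 0 ->
        exists2 x, cout K n x = 0 & exists w, z - f n x = ccd L n w].

Lemma lin_kerP (U V : lmodType k) (f : {linear U -> V}) x :
  reflect (f x = 0) (x \in lin_ker f).
Proof. exact: eqP. Qed.
Lemma lin_imP (U V : lmodType k) (f : {linear U -> V}) y :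
  reflect (exists x, f x = y) (y \in lin_im f).
Proof. exact: asboolP. Qed.

Lemma quasi_iso_chom (K L : ccomplex k) (f : forall n, {linear K n -> L n}) n :
  quasi_iso f -> lin_iso (chom K n) (chom L n).
Proof.
case=> fd finj fsurj.
apply: (@subquot_iso _ _ _ (lin_ker _) (lin_im _) (lin_ker _) (lin_im _) (f n)).
- move=> x /lin_kerP x0; apply/lin_kerP; move: x0.
  by case: n x => [//|n] x /= x0; rewrite -fd x0 raddf0.
- move=> x /lin_kerP x0; split=> /lin_imP[y yx]; apply/lin_imP.
    by have [z ->] := finj _ _ x0 (ex_intro _ _ (esym yx)); exists z.
  by exists (f n.+1 y); rewrite -fd yx.
- move=> y /lin_kerP y0; have [x x0 [w e]] := fsurj _ _ y0.
  by exists x; [apply/lin_kerP | apply/lin_imP; exists w].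
Qed.

Lemma chain_iso_chom (K L : ccomplex k) (f : forall n, {linear K n -> L n}) n :
  (forall n x, f n (ccd K n x) = ccd L n (f n.+1 x)) ->
  (forall n, bijective (f n)) -> lin_iso (chom K n) (chom L n).
Proof.
move=> fd bf; apply: (quasi_iso_chom _ (f := f)); split=> //.
- move=> m x x0 [y]; have [g fK gK] := bf m.+1; rewrite -[y]gK -fd => /(bij_inj (bf m)).
  by exists (g y).
- move=> m z z0; have [g fK gK] := bf m; exists (g z); last first.
    by exists 0; rewrite gK subrr raddf0.
  case: m z z0 g fK gK => [//|m] z z0 g fK gK /=.
  by apply: (bij_inj (bf m)); rewrite raddf0 fd gK.
Qed.
End Complexes.

(** * Double complexes and their total complexes *)

Section DProd.
Variables (I : eqType) (k : fieldType) (D : I -> lmodType k).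

(** Total complexes are cut out of a full product by homogeneity. A direct sum
    over [p + q = n] would be indexed by [p] and [n - p], and its differential
    would need transport along equations between such indices. *)
Definition dprod : Type := forall i, D i.
HB.instance Definition _ := gen_eqMixin dprod.
HB.instance Definition _ := gen_choiceMixin dprod.
Implicit Types x y z : dprod.

Definition dprod_zero : dprod := fun i => 0.
Definition dprod_opp x : dprod := fun i => - x i.
Definition dprod_add x y : dprod := fun i => x i + y i.
Definition dprod_scale (a : k) x : dprod := fun i => a *: x i.
Lemma dprodP x y : (forall i, x i = y i) -> x = y.
Proof. exact: functional_extensionality_dep. Qed.
Fact dprod_addA : associative dprod_add.
Proof. by move=> x y z; apply: dprodP => i; apply: addrA. Qed.
Fact dprod_addC : commutative dprod_add.
Proof. by move=> x y; apply: dprodP => i; apply: addrC. Qed.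
Fact dprod_add0 : left_id dprod_zero dprod_add.
Proof. by move=> x; apply: dprodP => i; apply: add0r. Qed.
Fact dprod_addN : left_inverse dprod_zero dprod_opp dprod_add.
Proof. by move=> x; apply: dprodP => i; apply: addNr. Qed.
HB.instance Definition _ :=
  GRing.isZmodule.Build dprod dprod_addA dprod_addC dprod_add0 dprod_addN.
Fact dprod_scaleA a b x : dprod_scale a (dprod_scale b x) = dprod_scale (a * b) x.
Proof. by apply: dprodP => i; apply: scalerA. Qed.
Fact dprod_scale1 : left_id 1 dprod_scale.
Proof. by move=> x; apply: dprodP => i; apply: scale1r. Qed.
Fact dprod_scaleDr : right_distributive dprod_scale +%R.
Proof. by move=> a x y; apply: dprodP => i; apply: scalerDr. Qed.
Fact dprod_scaleDl x : {morph dprod_scale^~ x : a b / a + b}.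
Proof. by move=> a b; apply: dprodP => i; apply: scalerDl. Qed.
HB.instance Definition _ := GRing.Zmodule_isLmodule.Build k dprod
  dprod_scaleA dprod_scale1 dprod_scaleDr dprod_scaleDl.

Lemma dprodDE x y i : (x + y) i = x i + y i. Proof. by []. Qed.
Lemma dprodNE x i : (- x) i = - x i. Proof. by []. Qed.
Lemma dprodZE a x i : (a *: x) i = a *: x i. Proof. by []. Qed.
Lemma dprod0E i : (0 : dprod) i = 0. Proof. by []. Qed.

Definition single i (v : D i) : dprod := fun j =>
  if i =P j is ReflectT e then eq_rect i (fun j => D j) v j e else 0.
Lemma singleE i v : single v i = v.
Proof. by rewrite /single; case: eqP => // e; rewrite (eq_axiomK e). Qed.
Lemma single_neq i (v : D i) j : i <> j -> single v j = 0.
Proof. by rewrite /single; case: eqP. Qed.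
End DProd.

(** The squares anticommute: the total differential is then the plain sum, and
    exchanging the two directions involves no sign. *)
Record dcomplex (k : fieldType) := DComplex {
  dcX :> nat -> nat -> lmodType k;
  dch : forall p q, {linear dcX p.+1 q -> dcX p q};
  dcv : forall p q, {linear dcX p q.+1 -> dcX p q};
  dchh : forall p q x, dch p q (dch p.+1 q x) = 0;
  dcvv : forall p q x, dcv p q (dcv p q.+1 x) = 0;
  dchv : forall p q x, dch p q (dcv p.+1 q x) + dcv p q (dch p q.+1 x) = 0
}.

Section Total.
Variables (k : fieldType) (X : dcomplex k).

Definition totT : lmodType k := dprod (fun i : nat * nat => X i.1 i.2).
Definition totd_fun (x : totT) : totT :=
  fun i => dch X i.1 i.2 (x (i.1.+1, i.2)) + dcv X i.1 i.2 (x (i.1, i.2.+1)).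
Fact totd_linear : linear totd_fun.
Proof.
move=> a x y; apply: dprodP => -[p q].
by rewrite /totd_fun /= !linearP /= scalerDr addrACA.
Qed.
HB.instance Definition _ := GRing.isLinear.Build k totT totT *:%R totd_fun totd_linear.
Definition totd : {linear totT -> totT} := totd_fun.
Lemma totdE x p q : totd x (p, q) = dch X p q (x (p.+1, q)) + dcv X p q (x (p, q.+1)).
Proof. by []. Qed.
Lemma totdd x : totd (totd x) = 0.
Proof.
apply: dprodP => -[p q]; rewrite !totdE !raddfD /= dchh dcvv addr0 add0r.
exact: dchv.
Qed.

Definition deg (n : int) : {pred totT} :=
  fun x => `[< forall p q : nat, p%:Z + q%:Z <> n -> x (p, q) = 0 >].
Lemma degP n x :
  reflect (forall p q : nat, p%:Z + q%:Z <> n -> x (p, q) = 0) (x \in deg n).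
Proof. exact: asboolP. Qed.
Fact deg_closed n : submod_closed (deg n).
Proof.
split; first by apply/degP.
move=> a x y /degP xn /degP yn; apply/degP => p q pq.
by rewrite dprodDE dprodZE xn // yn // scaler0 addr0.
Qed.
HB.instance Definition _ n := GRing.isSubmodClosed.Build k totT (deg n) (deg_closed n).
Definition filt (s : int) : {pred totT} :=
  fun x => `[< forall p q : nat, s < p%:Z -> x (p, q) = 0 >].
Lemma filtP s x :
  reflect (forall p q : nat, s < p%:Z -> x (p, q) = 0) (x \in filt s).
Proof. exact: asboolP. Qed.
Fact filt_closed s : submod_closed (filt s).
Proof.
split; first by apply/filtP.
move=> a x y /filtP xn /filtP yn; apply/filtP => p q pq.
by rewrite dprodDE dprodZE xn // yn // scaler0 addr0.
Qed.
HB.instance Definition _ n := GRing.isSubmodClosed.Build k totT (filt n) (filt_closed n).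

Lemma totd_deg n x : x \in deg n -> totd x \in deg (n - 1).
Proof.
by move=> /degP xn; apply/degP => p q pq; rewrite totdE !xn ?raddf0 ?addr0 //; lia.
Qed.
Lemma filtS (s s' : int) x : s <= s' -> x \in filt s -> x \in filt s'.
Proof. by move=> ss /filtP xs; apply/filtP => p q ps; apply: xs; lia. Qed.
Lemma filt_neg (s : int) x : s < 0 -> x \in filt s -> x = 0.
Proof. by move=> s0 /filtP xs; apply: dprodP => -[p q]; apply: xs; lia. Qed.
Lemma filt_full n x : x \in deg n -> x \in filt n.
Proof. by move=> /degP xn; apply/filtP => p q pq; apply: xn; lia. Qed.

Definition tot_ss : spectral_sequence k :=
  filtered_ss totdd totd_deg filtS.

Definition dccol p : ccomplex k :=
  @CComplex k (X p) (dcv X p) (dcvv (d := X) (p := p)).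

Definition proj p q (x : totT) : X p q := x (p, q).
Fact proj_linear p q : linear (@proj p q). Proof. by []. Qed.
HB.instance Definition _ p q := GRing.isLinear.Build k totT (X p q) *:%R (@proj p q) (@proj_linear p q).

Definition tsingle p q (v : X p q) : totT :=
  @single _ k (fun i : nat * nat => X i.1 i.2) (p, q) v.
Lemma tsingleE p q (v : X p q) : tsingle v (p, q) = v.
Proof. exact: (@singleE _ k (fun i : nat * nat => X i.1 i.2)). Qed.
Lemma tsingle_neq p q (v : X p q) p' q' : (p, q) <> (p', q') -> tsingle v (p', q') = 0.
Proof. exact: (@single_neq _ k (fun i : nat * nat => X i.1 i.2)). Qed.
Lemma tsingle_deg p q (v : X p q) : tsingle v \in deg (p%:Z + q%:Z).
Proof. by apply/degP => p' q' ne; apply: tsingle_neq => -[? ?]; apply: ne; subst. Qed.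
Lemma tsingle_filt p q (v : X p q) : tsingle v \in filt p%:Z.
Proof. by apply/filtP => p' q' ne; apply: tsingle_neq => -[? ?]; subst; lia. Qed.

(** Modulo [F (p - 1)], an element of [F p] of degree [p + q] is its component
    at [(p, q)], and the total differential reduces to [dcv]. *)
Lemma tot_ss_E1 (p q : nat) : lin_iso (tot_ss 1%N p%:Z q%:Z) (chom (dccol p) q).
Proof.
apply: (@subquot_iso _ _ _ (ssZ _ _ _ _ _ _) (ssB _ _ _ _ _ _) (lin_ker _) (lin_im _) (@proj p q)).
- move=> x /ssZP[xF xG dxF]; apply/lin_kerP; case: q x xF xG dxF => [//|q] x xF xG dxF /=.
  move/filtP: dxF => /(_ p q); rewrite totdE.
  by move/filtP: xF => ->; [rewrite raddf0 add0r; apply; lia|lia].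
- move=> x /ssZP[xF xG dxF]; split=> [/lin_imP[y yx]|/ssBP[y [yF yG xyF]]]; last first.
    apply/lin_imP; exists (y (p, q.+1)); rewrite /proj.
    move/filtP: xyF => /(_ p q); rewrite dprodDE dprodNE totdE.
    move/filtP: yF => /(_ p.+1 q) ->; last lia.
    rewrite raddf0 add0r => e; apply/esym/eqP; rewrite -subr_eq0; apply/eqP/e; lia.
  apply/ssBP; exists (tsingle (y : X p q.+1)); split.
  + by apply: filtS (tsingle_filt _); lia.
  + move: (tsingle_deg (y : X p q.+1)); congr (_ \in deg _); lia.
  + apply/filtP => p' q' lt; rewrite dprodDE dprodNE totdE.
    rewrite [tsingle _ (p'.+1, q')]tsingle_neq; last by case; lia.
    rewrite raddf0 add0r.
    have [pp|pp] := eqVneq p' p; last first.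
      rewrite tsingle_neq ?raddf0 ?subr0; last by case=> /eqP; rewrite eq_sym (negPf pp).
      move/filtP: xF => /(_ p' q') ->; rewrite ?addr0 //; lia.
    have [qq|qq] := eqVneq q' q; last first.
      rewrite tsingle_neq ?raddf0 ?subr0; last by case=> _ /eqP; rewrite eq_sym (negPf qq).
      move/degP: xG => /(_ p' q') ->; rewrite ?addr0 //; lia.
    by subst p' q'; rewrite tsingleE; rewrite /= in yx; rewrite yx subrr.
- move=> y /lin_kerP y0; exists (tsingle (y : X p q)); last first.
    apply/lin_imP; exists 0; rewrite raddf0; apply/esym/eqP; rewrite subr_eq0.
    apply/eqP/esym; exact: tsingleE.
  apply/ssZP; split; [exact: tsingle_filt|exact: tsingle_deg|].
  apply/filtP => p' q' lt; rewrite totdE.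
  rewrite tsingle_neq ?raddf0 ?add0r; last by case; lia.
  have [pp|pp] := eqVneq p' p; last first.
    by rewrite tsingle_neq ?raddf0 //; case=> /eqP; rewrite eq_sym (negPf pp).
  have [qq|qq] := eqVneq q'.+1 q; last first.
    by rewrite tsingle_neq ?raddf0 //; case=> _ /eqP; rewrite eq_sym (negPf qq).
  by subst p' q; rewrite tsingleE; exact: y0.
Qed.

Lemma totd_degS (n : nat) x : x \in deg n.+1%:Z -> totd x \in deg n%:Z.
Proof. by move/totd_deg; congr (_ \in deg _); lia. Qed.
Definition totc_d n : {linear submod (deg n.+1%:Z) -> submod (deg n%:Z)} :=
  restr (@totd_degS n).
Fact totc_dd n x : totc_d n (totc_d n.+1 x) = 0.
Proof. by apply: val_inj; apply: totdd. Qed.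
Definition totc : ccomplex k := CComplex totc_dd.

Lemma totc_cycle n (x : totc n) : cout totc n x = 0 <-> totd (val x) = 0.
Proof.
case: n x => [|n] x /=.
  split=> // _; apply: dprodP => -[p q].
  by rewrite totdE; have /degP x0 := valP x; rewrite !x0 ?raddf0 ?addr0 //; lia.
by split=> [/(congr1 val)|e] //; apply: val_inj.
Qed.

Lemma tot_ss_converges (H : nat -> lmodType k) :
  (forall n, lin_iso (chom totc n) (H n)) -> converges_to tot_ss H.
Proof.
move=> iso; apply: ss_converges => //.
- exact: filt_neg.
- exact: filt_full.
move=> n; apply: lin_iso_trans (iso n); apply: lin_iso_sym.
apply: (@subquot_iso _ _ _ (lin_ker _) (lin_im _) (cycles _ _ _) (bounds _ _ _)
  (\val : {linear submod (deg n%:Z) -> _})).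
- by move=> x /lin_kerP/totc_cycle x0; apply/cyclesP; split=> //; apply: valP.
- move=> x x0; split=> [/boundsP[y yG xy]|/lin_imP[y <-]].
    have yG' : y \in deg n.+1%:Z by move: yG; congr (_ \in deg _); lia.
    by apply/lin_imP; exists (Submod yG'); apply: val_inj.
  apply/boundsP; exists (val y) => //; have := valP y; congr (_ \in deg _); lia.
- move=> y /cyclesP[yG dy]; exists (Submod yG); last by rewrite subrr rpred0.
  by apply/lin_kerP/totc_cycle.
Qed.
End Total.
Arguments deg {k} X n.
Arguments filt {k} X s.
Arguments totd {k X}.

Section Transpose.
Variables (k : fieldType) (X : dcomplex k).
Fact dc_transpose_hv p q x : dcv X q p (dch X q p.+1 x) + dch X q p (dcv X q.+1 p x) = 0.
Proof. by rewrite addrC dchv. Qed.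
Definition dc_transpose : dcomplex k := @DComplex k (fun p q => X q p)
  (fun p q => dcv X q p) (fun p q => dch X q p)
  (fun p q x => dcvv x) (fun p q x => dchh x) dc_transpose_hv.

Definition flipT_fun (x : totT X) : totT dc_transpose := fun i => x (i.2, i.1).
Fact flipT_linear : linear flipT_fun. Proof. by []. Qed.
HB.instance Definition _ := GRing.isLinear.Build k (totT X) (totT dc_transpose) *:%R
  flipT_fun flipT_linear.
Lemma flipT_deg n x : x \in deg X n -> flipT_fun x \in deg dc_transpose n.
Proof. by move=> /degP xn; apply/degP => p q pq; apply: xn; lia. Qed.
Definition flipc n : {linear totc X n -> totc dc_transpose n} := restr (@flipT_deg n%:Z).
End Transpose.

Section TransposeIso.
Variables (k : fieldType) (X : dcomplex k).
Lemma flipc_d n (x : totc X n.+1) : flipc X n (ccd (totc X) n x) = ccd (totc (dc_transpose X)) n (flipc X n.+1 x).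
Proof. by apply: val_inj; apply: dprodP => -[p q]; rewrite /= /flipT_fun /totd_fun /= addrC. Qed.
Lemma flipc_bij n : bijective (flipc X n).
Proof.
have yG (y : totc (dc_transpose X) n) : ((fun i => val y (i.2, i.1)) : totT X) \in deg X n%:Z.
  by apply/degP => p q pq; have /degP yn := valP y; apply: yn; lia.
by exists (fun y => Submod (yG y)) => [[x xG]|[y yG']]; apply: val_inj; apply: dprodP => -[p q].
Qed.
Lemma chom_transpose n : lin_iso (chom (totc X) n) (chom (totc (dc_transpose X)) n).
Proof. apply: chain_iso_chom; [exact: flipc_d|exact: flipc_bij]. Qed.
End TransposeIso.

(** * Double complexes with exact rows *)

Section Augmented.
Variables (k : fieldType) (X : dcomplex k) (P : ccomplex k).
Variable eps : forall q, {linear X 0%N q -> P q}.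
Hypothesis eps_h : forall q x, eps q (dch X 0 q x) = 0.
Hypothesis eps_v : forall q x, eps q (dcv X 0 q x) = ccd P q (eps q.+1 x).
Hypothesis eps_surj : forall q z, exists x, eps q x = z.
Hypothesis eps_exact : forall q x, eps q x = 0 -> exists y, dch X 0 q y = x.
Hypothesis h_exact : forall p q x, dch X p q x = 0 -> exists y, dch X p.+1 q y = x.

(** The value at [0] keeps homogeneous what is built by means of [s]. *)
Lemma section_choice (U V : lmodType k) (f : {linear U -> V}) (S : V -> Prop) :
  (forall z, S z -> exists x, f x = z) ->
  {s : V -> U | s 0 = 0 /\ forall z, S z -> f (s z) = z}.
Proof.
move=> H; apply/cid; have /choice[s sP] (z : V) : exists x, (z = 0 -> x = 0) /\ (S z -> f x = z).
  have [->|z0] := pselect (z = 0); first by exists 0; rewrite raddf0.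
  have [/H[x xz]|nz] := pselect (S z); first by exists x.
  by exists 0.
by exists s; split=> [|z]; [apply: (sP 0).1|apply: (sP z).2].
Qed.

(** The staircase argument. The components of [y] are found for increasing
    [p]: the one at [(p + 1, q)] is a preimage under [dch] of
    [x (p, q) - dcv (y (p, q + 1))], which is a [dch]-cycle because [x] is a
    cycle and the preceding components already satisfy the equation. Injectivity
    and surjectivity of [augc] on homology are the cases where [pi] bounds the
    image of [x] and where [x = 0]. *)
Lemma aug_chase (N : nat) (x : totT X) (pi : forall q, P q) :
  totd x = 0 -> (forall p q, (p + q).+1 <> N -> x (p, q) = 0) ->
  (forall q, q <> N -> pi q = 0) ->
  (forall q, eps q (x (0%N, q)) = ccd P q (pi q.+1)) ->
  exists y : totT X, [/\ totd y = x, y \in deg X N%:Z &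
                        forall q, eps q (y (0%N, q)) = pi q].
Proof.
move=> dx xN piN xpi.
pose c1 q := section_choice (S := fun _ => True) (fun z _ => @eps_surj q z).
pose c0 q := section_choice (S := fun x => eps q x = 0) (fun z => @eps_exact q z).
pose ch p q := section_choice (S := fun x => dch X p q x = 0) (fun z => @h_exact p q z).
pose s1 q := sval (c1 q); have s1P q : s1 q 0 = 0 /\ forall z, True -> eps q (s1 q z) = z := svalP (c1 q).
pose s0 q := sval (c0 q); have s0P q : s0 q 0 = 0 /\ forall z, eps q z = 0 -> dch X 0 q (s0 q z) = z :=
  svalP (c0 q).
pose sh p q := sval (ch p q); have shP p q : sh p q 0 = 0 /\ forall z, dch X p q z = 0 -> dch X p.+1 q (sh p q z) = z :=
  svalP (ch p q).
(* The recursion is on p alone, for all q at once: no indices are equated. *)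
pose y := fix y p : forall q, X p q :=
  match p return forall q, X p q with
  | 0 => fun q => s1 q (pi q)
  | p'.+1 => match p' return (forall q, X p' q) -> forall q, X p'.+1 q with
            | 0 => fun y' q => s0 q (x (0%N, q) - dcv X 0 q (y' q.+1))
            | p''.+1 => fun y' q =>
               sh p'' q (x (p''.+1, q) - dcv X p''.+1 q (y' q.+1))
            end (y p')
  end.
have yN p q : (p + q)%N <> N -> y p q = 0.
  elim: p q => [|[|p] IH] q ne /=.
  - by rewrite piN // (s1P q).1.
  - by rewrite xN ?piN ?(s1P _).1 ?raddf0 ?addr0 ?(s0P q).1 //; lia.
  - by rewrite -/(y p.+1) IH ?xN ?raddf0 ?addr0 ?(shP _ q).1 //; lia.
have y0 q : eps q (y 0%N q) = pi q by exact: (s1P q).2.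
have dy p q : dch X p q (y p.+1 q) + dcv X p q (y p q.+1) = x (p, q).
  elim: p q => [|p IH] q; last first.
    rewrite [y p.+2]/= -/(y p.+1) (shP p q).2 ?subrK //.
    have := congr1 (fun z : totT X => z (p, q)) dx; rewrite totdE dprod0E => dxpq.
    rewrite linearB /= (eqP (_ : dch X p q (x (p.+1, q)) == - dcv X p q (x (p, q.+1)))); last first.
      by rewrite -addr_eq0 dxpq.
    rewrite -(IH q.+1) linearD /= dcvv addr0.
    by apply/eqP; rewrite subr_eq0 eq_sym -addr_eq0 dchv.
  rewrite [y 1%N]/= (s0P q).2 ?subrK //.
  by rewrite linearB /= eps_v xpi (y0 q.+1 : eps _ (s1 _ _) = _) subrr.
exists (fun i => y i.1 i.2); split=> //.
- by apply: dprodP => -[p q]; rewrite totdE dy.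
- by apply/degP => p q pq; apply: (yN p q); lia.
Qed.

Definition augc n : {linear totc X n -> P n} :=
  eps n \o (@proj k X 0%N n \o (\val : {linear submod (deg X n%:Z) -> _})).
Lemma augcE n (x : totc X n) : augc n x = eps n (val x (0%N, n)).
Proof. by []. Qed.

Lemma single_family n (z : P n) : exists pi : forall q, P q,
  pi n = z /\ forall q, q <> n -> pi q = 0.
Proof.
exists (@single _ k P n z); split; first exact: (@singleE _ k P).
by move=> q ne; apply: (@single_neq _ k P); apply: nesym.
Qed.

Lemma aug_inj n (x : totc X n) : cout (totc X) n x = 0 ->
  (exists z, augc n x = ccd P n z) -> exists y, x = ccd (totc X) n y.
Proof.
move=> /totc_cycle dx [z xz]; have [pi [pin piN]] := single_family z.
have /degP xn := valP x.
have [||q|y [dy yn _]] := aug_chase (N := n.+1) (pi := pi) dx.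
- by move=> p q ne; apply: xn; lia.
- exact: piN.
- have [->|ne] := eqVneq q n; first by rewrite pin -xz.
  by rewrite xn ?piN ?raddf0 //; move: ne; lia.
- by exists (Submod yn); apply: val_inj; rewrite /= -dy.
Qed.

Lemma aug_lift n (z : P n) : cout P n z = 0 ->
  exists2 x : totc X n, cout (totc X) n x = 0 & augc n x = z.
Proof.
move=> z0; have [pi [pin piN]] := single_family z.
have [|||q|y [dy yn y0]] := aug_chase (N := n) (x := 0) (pi := pi).
- exact: raddf0.
- by [].
- exact: piN.
- rewrite dprod0E raddf0; have [e|ne] := eqVneq q.+1 n; last by rewrite piN ?raddf0 //; lia.
  by case: _ / e z z0 pin {piN} => z z0 -> ; rewrite z0.
- by exists (Submod yn); [apply/totc_cycle|rewrite augcE /= y0].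
Qed.

Lemma augc_quasi_iso : quasi_iso augc.
Proof.
split=> [n x|n x|n z /aug_lift[x x0 <-]]; last 1 first.
- by exists x => //; exists 0; rewrite subrr raddf0.
- by rewrite !augcE /= totdE raddfD /= eps_h add0r eps_v.
- exact: aug_inj.
Qed.
End Augmented.

(** * Hochschild chains *)

Section TensorLemmas.
Variable k : fieldType.
Lemma tens0l (V W : lmodType k) (w : W) : (0 : V) ⊗ w = 0.
Proof. by rewrite -(scale0r (0 : V)) tensZl scale0r. Qed.
Lemma tensBl (V W : lmodType k) (v v' : V) (w : W) : (v - v') ⊗ w = v ⊗ w - v' ⊗ w.
Proof. by rewrite tensDl -scaleN1r tensZl scaleN1r. Qed.
Lemma tmapD (V W V' W' : lmodType k) (f : {linear V -> W}) (g : {linear V' -> W'}) x y :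
  tmap f g (x + y) = tmap f g x + tmap f g y.
Proof. exact: raddfD. Qed.
Lemma tassocD (U V W : lmodType k) x y : tassoc U V W (x + y) = tassoc U V W x + tassoc U V W y.
Proof. exact: raddfD. Qed.
Lemma tassocVD (U V W : lmodType k) x y : tassocV U V W (x + y) = tassocV U V W x + tassocV U V W y.
Proof. exact: raddfD. Qed.
Definition tlinD := (tensDl, tensDr, tmapD, tassocD, tassocVD).
Lemma tmap_comp (U V W U' V' W' : lmodType k) (f : {linear V -> W}) (g : {linear U -> V})
    (f' : {linear V' -> W'}) (g' : {linear U' -> V'}) x :
  tmap f f' (tmap g g' x) = tmap (f \o g) (f' \o g') x.
Proof.
elim/tens_ind: x => [u u'|x y IHx IHy]; last by rewrite !raddfD /= IHx IHy.
by rewrite !tmapE.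
Qed.
Lemma eq_tmap (V W V' W' : lmodType k) (f g : {linear V -> W}) (f' g' : {linear V' -> W'}) :
  f =1 g -> f' =1 g' -> tmap f f' =1 tmap g g'.
Proof. by move=> fg fg'; apply: tens_ext => v v'; rewrite !tmapE fg fg'. Qed.
Lemma tmap_id (V W : lmodType k) (f : {linear V -> V}) (g : {linear W -> W}) :
  f =1 id -> g =1 id -> tmap f g =1 id.
Proof. by move=> fi gi; apply: (tens_ext (g := idfun)) => v w; rewrite tmapE fi gi. Qed.
Lemma tmap_bij (V W V' W' : lmodType k) (f : {linear V -> W}) (g : {linear V' -> W'}) :
  bijective f -> bijective g -> bijective (tmap f g).
Proof.
have inv (U U' : lmodType k) (h : {linear U -> U'}) :
    bijective h -> exists h' : {linear U' -> U}, cancel h h' /\ cancel h' h.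
  case=> h' hK h'K.
  have h'L : linear h' by move=> a x y; apply: (can_inj hK); rewrite linearP !h'K.
  pose m := GRing.isLinear.Build k U' U *:%R h' h'L.
  by exists (HB.pack h' m : {linear U' -> U}).
move=> /inv[f' [fK f'K]] /inv[g' [gK g'K]]; exists (tmap f' g') => x;
  by rewrite tmap_comp tmap_id.
Qed.
Lemma tassocK (U V W : lmodType k) : cancel (tassoc U V W) (tassocV U V W).
Proof.
apply: (tens_ext (f := tassocV U V W \o tassoc U V W) (g := idfun)) => x w /=.
elim/tens_ind: x => [u v|x y IHx IHy]; first by rewrite tassocE tassocVE.
by rewrite !tensDl !raddfD /= IHx IHy.
Qed.
Lemma tassocVK (U V W : lmodType k) : cancel (tassocV U V W) (tassoc U V W).
Proof.
apply: (tens_ext (f := tassoc U V W \o tassocV U V W) (g := idfun)) => u x /=.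
elim/tens_ind: x => [v w|x y IHx IHy]; first by rewrite tassocVE tassocE.
by rewrite !tensDr !raddfD /= IHx IHy.
Qed.
End TensorLemmas.

Section ChainMaps.
Variables (k : fieldType) (C : lmodType k).
Implicit Types U V W : lmodType k.

(** [CH] as a functor in its coefficients. *)
Fixpoint CHf U W (f : {linear U -> W}) n : {linear CH C U n -> CH C W n} :=
  if n is m.+1 then tmap (CHf f m) idfun else f.

Lemma CHfS U W (f : {linear U -> W}) n (x : CH C U n) c :
  CHf f n.+1 (x ⊗ c) = CHf f n x ⊗ c.
Proof. exact: tmapE. Qed.
Lemma CH_ind W n (P : CH C W n.+1 -> Prop) :
  (forall x c, P (x ⊗ c)) -> (forall x y, P x -> P y -> P (x + y)) -> forall x, P x.
Proof. exact: tens_ind. Qed.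
Lemma CHfD U W (f : {linear U -> W}) n (x y : CH C U n) :
  CHf f n (x + y) = CHf f n x + CHf f n y.
Proof. exact: raddfD. Qed.
Lemma CHfZ U W (f : {linear U -> W}) n a (x : CH C U n) :
  CHf f n (a *: x) = a *: CHf f n x.
Proof. exact: linearZ. Qed.
Lemma CHf_comp U V W (f : {linear V -> W}) (g : {linear U -> V}) n x :
  CHf f n (CHf g n x) = CHf (f \o g) n x.
Proof.
elim: n x => [//|n IH] x; elim/CH_ind: x => [x c|x y IHx IHy].
  by rewrite !CHfS IH.
by rewrite !raddfD; congr (_ + _).
Qed.
Lemma eq_CHf U W (f g : {linear U -> W}) n : f =1 g -> CHf f n =1 CHf g n.
Proof.
move=> fg; elim: n => [//|n IH] x; elim/CH_ind: x => [x c|x y IHx IHy].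
  by rewrite !CHfS IH.
by rewrite !raddfD; congr (_ + _).
Qed.
Lemma CHf_id W (f : {linear W -> W}) n : f =1 id -> CHf f n =1 id.
Proof.
move=> fg; elim: n => [//|n IH] x; elim/CH_ind: x => [x c|x y IHx IHy].
  by rewrite !CHfS IH.
by rewrite !raddfD; congr (_ + _).
Qed.
Lemma CHf_lin U W (f g h : {linear U -> W}) a n x :
  (forall u, f u = a *: g u + h u) -> CHf f n x = a *: CHf g n x + CHf h n x.
Proof.
move=> fg; elim: n x => [//|n IH] x; elim/CH_ind: x => [x c|x y IHx IHy].
  by rewrite !CHfS IH tensPl.
by rewrite !CHfD IHx IHy scalerDr addrACA.
Qed.
Lemma CH_mapE W (f : {linear W -> W}) n x : CH_map C f n x = CHf f n x.
Proof.
elim: n x => [//|n IH] x; elim/CH_ind: x => [x c|x y IHx IHy].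
  by rewrite CHfS -IH /= tmapE.
by rewrite !raddfD; congr (_ + _).
Qed.
End ChainMaps.
Arguments CHf {k} C {U W} f n.

Section Bar.
Variables (k : fieldType) (C : unitalAlgType k).
Implicit Types U W : bimodule C.

Definition rmul W n (x : CH C W n) (c : C) : CH C W n := mul_last W n (x ⊗ c).
Lemma rmul0 W (w : CH C W 0) c : rmul w c = ract (w : W) c.
Proof. exact: tliftE. Qed.
Lemma rmulS W n (x : CH C W n) c c' : @rmul W n.+1 (x ⊗ c) c' = x ⊗ (c * c').
Proof. by rewrite /rmul /= tassocE tmapE tmulE. Qed.
Lemma rmulDl W n (x y : CH C W n) c : rmul (x + y) c = rmul x c + rmul y c.
Proof. by rewrite /rmul tensDl raddfD. Qed.
Lemma rmulZl W n (x : CH C W n) a c : rmul (a *: x) c = a *: rmul x c.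
Proof. by rewrite /rmul tensZl linearZ. Qed.
Lemma rmulM W n (x : CH C W n) c c' : rmul x (c * c') = rmul (rmul x c) c'.
Proof.
case: n x => [|n] x; first by rewrite !rmul0 ractM.
elim/CH_ind: x => [x b|x y IHx IHy]; first by rewrite !rmulS mulrA.
by rewrite !rmulDl IHx IHy.
Qed.
Lemma rmul1 W n (x : CH C W n) : rmul x 1 = x.
Proof.
case: n x => [|n] x; first by rewrite rmul0 ract1.
elim/CH_ind: x => [x b|x y IHx IHy]; first by rewrite rmulS mulr1.
by rewrite rmulDl IHx IHy.
Qed.

(** The faces other than the last make up the bar differential, which has an
    inductive description on left-nested chains; identities for the Hochschild
    differential are proved for it and for the last face separately. The
    constant [bar] is sealed, so that rewriting with additivity treats it as an
    atom. *)
Fixpoint bar_rec W n : {linear CH C W n.+1 -> CH C W n} :=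
  if n is m.+1 then tmap (bar_rec W m) idfun \+ ((-1) ^+ m.+1 : k) \*: mul_last W m.+1
  else mul_last W 0.
Fact bar_key : unit. Proof. exact: tt. Qed.
Definition bar W n := locked_with bar_key (bar_rec W n).

Lemma barD W n x y : bar W n (x + y) = bar W n x + bar W n y.
Proof. exact: raddfD. Qed.
Lemma barZ W n a x : bar W n (a *: x) = a *: bar W n x.
Proof. exact: linearZ. Qed.
Lemma bar0 W (w : CH C W 0) c : bar W 0 (w ⊗ c) = rmul w c.
Proof. by rewrite /bar unlock. Qed.
Lemma barS W n (x : CH C W n.+1) c :
  bar W n.+1 (x ⊗ c) = bar W n x ⊗ c + (-1) ^+ n.+1 *: rmul x c.
Proof. by rewrite /bar !unlock /= tmapE. Qed.

Definition cyc W n : {linear CH C W n.+1 -> CH C W n} := cyclic_face W n.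
Lemma cycD W n x y : cyc W n (x + y) = cyc W n x + cyc W n y.
Proof. exact: raddfD. Qed.
Lemma cycZ W n a x : cyc W n (a *: x) = a *: cyc W n x.
Proof. exact: linearZ. Qed.
Lemma cycE W n (x : CH C W n) c : cyc W n (x ⊗ c) = CHf C (lact_by W c) n x.
Proof. by rewrite -CH_mapE; apply: tliftE. Qed.

Lemma bar_face W n x : bar W n x = \sum_(i < n.+1) (-1) ^+ i *: face W n i x.
Proof.
elim: n x => [|n IH] x.
  by rewrite big_ord1 expr0 scale1r /bar unlock.
elim/CH_ind: x => [x c|x y IHx IHy]; last first.
  rewrite barD IHx IHy -big_split; apply: eq_bigr => i _ /=.
  by rewrite raddfD scalerDr.
rewrite barS IH [RHS]big_ord_recr /= ltnn eqxx; congr (_ + _).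
pose tc := (fun x => x ⊗ c) : CH C W n -> tensor (CH C W n) C.
have tD : {morph tc : x y / x + y} by move=> u v; apply: tensDl.
have t0 : tc 0 = 0 by apply: tens0l.
rewrite -[LHS]/(tc _) (big_morph tc tD t0); apply: eq_bigr => i _.
by rewrite /tc tensZl ltn_ord tmapE.
Qed.
Lemma hoch_diffE W n (x : CH C W n.+1) :
  hoch_diff x = bar W n x + (-1) ^+ n.+1 *: cyc W n x.
Proof.
rewrite /hoch_diff big_ord_recr /= bar_face; congr (_ + _ *: _).
by case: n x => [//|n] x /=; rewrite ltnNge leqnSn /= gtn_eqF.
Qed.

Lemma bar_rmul W n (x : CH C W n.+1) c : bar W n (rmul x c) = rmul (bar W n x) c.
Proof.
case: n x => [|n] x; elim/CH_ind: x => [x b|x y IHx IHy];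
  try by rewrite rmulDl !barD rmulDl IHx IHy.
  by rewrite rmulS !bar0 rmulM.
by rewrite rmulS !barS rmulDl rmulZl rmulS rmulM.
Qed.

Lemma bar_bar W n x : bar W n (bar W n.+1 x) = 0.
Proof.
elim: n x => [|n IH] x; elim/CH_ind: x => [x c|x y IHx IHy];
  try by rewrite !barD IHx IHy addr0.
  by rewrite barS barD barZ bar0 bar_rmul expr1 scaleN1r subrr.
rewrite barS barD barZ barS IH tens0l add0r bar_rmul.
by rewrite -scalerDl [X in _ + X]exprS mulN1r subrr scale0r.
Qed.

Section Naturality.
Variables (U W : bimodule C) (f : {linear U -> W}).
Hypothesis fr : forall u c, f (ract u c) = ract (f u) c.
Lemma CHf_rmul n (x : CH C U n) c : CHf C f n (rmul x c) = rmul (CHf C f n x) c.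
Proof.
case: n x => [|n] x; first by rewrite !rmul0 fr.
elim/CH_ind: x => [x b|x y IHx IHy]; first by rewrite !(rmulS, CHfS).
by rewrite !(CHfD, rmulDl) IHx IHy.
Qed.
Lemma CHf_bar n x : CHf C f n (bar U n x) = bar W n (CHf C f n.+1 x).
Proof.
elim: n x => [|n IH] x; elim/CH_ind: x => [x c|x y IHx IHy];
  try by rewrite !(barD, CHfD) IHx IHy.
  by rewrite bar0 CHf_rmul CHfS bar0.
by rewrite CHfS !barS CHfD CHfZ CHfS IH CHf_rmul.
Qed.
Hypothesis fl : forall u c, f (lact c u) = lact c (f u).
Lemma CHf_cyc n x : CHf C f n (cyc U n x) = cyc W n (CHf C f n.+1 x).
Proof.
elim/CH_ind: x => [x c|x y IHx IHy]; last by rewrite !raddfD; congr (_ + _).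
by rewrite CHfS !cycE !CHf_comp; apply: eq_CHf => u /=; apply: fl.
Qed.
Lemma CHf_hoch n (x : CH C U n.+1) : CHf C f n (hoch_diff x) = hoch_diff (CHf C f n.+1 x).
Proof. by rewrite !hoch_diffE CHfD CHfZ CHf_bar CHf_cyc. Qed.
End Naturality.

Lemma lact_by_ract W c (w : W) c' : lact_by W c (ract w c') = ract (lact_by W c w) c'.
Proof. by rewrite /lact_by lractA. Qed.

(** Read with [hoch_diffE], this says that the last face is a chain map from
    the bar complex, shifted, to the Hochschild complex: it divides the free
    bimodules [V ⊗ C^(n+1)] by commutators. *)
Lemma bar_cyc W n x :
  cyc W n (bar W n.+1 x) =
  bar W n (cyc W n.+1 x) + (-1) ^+ n.+1 *: cyc W n (cyc W n.+1 x).
Proof.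
elim/CH_ind: x => [x c|x y IHx IHy]; last first.
  by rewrite !(barD, cycD) IHx IHy scalerDr addrACA.
rewrite barS cycD cycZ cycE.
rewrite (CHf_bar (lact_by_ract (W := W) c)) -cycE; congr (_ + _ *: _).
elim/CH_ind: x => [x b|x y IHx IHy]; last first.
  by rewrite rmulDl tensDl !cycD IHx IHy.
rewrite rmulS !cycE -[RHS]/(cyc W n _) CHfS cycE CHf_comp.
by apply: eq_CHf => w; rewrite /= /lact_by lactM.
Qed.

(** Abstracting the relation between the two parts of the Hochschild
    differential that makes it square to zero. *)
Lemma diff_sq (X Y Z : lmodType k) (e1 t1 : {linear Y -> Z}) (e2 t2 : {linear X -> Y}) (s : k) x :
  e1 (e2 x) = 0 -> t1 (e2 x) = e1 (t2 x) + s *: t1 (t2 x) ->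
  e1 (e2 x - s *: t2 x) + s *: t1 (e2 x - s *: t2 x) = 0.
Proof.
move=> e0 te; rewrite !linearB !linearZ /= e0 te add0r !scalerN scalerDr.
by rewrite addrK addNr.
Qed.

Lemma hoch_hoch W n (x : CH C W n.+2) : hoch_diff (hoch_diff x) = 0.
Proof.
rewrite !hoch_diffE [X in X *: cyc W n.+1 x]exprS mulN1r scaleNr.
by apply: diff_sq; [exact: bar_bar|exact: bar_cyc].
Qed.

Definition hochc W : ccomplex k :=
  @CComplex k (CH C W) (fun n => (@hoch_diff k C W n : {linear _ -> _})) (@hoch_hoch W).
Lemma hochc_chom W n : chom (hochc W) n = HH W n.
Proof. by case: n. Qed.
End Bar.

(** * The double complex of a smash biproduct *)

Section Crossing.
Variables (k : fieldType) (A B : unitalAlgType k) (R : distr_law A B).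
Local Notation S := (smash R : unitalAlgType k).
Implicit Types X Y U W : lmodType k.

(** One application of [R] at the right end of a tensor. *)
Definition cross X : {linear tensor (tensor X B) A -> tensor (tensor X A) B} :=
  tassocV X A B \o tmap idfun R \o tassoc X B A.
Lemma crossE X (x : X) b a : cross X (x ⊗ b ⊗ a) = tassocV X A B (x ⊗ R (b ⊗ a)).
Proof. by rewrite /cross /= tassocE tmapE. Qed.
Lemma crossD X x y : cross X (x + y) = cross X x + cross X y.
Proof. exact: raddfD. Qed.
Lemma cross_nat X Y (f : {linear X -> Y}) t a :
  tmap (tmap f idfun) idfun (cross X (t ⊗ a)) = cross Y (tmap f idfun t ⊗ a).
Proof.
elim/tens_ind: t => [x b|t t' IH IH']; last first.
  by rewrite tensDl !raddfD tensDl raddfD /= IH IH'.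
rewrite tmapE !crossE /=; elim/tens_ind: (R _) => [a' b'|s s' IH IH'].
  by rewrite !tassocVE !tmapE.
by rewrite !tensDr !raddfD /= IH IH'.
Qed.

(** [sweep W q] carries the factor [b] of [w ⊗ b ⊗ a_1 ⊗ ... ⊗ a_q] to the
    right end, across [a_1], ..., [a_q] in turn. *)
Fixpoint sweep W q : {linear CH A (tensor W B) q -> tensor (CH A W q) B} :=
  if q is n.+1 then cross (CH A W n) \o tmap (sweep W n) idfun else idfun.
Lemma sweepS W q (x : CH A (tensor W B) q) a :
  sweep W q.+1 (x ⊗ a) = cross (CH A W q) (sweep W q x ⊗ a).
Proof. by rewrite /= tmapE. Qed.
Lemma sweepD W q (x y : CH A (tensor W B) q) : sweep W q (x + y) = sweep W q x + sweep W q y.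
Proof. exact: raddfD. Qed.
Lemma sweepZ W q c (x : CH A (tensor W B) q) : sweep W q (c *: x) = c *: sweep W q x.
Proof. exact: linearZ. Qed.
Lemma sweep_nat X Y (f : {linear X -> Y}) q x :
  sweep Y q (CHf A (tmap f idfun) q x) = tmap (CHf A f q) idfun (sweep X q x).
Proof.
elim: q x => [//|q IH] x; elim/CH_ind: x => [x a|x y IHx IHy]; last first.
  by rewrite CHfD !sweepD raddfD IHx IHy.
by rewrite CHfS !sweepS IH -cross_nat.
Qed.
Lemma sweep1 W q x (f : {linear W -> tensor W B}) : (forall w, f w = w ⊗ (1 : B)) ->
  sweep W q (CHf A f q x) = x ⊗ (1 : B).
Proof.
move=> fE; elim: q x => [|q IH] x; first exact: fE.
elim/CH_ind: x => [x a|x y IHx IHy]; last by rewrite CHfD sweepD IHx IHy tensDl.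
by rewrite CHfS sweepS IH crossE distr1l tassocVE.
Qed.

Definition mulB W : {linear tensor (tensor W B) B -> tensor W B} :=
  tmap idfun (tmul B) \o tassoc W B B.
Lemma mulBD W x y : mulB W (x + y) = mulB W x + mulB W y.
Proof. exact: raddfD. Qed.
Lemma mulBE W (w : W) b b' : mulB W (w ⊗ b ⊗ b') = w ⊗ (b * b').
Proof. by rewrite /mulB /= tassocE tmapE tmulE. Qed.

Lemma mulB_nat U W (f : {linear U -> W}) t :
  mulB W (tmap (tmap f idfun) idfun t) = tmap f idfun (mulB U t).
Proof.
elim/tens_ind: t => [y b|t t' IHt IHt']; last by rewrite !(tlinD, mulBD) IHt IHt'.
elim/tens_ind: y => [u b'|t t' IHt IHt']; last by rewrite !(tlinD, mulBD) IHt IHt'.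
by rewrite !(mulBE, tmapE).
Qed.
(** The compatibility of [R] with the product of [B]. *)
Lemma cross_mulB W (t : tensor W B) b' a :
  cross W (mulB W (t ⊗ b') ⊗ a) =
  mulB (tensor W A) (tmap (cross W) idfun (tassocV (tensor W B) A B (t ⊗ R (b' ⊗ a)))).
Proof.
elim/tens_ind: t => [w b|t t' IH IH']; last first.
  by rewrite !(tlinD, crossD, mulBD) IH IH'.
rewrite mulBE crossE distrMlE.
elim/tens_ind: (R (b' ⊗ a)) => [a1 b1|s s' IH IH']; last first.
  by rewrite smash_mulDr !(tlinD, crossD, mulBD) IH IH'.
rewrite smash_mulE tassocVE tmapE crossE.
elim/tens_ind: (R (b ⊗ a1)) => [a2 b2|s s' IH IH']; last first.
  by rewrite raddfD !(tlinD, crossD, mulBD) -IH -IH'.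
by rewrite smash_actE !tassocVE mulBE mul1r.
Qed.
Lemma sweep_mulB W q x :
  sweep W q (CHf A (mulB W) q x) =
  mulB (CH A W q) (tmap (sweep W q) idfun (sweep (tensor W B) q x)).
Proof.
elim: q x => [|q IH] x; first by rewrite [tmap _ _ _](tmap_id (f := idfun)).
elim/CH_ind: x => [x a|x y IHx IHy]; last first.
  by rewrite CHfD !(tlinD, sweepD, mulBD) IHx IHy.
rewrite CHfS !sweepS IH; move: (sweep _ q x) => t {IH x}.
elim/tens_ind: t => [z b'|t t' IH IH']; last first.
  by rewrite !(tlinD, crossD, mulBD) IH IH'.
rewrite tmapE cross_mulB crossE /=; congr (mulB _ _).
elim/tens_ind: (R _) => [a1 b1|s s' IH IH']; last by rewrite !(tlinD, crossD, mulBD) IH IH'.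
by rewrite !tassocVE !tmapE /= tmapE.
Qed.

(** A left action of the smash biproduct on a space that may carry other
    structure: the spaces [CH_p(B, V)] are left modules over the smash biproduct
    but right modules over [A] only. *)
Record saction W := SAction {
  sact :> S -> {linear W -> W};
  sact_linear : forall w, linear (fun s => sact s w);
  sact1 : forall w, sact 1 w = w;
  sactM : forall s t w, sact (s * t) w = sact s (sact t w)
}.
Lemma sactD W (alpha : saction W) s t w : alpha (s + t) w = alpha s w + alpha t w.
Proof. by have := sact_linear alpha w 1 s t; rewrite !scale1r. Qed.

Definition inr_act W (alpha : saction W) b := alpha (smash_inr R b).

Section Absorb.
Variables (W : lmodType k) (alpha : saction W).
Fact absorb_bilin q : bilin (fun (x : CH A W q) (b : B) => CHf A (inr_act alpha b) q x).
Proof.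
split=> [b|x]; first exact: linearP.
move=> c b b'; apply: CHf_lin => u; rewrite /inr_act smash_inr_linear.
exact: sact_linear.
Qed.
(** After a sweep, [b] acts on the left of [W]. *)
Definition absorb q : {linear tensor (CH A W q) B -> CH A W q} := tlift (absorb_bilin q).
Lemma absorbE q x b : absorb q (x ⊗ b) = CHf A (inr_act alpha b) q x.
Proof. exact: tliftE. Qed.
Lemma absorbD q x y : absorb q (x + y) = absorb q x + absorb q y.
Proof. exact: raddfD. Qed.
End Absorb.

Lemma absorb_nat X Y (alpha : saction X) (gamma : saction Y) (f : {linear X -> Y}) q t :
  (forall s x, f (alpha s x) = gamma s (f x)) ->
  CHf A f q (absorb alpha q t) = absorb gamma q (tmap (CHf A f q) idfun t).
Proof.
move=> fs; elim/tens_ind: t => [x b|t t' IH IH']; last first.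
  by rewrite absorbD CHfD IH IH' raddfD absorbD.
by rewrite tmapE !absorbE !CHf_comp; apply: eq_CHf => x'; apply: fs.
Qed.

Lemma absorb1 W (alpha : saction W) q x : absorb alpha q (x ⊗ (1 : B)) = x.
Proof. by rewrite absorbE; apply: CHf_id => w; apply: (sact1 alpha). Qed.

Lemma absorb_mulB W (alpha : saction W) q t b' :
  absorb alpha q (mulB _ (t ⊗ b')) = absorb alpha q (tmap (CHf A (inr_act alpha b') q) idfun t).
Proof.
elim/tens_ind: t => [x b|t t' IH IH']; last by rewrite !(tlinD, mulBD, absorbD) IH IH'.
rewrite mulBE tmapE !absorbE CHf_comp; apply: eq_CHf => w.
by rewrite /inr_act /= smash_inrM sactM.
Qed.

(** The last face in the [B]-direction of [U ⊗ A^q], where [i] detaches the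
    factor [b] that goes around: the identity when [U = CH_(p+1)(B, V)], a
    change of brackets when [U] is an induced bimodule. *)
Definition last_face U W (alpha : saction W) (i : {linear U -> tensor W B}) q :
  {linear CH A U q -> CH A W q} := absorb alpha q \o (sweep W q \o CHf A i q).
Lemma last_faceE U W (alpha : saction W) (i : {linear U -> tensor W B}) q x :
  last_face alpha i q x = absorb alpha q (sweep W q (CHf A i q x)).
Proof. by []. Qed.

Lemma last_faceD U W (alpha : saction W) (i : {linear U -> tensor W B}) q x y :
  last_face alpha i q (x + y) = last_face alpha i q x + last_face alpha i q y.
Proof. exact: raddfD. Qed.
Lemma last_faceZ U W (alpha : saction W) (i : {linear U -> tensor W B}) q c x :
  last_face alpha i q (c *: x) = c *: last_face alpha i q x.
Proof. exact: linearZ. Qed.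
Lemma last_face_nat U W U' W' (alpha : saction W) (alpha' : saction W')
    (i : {linear U -> tensor W B}) (i' : {linear U' -> tensor W' B})
    (g : {linear U -> U'}) (f : {linear W -> W'}) q x :
  (forall s x, f (alpha s x) = alpha' s (f x)) ->
  (forall u, i' (g u) = tmap f idfun (i u)) ->
  last_face alpha' i' q (CHf A g q x) = CHf A f q (last_face alpha i q x).
Proof.
move=> fs ig; rewrite !last_faceE (absorb_nat _ fs) -sweep_nat !CHf_comp.
by congr (absorb _ _ (sweep _ _ _)); apply: eq_CHf.
Qed.

(** Multiplying two factors of [B] and letting the product cross and act is
    the same as letting them cross and act one after the other. *)
Lemma last_face_mulB U1 U2 W (alpha : saction W) (alpha1 : saction U1)
    (i1 : {linear U1 -> tensor W B}) (i2 : {linear U2 -> tensor U1 B})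
    (m : {linear U2 -> U1}) q x :
  (forall s u, i1 (alpha1 s u) = tmap (alpha s) idfun (i1 u)) ->
  (forall u, i1 (m u) = mulB W (tmap i1 idfun (i2 u))) ->
  last_face alpha i1 q (CHf A m q x) =
  last_face alpha i1 q (last_face alpha1 i2 q x).
Proof.
move=> i1s i1m; rewrite !last_faceE.
have -> : CHf A i1 q (CHf A m q x) =
    CHf A (mulB W) q (CHf A (tmap i1 idfun) q (CHf A i2 q x)).
  by rewrite !CHf_comp; apply: eq_CHf.
rewrite sweep_mulB sweep_nat tmap_comp.
move: (sweep U1 q _) => t {x}.
elim/tens_ind: t => [x b|t t' IH IH']; last first.
  by rewrite !(tlinD, mulBD, absorbD, CHfD, sweepD) IH IH'.
rewrite tmapE absorb_mulB absorbE CHf_comp /= -sweep_nat CHf_comp.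
by congr (absorb _ _ (sweep _ _ _)); apply: eq_CHf => u /=; rewrite i1s.
Qed.

Section LastFaceDiff.
Variables (U W : bimodule A) (alpha : saction W) (i : {linear U -> tensor W B}).
Hypothesis alpha_inl : forall a w, alpha (smash_inl R a) w = lact a w.
Hypothesis alpha_ract : forall s w a, alpha s (ract w a) = ract (alpha s w) a.
Hypothesis i_lact : forall a u, i (lact a u) = tmap (lact_by W a) idfun (i u).
Hypothesis i_ract : forall u a,
  i (ract u a) = tmap (mul_last W 0) idfun (cross W (i u ⊗ a)).

Definition cross_rmul q (t : tensor (CH A W q) B) a :=
  tmap (mul_last W q) idfun (cross (CH A W q) (t ⊗ a)).
(** The compatibility of [R] with the product of [A]. *)
Lemma sweep_rmul q (x : CH A U q) a :
  sweep W q (CHf A i q (rmul x a)) = cross_rmul (sweep W q (CHf A i q x)) a.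
Proof.
case: q x => [|q] x; first by rewrite rmul0; exact: i_ract.
elim/CH_ind: x => [x a0|x y IHx IHy]; last first.
  by rewrite rmulDl !CHfD !sweepD IHx IHy /cross_rmul !(tlinD, crossD).
rewrite rmulS !CHfS !sweepS; move: (sweep _ _ _) => t {x}.
elim/tens_ind: t => [z b|t t' IH IH']; last first.
  by rewrite !(tlinD, crossD) IH IH' /cross_rmul !(tlinD, crossD).
rewrite !crossE distrMrE.
elim/tens_ind: (R (b ⊗ a0)) => [a1 b1|s s' IH IH']; last first.
  by rewrite smash_mulDl !(tlinD, crossD) IH IH' /cross_rmul !(tlinD, crossD).
rewrite smash_mulE tassocVE /cross_rmul crossE.
elim/tens_ind: (R (b1 ⊗ a)) => [a2 b2|s s' IH IH']; last first.
  by rewrite raddfD !(tlinD, crossD) IH IH'.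
by rewrite smash_actE !tassocVE tmapE mulr1 -/(rmul _ _) rmulS.
Qed.

Lemma cross_bar q (t : tensor (CH A W q.+1) B) a :
  tmap (bar W q.+1) idfun (cross _ (t ⊗ a)) =
  cross _ (tmap (bar W q) idfun t ⊗ a) + (-1) ^+ q.+1 *: cross_rmul t a.
Proof.
elim/tens_ind: t => [z b|t t' IH IH']; last first.
  rewrite !(tlinD, crossD) IH IH' /cross_rmul !(tlinD, crossD) scalerDr.
  by rewrite addrACA.
rewrite /cross_rmul tmapE !crossE.
elim/tens_ind: (R _) => [a1 b1|s s' IH IH']; last first.
  by rewrite !(tlinD, crossD) IH IH' scalerDr addrACA.
by rewrite !tassocVE !tmapE -/(rmul _ _) -tensZl -tensDl barS.
Qed.
Lemma sweep_bar q x :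
  sweep W q (CHf A i q (bar U q x)) =
  tmap (bar W q) idfun (sweep W q.+1 (CHf A i q.+1 x)).
Proof.
elim: q x => [|q IH] x; elim/CH_ind: x => [x a|x y IHx IHy];
  try by rewrite barD !CHfD !sweepD IHx IHy raddfD.
  rewrite bar0 sweep_rmul CHfS sweepS; apply: eq_tmap => // y.
  elim/tens_ind: y => [w a'|y y' IH IH']; last by rewrite barD -IH -IH' raddfD.
  by rewrite bar0.
by rewrite barS CHfD CHfZ sweepD sweepZ CHfS sweepS IH sweep_rmul CHfS sweepS cross_bar.
Qed.

Lemma absorb_bar q t :
  bar W q (absorb alpha q.+1 t) = absorb alpha q (tmap (bar W q) idfun t).
Proof.
elim/tens_ind: t => [z b|t t' IH IH']; last first.
  by rewrite absorbD barD IH IH' raddfD absorbD.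
by rewrite tmapE !absorbE CHf_bar // => u a; apply: alpha_ract.
Qed.
Lemma last_face_bar q x :
  last_face alpha i q (bar U q x) = bar W q (last_face alpha i q.+1 x).
Proof. by rewrite !last_faceE sweep_bar absorb_bar. Qed.

(** Both ends of [z ⊗ (a ⊗ b)] act on the left of [W], first [b] and then [a]:
    together, this is the action of [a ⊗ b] in the smash biproduct. *)
Lemma cyc_absorb q z s :
  cyc W q (absorb alpha q.+1 (tassocV _ A B (z ⊗ s))) = CHf A (alpha s) q z.
Proof.
elim/tens_ind: s => [a b|s s' IH IH']; last first.
  rewrite !(tlinD, absorbD, cycD) IH IH' -[X in X + _ = _]scale1r; symmetry.
  by apply: CHf_lin => w; rewrite scale1r sactD.
rewrite tassocVE absorbE CHfS cycE CHf_comp; apply: eq_CHf => w /=.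
rewrite /lact_by -alpha_inl /inr_act -sactM; congr (alpha _ w).
by rewrite [LHS]smash_mulE distr1l smash_actE mul1r mulr1.
Qed.
Lemma last_face_cyc q x :
  last_face alpha i q (cyc U q x) = cyc W q (last_face alpha i q.+1 x).
Proof.
elim/CH_ind: x => [x a|x y IHx IHy]; last by rewrite !(cycD, last_faceD) IHx IHy.
rewrite !last_faceE cycE CHfS sweepS CHf_comp.
rewrite (eq_CHf (g := tmap (lact_by W a) idfun \o i)); last by move=> u; apply: i_lact.
rewrite -CHf_comp sweep_nat; move: (sweep _ _ _) => t {x}.
elim/tens_ind: t => [z b|t t' IH IH']; last first.
  by rewrite !(tlinD, crossD, absorbD, cycD) IH IH'.
rewrite tmapE absorbE crossE cyc_absorb CHf_comp; apply: eq_CHf => w /=.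
rewrite /lact_by -alpha_inl /inr_act -sactM; congr (alpha _ w).
by rewrite [LHS]smash_mulE smash_act1.
Qed.
(** The last [B]-face commutes with every [A]-face. For the products of
    neighbouring [a]'s this is [sweep_bar]; for the cyclic face, both composites
    let [1 ⊗ b] times [a ⊗ 1], that is [R (b ⊗ a)], act on [W]. *)
Lemma last_face_hoch q (x : CH A U q.+1) :
  last_face alpha i q (hoch_diff x) = hoch_diff (last_face alpha i q.+1 x).
Proof. by rewrite !hoch_diffE last_faceD last_faceZ last_face_bar last_face_cyc. Qed.
End LastFaceDiff.

End Crossing.

Section ChainActions.
Variables (k : fieldType) (A B : unitalAlgType k) (R : distr_law A B).
Local Notation S := (smash R : unitalAlgType k).

Section ActCH.
Variables (W : lmodType k) (alpha : saction R W) (p : nat).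
Definition act_CH_map (s : S) : {linear CH B W p -> CH B W p} := CHf B (alpha s) p.
Fact act_CH_linear x : linear (fun s => act_CH_map s x).
Proof. by move=> c s t; apply: CHf_lin => u; apply: sact_linear. Qed.
Fact act_CH1 x : act_CH_map 1 x = x.
Proof. by apply: CHf_id => u; apply: sact1. Qed.
Fact act_CHM s t x : act_CH_map (s * t) x = act_CH_map s (act_CH_map t x).
Proof. by rewrite /act_CH_map CHf_comp; apply: eq_CHf => u; apply: sactM. Qed.
Definition act_CH : saction R (CH B W p) := SAction act_CH_linear act_CH1 act_CHM.
End ActCH.

Section CrossedCH.
Variables (W : bimodule A) (alpha : saction R W).
Hypothesis alpha_inl : forall a w, alpha (smash_inl R a) w = lact a w.
Hypothesis alpha_ract : forall s w a, alpha s (ract w a) = ract (alpha s w) a.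
Local Notation CHB p := (CH_bimodule R W p).

Lemma act_CH_inl p a (x : CHB p) : act_CH alpha p (smash_inl R a) x = lact a x.
Proof. by rewrite /= /CH_lact CH_mapE; apply: eq_CHf => w; apply: alpha_inl. Qed.

Lemma act_CH_ract p s (x : CHB p) a :
  act_CH alpha p s (ract x a) = ract (act_CH alpha p s x : CHB p) a.
Proof.
rewrite /= /act_CH_map; elim: p x a => [|p IH] x a; first by rewrite !CH_ract0 alpha_ract.
elim/CH_ind: x => [x b|x y IHx IHy]; last by rewrite CH_ractD !CHfD CH_ractD IHx IHy.
rewrite CHfS !CH_ractS; elim/tens_ind: (R _) => [a' b'|t t' IHt IHt']; last first.
  by rewrite !CH_slideD CHfD IHt IHt'.
by rewrite !CH_slideE CHfS IH.
Qed.

Lemma peel_lact p a (u : CHB p.+1) :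
  (lact a u : CHB p.+1) = tmap (lact_by (CHB p) a) idfun u.
Proof. by apply: eq_tmap. Qed.
Lemma peel_ract p (u : CHB p.+1) a :
  (ract u a : CHB p.+1) = tmap (mul_last (CHB p) 0) idfun (cross R (CHB p) (u ⊗ a)).
Proof.
elim/CH_ind: u => [x b|x y IHx IHy]; last first.
  by rewrite tensDl crossD tmapD -IHx -IHy; apply: CH_ractD.
rewrite crossE -[LHS]/(CH_ract R _ _) CH_ractS /CH_slide; apply: eq_tmap => //.
by apply: tens_ext => y a'; rewrite -/(rmul _ _) rmul0.
Qed.
End CrossedCH.
End ChainActions.

Section SmashComplex.
Variables (k : fieldType) (A B : unitalAlgType k) (R : distr_law A B).
Local Notation S := (smash R : unitalAlgType k).

Section Bimodule.
Variable V : bimodule S.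

Definition act_lact : saction R V :=
  @SAction k A B R V (fun s => lact_by V s) (lact_bilin V).1 (@lact1 k S V) (@lactM k S V).

Local Notation CHB p := (CH_bimodule R (resA V) p).
Definition bbar p : {linear CHB p.+1 -> CHB p} := bar (resB V) p.
Definition aCH p : saction R (CHB p) := act_CH act_lact p.

Lemma bbar_act p s x : bbar p (aCH p.+1 s x) = aCH p s (bbar p x).
Proof.
have fr (v : resB V) b : lact_by V s (ract v b) = ract (lact_by V s v : resB V) b.
  exact: (esym (lractA _ _ _)).
pose g : {linear V -> V} := lact_by V s.
exact: esym (@CHf_bar _ _ (resB V) (resB V) g fr p x).
Qed.
Lemma bbar_lact p a x : bbar p (lact a x) = lact a (bbar p x).
Proof.
rewrite -(@act_CH_inl _ _ _ _ (resA V) act_lact) // -[RHS](@act_CH_inl _ _ _ _ (resA V) act_lact) //.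
exact: bbar_act.
Qed.

Definition bmul p : {linear tensor (CHB p) B -> CHB p} := mul_last (resB V) p.
Lemma bmulD p x y : bmul p (x + y) = bmul p x + bmul p y.
Proof. exact: raddfD. Qed.
Lemma bbarD p x y : bbar p (x + y) = bbar p x + bbar p y.
Proof. exact: raddfD. Qed.
(** For [p = 0] both sides are [v] acted on from the right by [1 ⊗ b] times
    [a ⊗ 1], which is [R (b ⊗ a)]; further factors of [B] are merged by the
    compatibility of [R] with the product of [B]. *)
Lemma rmul_slide p (x : CHB p) b a :
  CH_ract R (rmul (W := resB V) x b : CH B (resA V) p) a =
  bmul p (CH_slide R (x : CH B (resA V) p) (R (b ⊗ a))).
Proof.
elim: p x a b => [|p _] x a b.
  rewrite CH_ract0 rmul0.
  transitivity (ract (x : V) (R (b ⊗ a) : S)).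
    rewrite -[LHS]/(ract (ract (x : V) (smash_inr R b : S)) (smash_inl R a : S)).
    rewrite -ractM; apply: (congr1 (fun s : S => ract (x : V) s)).
    by rewrite [LHS]smash_mulE smash_act1.
  elim/tens_ind: (R _) => [a' b'|s s' IH IH']; last first.
    rewrite CH_slideD bmulD -IH -IH'.
    by have := (ract_bilin V).2 x 1 s s'; rewrite !scale1r.
  rewrite CH_slideE [bmul 0 _](rmul0 (W := resB V)) CH_ract0.
  rewrite -[RHS]/(ract (ract (x : V) (smash_inl R a' : S)) (smash_inr R b' : S)) -ractM.
  apply: (congr1 (fun s : S => ract (x : V) s)).
  by rewrite [RHS]smash_mulE distr1l smash_actE mul1r mulr1.
elim/CH_ind: x => [x b0|x y IHx IHy]; last first.
  rewrite rmulDl CH_ractD IHx IHy; apply: esym.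
  rewrite -[RHS](@bmulD p.+1); apply: (congr1 (bmul p.+1)).
  by rewrite /CH_slide !tlinD.
rewrite rmulS CH_ractS distrMlE.
elim/tens_ind: (R (b ⊗ a)) => [a1 b1|s s' IH IH']; last first.
  by rewrite smash_mulDr !CH_slideD bmulD IH IH'.
rewrite smash_mulE CH_slideE CH_ractS.
elim/tens_ind: (R (b0 ⊗ a1)) => [a2 b2|s s' IH IH']; last first.
  by rewrite raddfD !CH_slideD tensDl bmulD IH IH'.
rewrite smash_actE !CH_slideE mul1r.
by rewrite [RHS](rmulS (W := resB V)).
Qed.
Lemma bbar_ract p (x : CHB p.+1) a : bbar p (ract x a) = ract (bbar p x) a.
Proof.
rewrite -[ract x a]/(CH_ract R x a) -[RHS]/(CH_ract R (bbar p x) a).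
elim: p x a => [|p IH] x a.
  elim/tens_ind: x => [x b|x y IHx IHy]; last first.
    by rewrite CH_ractD !bbarD IHx IHy CH_ractD.
  rewrite [bbar 0 (x ⊗ b)](bar0 (W := resB V)) rmul_slide CH_ractS.
  elim/tens_ind: (R _) => [a' b'|t t' IHt IHt']; last first.
    by rewrite !CH_slideD bbarD bmulD IHt IHt'.
  by rewrite CH_slideE [LHS](bar0 (W := resB V)).
elim/tens_ind: x => [x b|x y IHx IHy]; last first.
  by rewrite CH_ractD !bbarD IHx IHy CH_ractD.
rewrite [bbar p.+1 (x ⊗ b)](barS (W := resB V)) CH_ractS.
transitivity (CH_slide R (bbar p x : CH B (resA V) p) (R (b ⊗ a)) +
   (-1) ^+ p.+1 *: bmul p.+1 (CH_slide R (x : CH B (resA V) p.+1) (R (b ⊗ a)))).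
  elim/tens_ind: (R _) => [a' b'|t t' IHt IHt']; last first.
    by rewrite !CH_slideD bbarD bmulD IHt IHt' scalerDr addrACA.
  by rewrite !CH_slideE -IH; apply: (barS (W := resB V)).
rewrite -rmul_slide CH_ractD CH_ractS; congr (_ + _).
by rewrite /CH_ract tensZl linearZ.
Qed.

Local Notation lastB p q := (last_face (aCH p) (idfun : {linear CHB p.+1 -> tensor (CHB p) B}) q).
Definition smash_dh p q : {linear CH A (CHB p.+1) q -> CH A (CHB p) q} :=
  CHf A (bbar p) q \+ ((-1) ^+ p.+1 : k) \*: lastB p q.
Definition smash_dv p q : {linear CH A (CHB p) q.+1 -> CH A (CHB p) q} :=
  ((-1) ^+ p : k) \*: (@hoch_diff k A (CHB p) q : {linear _ -> _}).
Lemma smash_dhE p q x :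
  smash_dh p q x = CHf A (bbar p) q x + (-1) ^+ p.+1 *: lastB p q x.
Proof. by []. Qed.
Lemma smash_dvE p q (x : CH A (CHB p) q.+1) : smash_dv p q x = (-1) ^+ p *: hoch_diff x.
Proof. by []. Qed.

Lemma smash_dhZ p q c x : smash_dh p q (c *: x) = c *: smash_dh p q x.
Proof. exact: linearZ. Qed.

(** The argument for the Hochschild differential: [last_face_mulB] plays the
    role of the identity relating the cyclic face to the product of the last
    two factors. *)
Lemma smash_hh p q x : smash_dh p q (smash_dh p.+1 q x) = 0.
Proof.
rewrite !smash_dhE [X in X *: last_face _ _ _ x]exprS mulN1r scaleNr.
apply: (@diff_sq k _ _ _ (CHf A (bbar p) q) (lastB p q) (CHf A (bbar p.+1) q) (lastB p.+1 q)).
  rewrite CHf_comp; have : forall n (z : CH A (CHB p.+2) n),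
      CHf A (bbar p \o bbar p.+1) n z = 0; last exact.
  elim=> [|n IH] z; first exact: (@bar_bar _ _ (resB V) p z).
  elim/CH_ind: z => [z c|z z' IHz IHz']; last by rewrite CHfD IHz IHz' addr0.
  by rewrite CHfS IH tens0l.
pose e : {linear CHB p.+2 -> CHB p.+1} := tmap (bbar p) idfun.
pose m : {linear CHB p.+2 -> CHB p.+1} := mul_last (resB V) p.+1.
have -> : CHf A (bbar p.+1) q x = (-1) ^+ p.+1 *: CHf A m q x + CHf A e q x.
  apply: CHf_lin => u; rewrite addrC; elim/tens_ind: u => [u c|u u' IHu IHu'].
    by rewrite [LHS](barS (W := resB V)) /e tmapE.
  by rewrite bbarD IHu IHu' !raddfD /= addrACA.
rewrite last_faceD last_faceZ addrC; congr (_ + _ *: _).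
  apply: last_face_nat => [s u|//]; exact: bbar_act.
apply: last_face_mulB => // u; symmetry.
have Ei : tmap (idfun : {linear CHB p.+1 -> tensor (CHB p) B}) (idfun : {linear B -> B}) u = u.
  exact: tmap_id.
exact: (congr1 (mulB B (CHB p)) Ei).
Qed.

Lemma lastB_hoch p q (x : CH A (CHB p.+1) q.+1) :
  lastB p q (hoch_diff x) = hoch_diff (lastB p q.+1 x).
Proof.
apply: last_face_hoch.
- move=> a w; exact: (@act_CH_inl _ _ _ _ (resA V) act_lact).
- move=> s w a; apply: (@act_CH_ract _ _ _ _ (resA V) act_lact).
  by move=> s' w' a'; exact: (esym (@lractA _ _ V s' w' (smash_inl R a' : S))).
- exact: peel_lact.
- exact: peel_ract.
Qed.
Lemma smash_dh_hoch p q (x : CH A (CHB p.+1) q.+1) :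
  smash_dh p q (hoch_diff x) = hoch_diff (smash_dh p q.+1 x).
Proof.
rewrite !smash_dhE lastB_hoch CHf_hoch; first by rewrite linearD linearZ.
  by move=> u a; apply: bbar_ract.
by move=> u a; apply: bbar_lact.
Qed.

Lemma smash_vv p q x : smash_dv p q (smash_dv p q.+1 x) = 0.
Proof. by rewrite !smash_dvE linearZ /= hoch_hoch !scaler0. Qed.
Lemma smash_hv p q x :
  smash_dh p q (smash_dv p.+1 q x) + smash_dv p q (smash_dh p q.+1 x) = 0.
Proof.
by rewrite !smash_dvE smash_dhZ smash_dh_hoch -scalerDl exprS mulN1r addNr scale0r.
Qed.

Definition smash_dc : dcomplex k := DComplex smash_hh smash_vv smash_hv.

Lemma smash_dc_col p q :
  lin_iso (chom (dccol smash_dc p) q) (HH (CH_bimodule R (resA V) p) q).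
Proof.
rewrite -hochc_chom.
(* Rescaling degree n by (-1)^(p n) removes the sign (-1)^p of smash_dv. *)
pose f n : {linear dccol smash_dc p n -> hochc (CHB p) n} := ((-1) ^+ p) ^+ n \*: idfun.
have fE n x : f n x = ((-1) ^+ p) ^+ n *: x by [].
apply: (@chain_iso_chom _ _ _ f) => n.
  move=> x; rewrite !fE -[ccd (dccol _ _) _ _]/(smash_dv p n x) smash_dvE.
  by rewrite scalerA -exprSr; apply: esym; apply: linearZ.
exists (fun x => ((-1) ^+ p) ^+ n *: x) => x;
  by rewrite fE scalerA -exprMn -expr2 sqrr_sign expr1n scale1r.
Qed.
End Bimodule.

Section Functoriality.
Variables (V V' : bimodule S) (f : {linear V -> V'}).
Hypothesis f_lact : forall s v, f (lact s v) = lact s (f v).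
Hypothesis f_ract : forall v s, f (ract v s) = ract (f v) s.
Local Notation fB p := (CHf B f p : {linear CH_bimodule R (resA V) p -> CH_bimodule R (resA V') p}).
Definition smash_map p q : {linear smash_dc V p q -> smash_dc V' p q} := CHf A (fB p) q.

Lemma fB_act p s x : fB p (aCH V p s x) = aCH V' p s (fB p x).
Proof. by rewrite /= /act_CH_map !CHf_comp; apply: eq_CHf => v; apply: f_lact. Qed.
Lemma fB_lact p a x : fB p (lact a x) = lact a (fB p x).
Proof.
have E U b y : (lact b y : CH_bimodule R (resA U) p) = aCH U p (smash_inl R b) y.
  by apply: esym; apply: (@act_CH_inl _ _ _ _ (resA U) (act_lact U)).
rewrite E [RHS]E; exact: fB_act.
Qed.
Lemma fB_ract p x a : fB p (ract x a) = ract (fB p x) a.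
Proof.
rewrite -[ract x a]/(CH_ract R x a) -[RHS]/(CH_ract R (fB p x) a).
elim: p x a => [|p IH] x a; first by rewrite !CH_ract0 /= f_ract.
elim/CH_ind: x => [x b|x y IHx IHy]; last by rewrite CH_ractD !CHfD CH_ractD IHx IHy.
rewrite CHfS !CH_ractS; elim/tens_ind: (R _) => [a' b'|t t' IHt IHt']; last first.
  by rewrite !CH_slideD CHfD IHt IHt'.
by rewrite !CH_slideE CHfS IH.
Qed.
Lemma smash_map_h p q x : smash_map p q (smash_dh V p q x) = smash_dh V' p q (smash_map p.+1 q x).
Proof.
rewrite /smash_map !smash_dhE CHfD CHfZ !CHf_comp; congr (_ + _ *: _).
  apply: eq_CHf => u; apply: (@CHf_bar _ _ (resB V) (resB V')) => v b; exact: f_ract.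
symmetry; apply: last_face_nat => // s u; exact: fB_act.
Qed.
Lemma smash_map_v p q x : smash_map p q (smash_dv V p q x) = smash_dv V' p q (smash_map p q.+1 x).
Proof.
rewrite /smash_map !smash_dvE CHfZ CHf_hoch // => u a; [exact: fB_ract|exact: fB_lact].
Qed.
End Functoriality.
End SmashComplex.

(** * Acyclicity of induced bimodules *)

Section BarContraction.
Variables (k : fieldType) (C : unitalAlgType k) (W : bimodule C).
Variable s0 : {linear W -> tensor W C}.
Hypothesis s0_split : forall w, bar W 0 (s0 w) = w.
Hypothesis s0_ract : forall w c, s0 (ract w c) = rmul (s0 w : CH C W 1) c.

(** A section [s0] of the action [W ⊗ C -> W] exhibits [W] as a relatively
    projective right module; applied to the coefficients, it contracts the bar
    complex, and also the Hochschild complex as soon as it is left linear. *)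
Fixpoint bar_sec n : {linear CH C W n -> CH C W n.+1} :=
  if n is m.+1 then tmap (bar_sec m) idfun else s0.
Lemma bar_secS n x c : bar_sec n.+1 (x ⊗ c) = bar_sec n x ⊗ c.
Proof. exact: tmapE. Qed.
Lemma bar_secD n x y : bar_sec n (x + y) = bar_sec n x + bar_sec n y.
Proof. exact: raddfD. Qed.
Lemma bar_secZ n a x : bar_sec n (a *: x) = a *: bar_sec n x.
Proof. exact: linearZ. Qed.
Lemma bar_sec_rmul n (x : CH C W n) c : bar_sec n (rmul x c) = rmul (bar_sec n x) c.
Proof.
case: n x => [|n] x; first by rewrite rmul0; exact: s0_ract.
elim/CH_ind: x => [x b|x y IHx IHy]; last by rewrite rmulDl !bar_secD rmulDl IHx IHy.
by rewrite rmulS !bar_secS rmulS.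
Qed.
Lemma bar_secK n x : bar W n.+1 (bar_sec n.+1 x) = x - bar_sec n (bar W n x).
Proof.
elim: n x => [|n IH] x; elim/CH_ind: x => [x c|x y IHx IHy];
  try by rewrite !(bar_secD, barD) IHx IHy opprD addrACA.
  by rewrite bar_secS barS s0_split bar0 bar_sec_rmul scaleN1r.
rewrite bar_secS barS IH [bar W n.+1 _]barS bar_secD bar_secZ bar_secS bar_sec_rmul.
by rewrite tensBl opprD addrA [in LHS]exprS mulN1r scaleNr.
Qed.
Lemma bar_sec_CHf (f : {linear W -> W}) n x :
  (forall w, s0 (f w) = tmap f idfun (s0 w)) ->
  bar_sec n (CHf C f n x) = CHf C f n.+1 (bar_sec n x).
Proof.
move=> sf; elim: n x => [|n IH] x; first exact: sf.
elim/CH_ind: x => [x c|x y IHx IHy]; last by rewrite !(CHfD, bar_secD) IHx IHy.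
by rewrite CHfS !bar_secS CHfS IH.
Qed.

Hypothesis s0_lact : forall w c, s0 (lact c w) = tmap (lact_by W c) idfun (s0 w).
Lemma bar_sec_cyc n x : cyc W n.+1 (bar_sec n.+1 x) = bar_sec n (cyc W n x).
Proof.
elim/CH_ind: x => [x c|x y IHx IHy]; last by rewrite !(bar_secD, cycD) IHx IHy.
by rewrite bar_secS !cycE bar_sec_CHf // => w; apply: s0_lact.
Qed.
Lemma hoch_sec n x : hoch_diff (bar_sec n.+1 x) = x - bar_sec n (hoch_diff x).
Proof.
rewrite !hoch_diffE bar_secK bar_sec_cyc bar_secD bar_secZ opprD addrA.
by rewrite [in LHS]exprS mulN1r scaleNr.
Qed.
Lemma hoch_sec0 w : hoch_diff (s0 w : CH C W 1) = w - cyc W 0 (s0 w).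
Proof. by rewrite hoch_diffE s0_split expr1 scaleN1r. Qed.
End BarContraction.

(** Here [F] is the bimodule over the smash biproduct induced from the right
    [A]-module [N]: as a right [B]-module it is [N ⊗ B]. The unit of [B]
    contracts the rows of [D(F)], and what they resolve is [CH(A, N)]. *)
Section Induced.
Variables (k : fieldType) (A B : unitalAlgType k) (R : distr_law A B).
Local Notation S := (smash R : unitalAlgType k).
Variables (F : bimodule S) (N : bimodule A) (gamma : saction R N).
Variables (u : {linear F -> tensor N B}) (uV : {linear tensor N B -> F}).
Hypotheses (uK : cancel u uV) (uVK : cancel uV u).
Hypothesis gamma_inl : forall a w, gamma (smash_inl R a) w = lact a w.
Hypothesis gamma_ract : forall s w a, gamma s (ract w a) = ract (gamma s w) a.
Hypothesis u_lact : forall s f, u (lact s f) = tmap (gamma s) idfun (u f).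
Hypothesis u_inl : forall f a,
  u (ract f (smash_inl R a : S)) = tmap (mul_last N 0) idfun (cross R N (u f ⊗ a)).
Hypothesis u_inr : forall f b, u (ract f (smash_inr R b : S)) = mulB B N (u f ⊗ b).

Local Notation CHB p := (CH_bimodule R (resA F) p).
Local Notation lastB p q := (last_face (aCH F p) (idfun : {linear CHB p.+1 -> tensor (CHB p) B}) q).

Definition unit_sec_fun (n : N) : F := uV (n ⊗ (1 : B)).
Fact unit_sec_linear : linear unit_sec_fun.
Proof. by move=> a x y; rewrite /unit_sec_fun tensPl linearP. Qed.
HB.instance Definition _ := GRing.isLinear.Build k N F *:%R unit_sec_fun unit_sec_linear.
Definition unit_sec : {linear N -> F} := unit_sec_fun.
Lemma unit_sec_act s n : unit_sec (gamma s n) = lact s (unit_sec n).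
Proof. by apply: (can_inj uK); rewrite u_lact !uVK tmapE. Qed.

Definition ind_s0 : {linear F -> tensor F B} := tmap unit_sec idfun \o u.
Lemma ind_s0_split (f : resB F) : bar (resB F) 0 (ind_s0 f) = f.
Proof.
rewrite -[RHS]uK /ind_s0 /=; elim/tens_ind: (u f) => [n b|t t' IH IH']; last first.
  by rewrite tmapD barD IH IH' raddfD.
rewrite tmapE [LHS](bar0 (W := resB F)) rmul0 /=.
apply: (can_inj uK); rewrite [LHS](u_inr (unit_sec n) b) !uVK mulBE.
by rewrite mul1r.
Qed.
Lemma ind_s0_ract (f : resB F) b : ind_s0 (ract f b) = rmul (W := resB F) (n := 1) (ind_s0 f) b.
Proof.
rewrite /ind_s0 /= [u _](u_inr f b); elim/tens_ind: (u f) => [n b'|t t' IH IH']; last first.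
  by rewrite !(tlinD, mulBD) IH IH'; apply: esym; apply: (@rmulDl _ _ (resB F) 1).
by rewrite mulBE !tmapE [RHS](rmulS (W := resB F) (n := 0)).
Qed.
Lemma ind_s0_act s f : ind_s0 (lact s f) = tmap (lact_by F s) idfun (ind_s0 f).
Proof.
rewrite /ind_s0 /= u_lact !tmap_comp; apply: eq_tmap => // n.
exact: unit_sec_act.
Qed.

Definition ind_sec p : {linear CHB p -> CHB p.+1} := bar_sec (W := resB F) ind_s0 p.
Lemma ind_secK p x : bbar F p.+1 (ind_sec p.+1 x) = x - ind_sec p (bbar F p x).
Proof. exact: (bar_secK (W := resB F) ind_s0_split ind_s0_ract). Qed.
Lemma ind_sec_act p s x : ind_sec p (aCH F p s x) = aCH F p.+1 s (ind_sec p x).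
Proof.
pose g : {linear F -> F} := lact_by F s.
exact: (@bar_sec_CHf _ _ (resB F) ind_s0 g p x (ind_s0_act s)).
Qed.

Definition ind_h p q : {linear CH A (CHB p) q -> CH A (CHB p.+1) q} := CHf A (ind_sec p) q.
(** The contraction commutes with the last face, because it is left linear
    ([ind_sec_act]), so only the bar part contributes to the homotopy. *)
Lemma ind_hK p q x : smash_dh F p.+1 q (ind_h p.+1 q x) = x - ind_h p q (smash_dh F p q x).
Proof.
rewrite !smash_dhE /ind_h.
rewrite (last_face_nat (alpha := aCH F p) (i := idfun) (f := ind_sec p)) //; last first.
  by move=> s y; apply: ind_sec_act.
rewrite CHfD CHfZ opprD addrA exprS mulN1r scaleNr; congr (_ - _).
rewrite !CHf_comp; apply/eqP; rewrite eq_sym subr_eq; apply/eqP.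
rewrite -[X in _ = X + _]scale1r -(@CHf_lin _ _ _ _ idfun) ?CHf_id //.
by move=> y; rewrite /= scale1r ind_secK subrK.
Qed.

Definition ind_eps q : {linear CH A (CHB 0) q -> CH A N q} := last_face gamma (u : {linear CHB 0 -> tensor N B}) q.
Lemma ind_eps_h q x : ind_eps q (smash_dh F 0 q x) = 0.
Proof.
rewrite /ind_eps smash_dhE last_faceD last_faceZ expr1 scaleN1r.
rewrite (@last_face_mulB _ _ _ _ _ _ _ _ (aCH F 0) _ (idfun : {linear CHB 1 -> tensor (CHB 0) B})).
- by rewrite subrr.
- by move=> s f; apply: u_lact.
- move=> y; elim/tens_ind: y => [f b|y y' IH IH']; last first.
    rewrite bbarD; transitivity (u (bbar F 0 y) + u (bbar F 0 y')); first exact: raddfD.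
    by rewrite IH IH' -mulBD -tmapD.
  rewrite [bbar F 0 _](bar0 (W := resB F)) rmul0 [LHS](u_inr f b).
  by rewrite /= tmapE.
Qed.
Lemma ind_eps_v q x : ind_eps q (smash_dv F 0 q x) = hoch_diff (ind_eps q.+1 x).
Proof.
rewrite smash_dvE expr0 scale1r; apply: last_face_hoch => //.
- move=> a f; rewrite -[lact a f]/(lact (smash_inl R a : S) (f : F)) u_lact.
  by apply: eq_tmap => // n; apply: gamma_inl.
- move=> f a; rewrite -[ract f a]/(CH_ract R f a) CH_ract0; exact: u_inl.
Qed.
Lemma ind_eps_sec q z : ind_eps q (CHf A unit_sec q z) = z.
Proof.
rewrite /ind_eps last_faceE CHf_comp sweep1 ?absorb1 // => n.
by rewrite /= uVK.
Qed.
Lemma ind_h0K q x : smash_dh F 0 q (ind_h 0 q x) = x - CHf A unit_sec q (ind_eps q x).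
Proof.
rewrite smash_dhE /ind_h expr1 scaleN1r.
rewrite (last_face_nat (alpha := gamma) (i := (u : {linear CHB 0 -> tensor N B})) (f := unit_sec)) //; last first.
  by move=> s y; apply: unit_sec_act.
congr (_ - _); rewrite CHf_comp; apply: CHf_id => f; exact: ind_s0_split.
Qed.

Lemma ind_eps_exact q x : ind_eps q x = 0 -> exists y, smash_dh F 0 q y = x.
Proof. by move=> x0; exists (ind_h 0 q x); rewrite ind_h0K x0 raddf0 subr0. Qed.
Lemma ind_h_exact p q x : smash_dh F p q x = 0 -> exists y, smash_dh F p.+1 q y = x.
Proof. by move=> x0; exists (ind_h p.+1 q x); rewrite ind_hK x0 raddf0 subr0. Qed.
Lemma ind_eps_surj q z : exists x, ind_eps q x = z.
Proof. by exists (CHf A unit_sec q z); apply: ind_eps_sec. Qed.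

Definition ind_aug_inj n x := @aug_inj k (smash_dc F) (hochc N) ind_eps ind_eps_v ind_eps_surj ind_eps_exact ind_h_exact n x.
Definition ind_aug_lift n z := @aug_lift k (smash_dc F) (hochc N) ind_eps ind_eps_v ind_eps_surj ind_eps_exact ind_h_exact n z.
End Induced.

Section BarBimodule.
Variables (k : fieldType) (C : unitalAlgType k) (V : bimodule C) (n : nat).
Definition bar_lact (c : C) (x : CH C V n) : CH C V n := CHf C (lact_by V c) n x.
Fact bar_lact_bilin : bilin bar_lact.
Proof.
split=> [x|c]; last exact: linearP.
by move=> a c d; apply: CHf_lin => w; apply: (lact_bilin V).1.
Qed.
Fact rmul_bilin : bilin (@rmul k C V n).
Proof. by split=> [c a x y|x a c d]; rewrite /rmul ?tensPl ?tensPr linearP. Qed.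
Fact bar_lact1 x : bar_lact 1 x = x.
Proof. by apply: CHf_id => w; apply: lact1. Qed.
Fact bar_lactM c d x : bar_lact (c * d) x = bar_lact c (bar_lact d x).
Proof. by rewrite /bar_lact CHf_comp; apply: eq_CHf => w; apply: lactM. Qed.
Fact bar_lractA c x d : rmul (bar_lact c x) d = bar_lact c (rmul x d).
Proof. by rewrite /bar_lact CHf_rmul // => w e; apply: lact_by_ract. Qed.
(** [V ⊗ C^n] as a bimodule; for positive [n] it is free as a right module. *)
Definition bar_bimodule : bimodule C :=
  Bimodule bar_lact_bilin rmul_bilin bar_lact1 (@rmul1 k C V n) bar_lactM
    (@rmulM k C V n) bar_lractA.
End BarBimodule.

Section FreeOverA.
Variables (k : fieldType) (A B : unitalAlgType k) (R : distr_law A B).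
Local Notation S := (smash R : unitalAlgType k).
Variable M : bimodule S.

(** The [A]-bimodule [M ⊗ A] with [A] acting on the left of [M] and on the right
    of [A]: what is left of [M ⊗ C] once the factor [B] has been contracted. *)
Definition freeA_lact (a : A) : {linear tensor M A -> tensor M A} :=
  tmap (lact_by M (smash_inl R a)) idfun.
Definition freeA_ract (x : tensor M A) (a : A) : tensor M A := tmap idfun (amulr a) x.
Fact freeA_lact_bilin : bilin (fun a x => freeA_lact a x).
Proof.
split=> [x|a]; last exact: linearP.
move=> c a a'; elim/tens_ind: x => [m b|x y IHx IHy]; last first.
  by rewrite !tmapD IHx IHy scalerDr addrACA.
rewrite !tmapE -tensPl; congr (_ ⊗ _).
exact: (lact_bilin (resA M)).1.
Qed.
Fact freeA_ract_bilin : bilin freeA_ract.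
Proof.
split=> [a|x]; first exact: linearP.
move=> c a a'; elim/tens_ind: x => [m b|x y IHx IHy]; last first.
  by rewrite /freeA_ract !tmapD -!/(freeA_ract _ _) IHx IHy scalerDr addrACA.
by rewrite /freeA_ract !tmapE -tensPr /amulr [X in _ ⊗ X](amul_bilin A).2.
Qed.
Fact freeA_lact1 x : freeA_lact 1 x = x.
Proof. by apply: tmap_id => // m; apply: lact1. Qed.
Fact freeA_ract1 x : freeA_ract x 1 = x.
Proof. by apply: tmap_id => // a; apply: mulr1. Qed.
Fact freeA_lactM a b x : freeA_lact (a * b) x = freeA_lact a (freeA_lact b x).
Proof.
rewrite /freeA_lact tmap_comp; apply: eq_tmap => // m.
by rewrite /lact_by /= /lact_by smash_inlM lactM.
Qed.
Fact freeA_ractM x a b : freeA_ract x (a * b) = freeA_ract (freeA_ract x a) b.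
Proof.
by rewrite /freeA_ract tmap_comp; apply: eq_tmap => // c; apply: mulrA.
Qed.
Fact freeA_lractA a x b : freeA_ract (freeA_lact a x) b = freeA_lact a (freeA_ract x b).
Proof. by rewrite /freeA_ract !tmap_comp; apply: eq_tmap. Qed.
Definition freeA : bimodule A :=
  Bimodule freeA_lact_bilin freeA_ract_bilin freeA_lact1 freeA_ract1 freeA_lactM
    freeA_ractM freeA_lractA.

Definition freeA_smap (s : S) : {linear tensor M A -> tensor M A} := tmap (lact_by M s) idfun.
Fact freeA_smap_linear x : linear (fun s => freeA_smap s x).
Proof.
move=> c a a'; elim/tens_ind: x => [m b|x y IHx IHy]; last first.
  by rewrite !tmapD IHx IHy scalerDr addrACA.
rewrite !tmapE -tensPl; congr (_ ⊗ _); exact: (lact_bilin M).1.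
Qed.
Fact freeA_smap1 x : freeA_smap 1 x = x.
Proof. by apply: tmap_id => // m; apply: lact1. Qed.
Fact freeA_smapM s t x : freeA_smap (s * t) x = freeA_smap s (freeA_smap t x).
Proof. by rewrite /freeA_smap tmap_comp; apply: eq_tmap => // m; apply: lactM. Qed.
Definition freeA_act : saction R freeA :=
  @SAction k A B R freeA freeA_smap freeA_smap_linear freeA_smap1 freeA_smapM.

Definition freeA_one_fun (m : M) : freeA := m ⊗ (1 : A).
Fact freeA_one_linear : linear freeA_one_fun. Proof. by move=> a x y; apply: tensPl. Qed.
HB.instance Definition _ := GRing.isLinear.Build k M freeA *:%R freeA_one_fun freeA_one_linear.
Definition freeA_s0 : {linear freeA -> tensor freeA A} := tmap freeA_one_fun idfun.
Lemma freeA_s0_split (w : freeA) : bar freeA 0 (freeA_s0 w) = w.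
Proof.
rewrite /freeA_s0; elim/tens_ind: w => [m a|x y IHx IHy]; last by rewrite tmapD barD IHx IHy.
by rewrite tmapE bar0 rmul0 /= /freeA_ract tmapE /= /amulr mul1r.
Qed.
Lemma freeA_s0_ract (w : freeA) a : freeA_s0 (ract w a) = rmul (freeA_s0 w : CH A freeA 1) a.
Proof.
rewrite /freeA_s0 /= /freeA_ract.
elim/tens_ind: w => [m b|x y IHx IHy]; last first.
  by rewrite !tmapD IHx IHy; apply: esym; apply: (@rmulDl _ _ freeA 1).
by rewrite !tmapE [RHS](@rmulS _ _ freeA 0).
Qed.
Lemma freeA_s0_lact (w : freeA) a :
  freeA_s0 (lact a w) = tmap (lact_by freeA a) idfun (freeA_s0 w).
Proof.
rewrite /freeA_s0 /= /freeA_lact !tmap_comp; apply: eq_tmap => // m.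
by rewrite /= /lact_by /= /freeA_lact tmapE.
Qed.

(** The quotient by commutators identifies [m ⊗ a] with [a m]. *)
Fact freeA_aug_bilin : bilin (fun (m : M) (a : A) => lact (smash_inl R a : S) m).
Proof.
split=> [a|m]; first exact: (lact_bilin M).2.
exact: (lact_bilin (resA M)).1.
Qed.
Definition freeA_aug : {linear freeA -> M} := tlift freeA_aug_bilin.
Lemma freeA_augE m a : freeA_aug (m ⊗ a) = lact (smash_inl R a : S) m.
Proof. exact: tliftE. Qed.
Lemma freeA_augK m : freeA_aug (m ⊗ (1 : A)) = m.
Proof. by rewrite freeA_augE; apply: lact1. Qed.
Lemma freeA_augD x y : freeA_aug (x + y) = freeA_aug x + freeA_aug y.
Proof. exact: raddfD. Qed.
Lemma freeA_aug_hoch (x : CH A freeA 1) : freeA_aug (hoch_diff x) = 0.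
Proof.
elim/CH_ind: x => [w a|x y IHx IHy]; last first.
  by rewrite (linearD (@hoch_diff _ _ freeA 0)) freeA_augD IHx IHy addr0.
rewrite hoch_diffE bar0 rmul0 cycE expr1 scaleN1r /= /freeA_ract /lact_by /= /freeA_lact.
elim/tens_ind: w => [m b|x y IHx IHy]; last first.
  by rewrite !tmapD opprD addrACA freeA_augD IHx IHy addr0.
by rewrite !tmapE raddfB /= !freeA_augE /= /amulr /lact_by smash_inlM lactM subrr.
Qed.
Lemma freeA_aug_exact (w : freeA) : freeA_aug w = 0 -> exists x : CH A freeA 1, w = hoch_diff x.
Proof.
move=> w0; exists (freeA_s0 w); rewrite hoch_sec0; last exact: freeA_s0_split.
suff -> : cyc freeA 0 (freeA_s0 w) = freeA_one_fun (freeA_aug w).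
  by rewrite w0 raddf0 subr0.
rewrite /freeA_s0; elim/tens_ind: {w0} w => [m a|x y IHx IHy]; last first.
  by rewrite tmapD cycD IHx IHy -raddfD -raddfD.
rewrite tmapE cycE /= /lact_by /= /freeA_lact /freeA_one_fun tmapE.
by rewrite freeA_augE.
Qed.
Lemma freeA_hoch_exact n (x : CH A freeA n.+1) :
  hoch_diff x = 0 -> exists y : CH A freeA n.+2, x = hoch_diff y.
Proof.
move=> x0; exists (bar_sec freeA_s0 n.+1 x).
rewrite (hoch_sec freeA_s0_split freeA_s0_ract freeA_s0_lact).
by rewrite x0 raddf0 subr0.
Qed.
End FreeOverA.

Section BarInduced.
Variables (k : fieldType) (A B : unitalAlgType k) (R : distr_law A B).
Local Notation S := (smash R : unitalAlgType k).
Variables (V : bimodule S) (m : nat).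
Local Notation M := (bar_bimodule V m).
Local Notation F := (bar_bimodule V m.+1).
Local Notation N := (freeA M).

(** The smash biproduct and [A ⊗ B] are the same space, with two module
    structures whose operations coincide. *)
Definition smash_tensor (s : S) : tensor A B := s.
Fact smash_tensor_linear : linear smash_tensor. Proof. by []. Qed.
HB.instance Definition _ := GRing.isLinear.Build k S (tensor A B) *:%R smash_tensor smash_tensor_linear.
Definition tensor_smash (s : tensor A B) : S := s.
Fact tensor_smash_linear : linear tensor_smash. Proof. by []. Qed.
HB.instance Definition _ := GRing.isLinear.Build k (tensor A B) S *:%R tensor_smash tensor_smash_linear.

Definition split_free : {linear F -> tensor N B} :=
  tassocV M A B \o tmap (idfun : {linear M -> M}) smash_tensor.
Definition join_free : {linear tensor N B -> F} :=
  tmap (idfun : {linear M -> M}) tensor_smash \o tassoc M A B.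
Lemma split_freeE (x : M) a b : split_free (x ⊗ (a ⊗ b : S)) = x ⊗ a ⊗ b.
Proof. by rewrite /split_free /= tmapE [LHS]tassocVE. Qed.
Lemma split_freeD x y : split_free (x + y) = split_free x + split_free y.
Proof. exact: raddfD. Qed.
Lemma split_freeK : cancel split_free join_free.
Proof. by move=> x; rewrite /join_free /= tassocVK tmap_comp tmap_id. Qed.
Lemma join_freeK : cancel join_free split_free.
Proof. by move=> x; rewrite /split_free /= tmap_comp tmap_id // tassocK. Qed.
Lemma bar_free_ind (P : F -> Prop) :
  (forall (x : M) (a : A) (b : B), P (x ⊗ (a ⊗ b : S))) ->
  (forall x y, P x -> P y -> P (x + y)) -> forall x, P x.
Proof.
move=> Pt PD; elim/tens_ind => // x s.
move: s; apply: (@tens_ind k A B (fun s => P (x ⊗ (s : S)))) => // s s' Ps Ps'.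
have -> : x ⊗ ((s + s' : tensor A B) : S) = x ⊗ (s : S) + x ⊗ (s' : S) by rewrite -tensDr.
exact: PD.
Qed.
Lemma split_free_lact s f :
  split_free (lact s f) = tmap (freeA_act M s) idfun (split_free f).
Proof.
elim/bar_free_ind: f => [x a b|f f' IH IH']; last first.
  by rewrite [lact s _](linearD (lact_by F s)) !split_freeD tmapD -IH -IH'.
rewrite split_freeE !tmapE [lact s _](CHfS (lact_by V s) x (a ⊗ b : S)).
by rewrite split_freeE.
Qed.
Lemma split_free_inl f a :
  split_free (ract f (smash_inl R a : S)) =
  tmap (mul_last N 0) idfun (cross R N (split_free f ⊗ a)).
Proof.
elim/bar_free_ind: f => [x a0 b|f f' IH IH']; last first.
  rewrite [ract _ _](linearD (ract_by F (smash_inl R a : S))) !split_freeD.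
  by rewrite tensDl crossD tmapD -IH -IH'.
rewrite [ract _ _](rmulS (W := V) x (a0 ⊗ b : S)) [_ * _]smash_mulE split_freeE crossE.
elim/tens_ind: (R _) => [a' b'|t t' IHt IHt']; last first.
  by rewrite raddfD !tlinD split_freeD IHt IHt'.
rewrite smash_actE split_freeE tassocVE tmapE -/(rmul _ _) rmul0 mulr1.
by rewrite /= /freeA_ract tmapE.
Qed.
Lemma split_free_inr f b :
  split_free (ract f (smash_inr R b : S)) = mulB B N (split_free f ⊗ b).
Proof.
elim/bar_free_ind: f => [x a0 b0|f f' IH IH']; last first.
  rewrite [ract _ _](linearD (ract_by F (smash_inr R b : S))) !split_freeD.
  by rewrite tensDl mulBD -IH -IH'.
rewrite [ract _ _](rmulS (W := V) x (a0 ⊗ b0 : S)) [_ * _]smash_mulE distr1r.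
by rewrite smash_actE !split_freeE mulBE mulr1.
Qed.
Lemma freeA_act_inl a w : freeA_act M (smash_inl R a) w = lact a w.
Proof. by []. Qed.
Lemma freeA_act_ract s w a : freeA_act M s (ract w a) = ract (freeA_act M s w) a.
Proof. by rewrite /= /freeA_ract /freeA_smap !tmap_comp; apply: eq_tmap. Qed.

Local Notation eps := (ind_eps (freeA_act M) split_free).
Definition bar_eta : {linear totc (smash_dc F) 0 -> M} := freeA_aug M \o augc (X := smash_dc F) (P := hochc N) eps 0.
Lemma bar_eta_aug x : bar_eta x = freeA_aug M (eps 0%N (val x (0%N, 0%N))).
Proof. by []. Qed.
(** [x ⊗ (a ⊗ b)] goes to [a (b x)], the left action of [a ⊗ b] on [x]. *)
Lemma bar_etaE x : bar_eta x = cyc V m (val x (0%N, 0%N)).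
Proof.
rewrite bar_eta_aug; move: (val x _) => f {x}.
transitivity (freeA_aug M (absorb (freeA_act M) 0 (split_free f))); first by [].
elim/bar_free_ind: f => [x a b|f f' IH IH']; last first.
  by rewrite split_freeD absorbD freeA_augD IH IH' cycD.
rewrite split_freeE absorbE /= /inr_act /= /freeA_smap tmapE freeA_augE.
rewrite [RHS](cycE (W := V) x (a ⊗ b : S)) -[RHS]/(lact (a ⊗ b : S) (x : M)).
rewrite -lactM; apply: (congr1 (fun s : S => lact s (x : M))).
by rewrite [LHS]smash_mulE distr1l smash_actE mul1r mulr1.
Qed.

Lemma bar_eta_surj y : exists x, bar_eta x = y.
Proof.
have [||||||||x _ e] := @ind_aug_lift _ _ _ R F N (freeA_act M) split_free join_free _ _ _ _ _ _ _ 0 (y ⊗ (1 : A)).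
all: try done.
- exact: split_freeK.
- exact: join_freeK.
- exact: freeA_act_ract.
- exact: split_free_lact.
- exact: split_free_inl.
- exact: split_free_inr.
- by exists x; rewrite -[RHS]freeA_augK -e.
Qed.
Lemma bar_eta_d (x : totc (smash_dc F) 1) : bar_eta (ccd (totc (smash_dc F)) 0 x) = 0.
Proof.
rewrite bar_eta_aug.
rewrite -[X in eps _ X]/(smash_dh F 0 0 (val x (1%N, 0%N)) + smash_dv F 0 0 (val x (0%N, 1%N))).
rewrite (linearD (eps 0%N)).
rewrite (ind_eps_h (F := F) split_free_lact split_free_inr) add0r.
rewrite (ind_eps_v (F := F)); first exact: freeA_aug_hoch.
- exact: freeA_act_inl.
- exact: freeA_act_ract.
- exact: split_free_lact.
- exact: split_free_inl.
Qed.
Lemma bar_tot_exact n (x : totc (smash_dc F) n.+1) :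
  ccd (totc (smash_dc F)) n x = 0 -> exists y, ccd (totc (smash_dc F)) n.+1 y = x.
Proof.
move=> x0.
have H := @ind_aug_inj _ _ _ R F N (freeA_act M) split_free join_free split_freeK join_freeK
  freeA_act_inl freeA_act_ract split_free_lact split_free_inl split_free_inr n.+1 x x0.
case: H => [|y ->]; last by exists y.
apply: freeA_hoch_exact.
have [fd _ _] := augc_quasi_iso (X := smash_dc F) (P := hochc N) (eps := eps)
  (ind_eps_h (F := F) split_free_lact split_free_inr)
  (ind_eps_v (F := F) freeA_act_inl freeA_act_ract split_free_lact split_free_inl)
  (ind_eps_surj (F := F) (freeA_act M) join_freeK)
  (ind_eps_exact (F := F) split_freeK join_freeK split_free_lact split_free_inr)
  (ind_h_exact (F := F) split_freeK join_freeK split_free_lact split_free_inr).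
by have := fd n x; rewrite x0 raddf0 => /esym.
Qed.
Lemma bar_eta_exact (x : totc (smash_dc F) 0) : bar_eta x = 0 ->
  exists y, ccd (totc (smash_dc F)) 0 y = x.
Proof.
move=> x0.
have H := @ind_aug_inj _ _ _ R F N (freeA_act M) split_free join_free split_freeK join_freeK
  freeA_act_inl freeA_act_ract split_free_lact split_free_inl split_free_inr 0 x erefl.
case: H => [|y ->]; last by exists y.
exact: (freeA_aug_exact (M := M) x0).
Qed.
End BarInduced.

(** * Comparison with the Hochschild complex *)

Lemma ccdZ (k : fieldType) (K : ccomplex k) n a x : ccd K n (a *: x) = a *: ccd K n x.
Proof. exact: linearZ. Qed.

Section TotMap.
Variables (k : fieldType) (A B : unitalAlgType k) (R : distr_law A B).
Local Notation S := (smash R : unitalAlgType k).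
Implicit Types U V W : bimodule S.

Section Def.
Variables (V W : bimodule S) (f : {linear V -> W}).
Definition totT_map (x : totT (smash_dc V)) : totT (smash_dc W) :=
  fun i => smash_map f i.1 i.2 (x i).
Fact totT_map_linear : linear totT_map.
Proof. by move=> a x y; apply: dprodP => i; apply: linearP. Qed.
HB.instance Definition _ := GRing.isLinear.Build k (totT (smash_dc V)) (totT (smash_dc W))
  *:%R totT_map totT_map_linear.
Lemma totT_map_deg n x : x \in deg (smash_dc V) n -> totT_map x \in deg (smash_dc W) n.
Proof. by move=> /degP xn; apply/degP => p q pq; rewrite /totT_map xn // raddf0. Qed.
Definition totc_map n : {linear totc (smash_dc V) n -> totc (smash_dc W) n} :=
  restr (@totT_map_deg n%:Z).
End Def.

Lemma smash_map_comp U V W (f : {linear V -> W}) (g : {linear U -> V}) p q x :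
  smash_map f p q (smash_map g p q x) = smash_map (f \o g) p q x.
Proof. by rewrite /smash_map CHf_comp; apply: eq_CHf => y; apply: CHf_comp. Qed.
Lemma smash_map_lin V W (f g h : {linear V -> W}) a p q x :
  (forall v, f v = a *: g v + h v) ->
  smash_map f p q x = a *: smash_map g p q x + smash_map h p q x.
Proof. by move=> fgh; apply: CHf_lin => y; apply: CHf_lin. Qed.
Lemma smash_map_id V (f : {linear V -> V}) p q x : f =1 id -> smash_map f p q x = x.
Proof. by move=> fi; apply: CHf_id => y; apply: CHf_id. Qed.
Lemma smash_map0 V W (f : {linear V -> W}) p q x :
  (forall v, f v = 0) -> smash_map f p q x = 0.
Proof.
move=> f0; have := @smash_map_lin V W f f f 1 p q x.
rewrite scale1r => E; apply: (addrI (smash_map f p q x)).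
by rewrite addr0 -E // => v; rewrite f0 scaler0 addr0.
Qed.

Lemma totc_map_comp U V W (f : {linear V -> W}) (g : {linear U -> V}) n x :
  totc_map f n (totc_map g n x) = totc_map (f \o g) n x.
Proof. by apply: val_inj; apply: dprodP => i; apply: smash_map_comp. Qed.
Lemma totc_map_lin V W (f g h : {linear V -> W}) a n x :
  (forall v, f v = a *: g v + h v) ->
  totc_map f n x = a *: totc_map g n x + totc_map h n x.
Proof. by move=> fgh; apply: val_inj; apply: dprodP => i; apply: smash_map_lin. Qed.
Lemma totc_map_id V (f : {linear V -> V}) n x : f =1 id -> totc_map f n x = x.
Proof. by move=> fi; apply: val_inj; apply: dprodP => i; apply: smash_map_id. Qed.
Lemma totc_map0 V W (f : {linear V -> W}) n x :
  (forall v, f v = 0) -> totc_map f n x = 0.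
Proof. by move=> f0; apply: val_inj; apply: dprodP => i; apply: smash_map0. Qed.
Lemma totc_map_d V W (f : {linear V -> W}) n x :
  (forall s v, f (lact s v) = lact s (f v)) ->
  (forall v s, f (ract v s) = ract (f v) s) ->
  totc_map f n (ccd (totc (smash_dc V)) n x) = ccd (totc (smash_dc W)) n (totc_map f n.+1 x).
Proof.
move=> fl fr; apply: val_inj; apply: dprodP => -[p q].
rewrite /= /totT_map /totd_fun [LHS]linearD /=.
by rewrite (smash_map_h fl fr) (smash_map_v fl fr).
Qed.
End TotMap.

Section Comparison.
Variables (k : fieldType) (A B : unitalAlgType k) (R : distr_law A B).
Local Notation S := (smash R : unitalAlgType k).
Variable V : bimodule S.
Local Notation F m := (bar_bimodule V m.+1).
Local Notation T m := (totc (smash_dc (F m))).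

Definition bar_step m : {linear F m.+1 -> F m} := bar V m.+1.
Lemma bar_step_lact m s v : bar_step m (lact s v) = lact s (bar_step m v).
Proof. exact: esym (@CHf_bar k S V V (lact_by V s) (lact_by_ract (W := V) s) m.+1 v). Qed.
Lemma bar_step_ract m v s : bar_step m (ract v s) = ract (bar_step m v) s.
Proof. exact: (@bar_rmul k S V m.+1 v s). Qed.
Definition bar_aug : {linear F 0 -> V} := bar V 0.
Lemma bar_aug_lact s v : bar_aug (lact s v) = lact s (bar_aug v).
Proof. exact: esym (@CHf_bar k S V V (lact_by V s) (lact_by_ract (W := V) s) 0 v). Qed.
Lemma bar_aug_ract v s : bar_aug (ract v s) = ract (bar_aug v) s.
Proof. by rewrite -[RHS](@rmul0 k S V); apply: (@bar_rmul k S V 0 v s). Qed.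

Definition bar_one_fun m (x : CH S V m) : F m := x ⊗ (1 : S).
Fact bar_one_linear m : linear (@bar_one_fun m). Proof. by move=> a x y; apply: tensPl. Qed.
HB.instance Definition _ m := GRing.isLinear.Build k (CH S V m) (F m) *:%R
  (@bar_one_fun m) (@bar_one_linear m).
Definition bar_one m : {linear F m -> F m.+1} := (@bar_one_fun m.+1 : {linear CH S V m.+1 -> F m.+1}).
Definition aug_one : {linear V -> F 0} := (@bar_one_fun 0 : {linear CH S V 0 -> F 0}).
Lemma bar_step_one m x :
  bar_step m.+1 (bar_one m.+1 x) = (-1) ^+ m.+2 *: x + bar_one m (bar_step m x).
Proof. by rewrite [LHS](barS (W := V)) rmul1 addrC. Qed.
Lemma bar_step_one0 x :
  bar_step 0 (bar_one 0 x) = (-1) *: x + aug_one (bar_aug x).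
Proof. by rewrite [LHS](barS (W := V)) rmul1 addrC expr1. Qed.
Lemma bar_aug_one v : bar_aug (aug_one v) = v.
Proof. by rewrite [LHS](bar0 (W := V)) rmul1. Qed.

(** The triple complex [D(F_m)], with two of its directions totalized. *)
Definition res_h m n : {linear T m.+1 n -> T m n} := totc_map (bar_step m) n.
Definition res_v m n : {linear T m n.+1 -> T m n} := ((-1) ^+ m : k) \*: ccd (T m) n.
Lemma res_hZ m n a x : res_h m n (a *: x) = a *: res_h m n x.
Proof. exact: linearZ. Qed.
Lemma res_vE m n x : res_v m n x = (-1) ^+ m *: ccd (T m) n x.
Proof. by []. Qed.
Lemma res_hh m n x : res_h m n (res_h m.+1 n x) = 0.
Proof. by rewrite /res_h totc_map_comp; apply: totc_map0 => v; apply: bar_bar. Qed.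
Lemma res_vv m n x : res_v m n (res_v m n.+1 x) = 0.
Proof. by rewrite !res_vE ccdZ ccdd !scaler0. Qed.
Lemma res_hv m n x : res_h m n (res_v m.+1 n x) + res_v m n (res_h m n.+1 x) = 0.
Proof.
rewrite !res_vE res_hZ /res_h (totc_map_d _ (@bar_step_lact m) (@bar_step_ract m)).
by rewrite -scalerDl exprS mulN1r addNr scale0r.
Qed.
Definition res_dc : dcomplex k := DComplex res_hh res_vv res_hv.

(** The [m]-direction is contracted by [D] of the maps [y |-> y ⊗ 1], up to the
    sign with which they occur in the bar differential. *)
Lemma res_tot_smash n : lin_iso (chom (totc res_dc) n) (chom (totc (smash_dc V)) n).
Proof.
apply: (quasi_iso_chom _ (@augc_quasi_iso k res_dc (totc (smash_dc V)) (fun n => totc_map bar_aug n) _ _ _ _ _)).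
- by move=> q x; rewrite /= /res_h totc_map_comp; apply: totc_map0 => v; exact: (@bar_bar k S V 0 v).
- move=> q x; rewrite [dcv _ _ _ _]res_vE expr0 scale1r.
  exact: (totc_map_d _ bar_aug_lact bar_aug_ract).
- move=> q z; exists (totc_map aug_one q z); rewrite totc_map_comp.
  by apply: totc_map_id => v; apply: bar_aug_one.
- move=> q x x0; exists (- totc_map (bar_one 0) q x).
  rewrite [LHS]linearN /= /res_h totc_map_comp.
  rewrite (@totc_map_lin _ _ _ _ _ _ _ idfun (aug_one \o bar_aug) (-1)); last exact: bar_step_one0.
  by rewrite -totc_map_comp x0 raddf0 addr0 totc_map_id // scaleN1r opprK.
- move=> m q x x0; exists ((-1) ^+ m.+2 *: totc_map (bar_one m.+1) q x).
  rewrite [LHS]linearZ /= /res_h totc_map_comp.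
  rewrite (@totc_map_lin _ _ _ _ _ _ _ idfun (bar_one m \o bar_step m) ((-1) ^+ m.+2)); last exact: bar_step_one.
  rewrite -totc_map_comp -/(res_h m q) [res_h _ _ _]x0 raddf0 addr0 totc_map_id //.
  by rewrite scalerA -expr2 sqrr_sign scale1r.
Qed.

(** The [n]-direction has homology [V ⊗ C^m] in degree [0] only, and [bar_cyc]
    computes the differential induced there. *)
Lemma res_tot_hoch n : lin_iso (chom (totc (dc_transpose res_dc)) n) (chom (hochc V) n).
Proof.
apply: (quasi_iso_chom _ (@augc_quasi_iso k (dc_transpose res_dc) (hochc V) (fun m => bar_eta V m) _ _ _ _ _)).
- move=> m x; rewrite [dch _ _ _ _]res_vE linearZ_LR.
  by rewrite [X in _ *: X]bar_eta_d scaler0.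
- move=> m x; rewrite [LHS]bar_etaE [X in ccd _ _ X]bar_etaE.
  exact: etrans (@bar_cyc k S V m (val x (0%N, 0%N))) (esym (hoch_diffE _)).
- by move=> m z; apply: bar_eta_surj.
- move=> m x /bar_eta_exact[y yx]; exists ((-1) ^+ m *: y).
  by rewrite [LHS]res_vE ccdZ yx scalerA -expr2 sqrr_sign scale1r.
- move=> n' m x; rewrite [dch _ _ _ _]res_vE => /(congr1 (fun y => (-1) ^+ m *: y)).
  rewrite scaler0 scalerA -expr2 sqrr_sign scale1r => /bar_tot_exact[y yx].
  exists ((-1) ^+ m *: y).
  by rewrite [LHS]res_vE ccdZ yx scalerA -expr2 sqrr_sign scale1r.
Qed.

Lemma smash_tot_hoch n : lin_iso (chom (totc (smash_dc V)) n) (HH V n).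
Proof.
rewrite -hochc_chom; apply: lin_iso_trans (res_tot_hoch n).
apply: lin_iso_trans (chom_transpose _ _).
exact: lin_iso_sym (res_tot_smash n).
Qed.
End Comparison.

(** * The rows of the double complex *)

(** The complexes in [p] with [q] fixed are matched with Hochschild complexes of
    [B] in two steps: [nest_right] turns [(V ⊗ B^p) ⊗ A^q] into
    [A^q ⊗ (V ⊗ B^p)], and [unnest] takes the factors of [B] out of the
    coefficients, giving [(A^q ⊗ V) ⊗ B^p]. *)
Section Swap.
Variable k : fieldType.
Implicit Types X Y : lmodType k.
Fact swap_bilin X Y : bilin (fun (x : X) (y : Y) => y ⊗ x).
Proof. by split=> [y|x] c u v; rewrite ?tensPl ?tensPr. Qed.
Definition swap X Y : {linear tensor X Y -> tensor Y X} := tlift (swap_bilin X Y).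
Lemma swapE X Y x y : swap X Y (x ⊗ y) = y ⊗ x. Proof. exact: tliftE. Qed.
Lemma swapD X Y x y : swap X Y (x + y) = swap X Y x + swap X Y y.
Proof. exact: raddfD. Qed.
Lemma swap_bij X Y : bijective (swap X Y).
Proof.
by exists (swap Y X) => x; elim/tens_ind: x => [x y|x y IHx IHy]; rewrite ?swapD ?IHx ?IHy ?swapE.
Qed.
End Swap.

Section RightChains.
Variables (k : fieldType) (A B : unitalAlgType k).
Implicit Types X Y U V W : lmodType k.

Fixpoint CHrf U W (f : {linear U -> W}) n : {linear CHr A U n -> CHr A W n} :=
  if n is m.+1 then tmap idfun (CHrf f m) else f.
Lemma CHrfS U W (f : {linear U -> W}) n a x : CHrf f n.+1 (a ⊗ x) = a ⊗ CHrf f n x.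
Proof. exact: tmapE. Qed.
Lemma CHrfD U W (f : {linear U -> W}) n x y : CHrf f n (x + y) = CHrf f n x + CHrf f n y.
Proof. exact: raddfD. Qed.
Lemma CHr_ind W n (P : CHr A W n.+1 -> Prop) :
  (forall a x, P (a ⊗ x)) -> (forall x y, P x -> P y -> P (x + y)) -> forall x, P x.
Proof. exact: tens_ind. Qed.
Lemma eq_CHrf (U W : lmodType k) (f g : {linear U -> W}) n : f =1 g -> CHrf f n =1 CHrf g n.
Proof.
move=> fg; elim: n => [//|n IH] x; elim/CHr_ind: x => [a x|x y IHx IHy].
  by rewrite !CHrfS IH.
by rewrite !CHrfD IHx IHy.
Qed.
Lemma CHrf_id (W : lmodType k) (f : {linear W -> W}) n : f =1 id -> CHrf f n =1 id.
Proof.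
move=> fi; elim: n => [//|n IH] x; elim/CHr_ind: x => [a x|x y IHx IHy].
  by rewrite CHrfS IH.
by rewrite CHrfD IHx IHy.
Qed.
Lemma CHrf_lin U W (f g h : {linear U -> W}) a n x :
  (forall u, f u = a *: g u + h u) -> CHrf f n x = a *: CHrf g n x + CHrf h n x.
Proof.
move=> fg; elim: n x => [//|n IH] x; elim/CHr_ind: x => [c x|x y IHx IHy].
  by rewrite !CHrfS IH tensPr.
by rewrite !CHrfD IHx IHy scalerDr addrACA.
Qed.

(** Left-nested chains grow by [a_n] next to the outermost bracket, right-nested
    ones by [a_1]; the rotation therefore inserts its factors next to [W]. *)
Fixpoint insert_last W n : {linear tensor (CHr A W n) A -> CHr A W n.+1} :=
  if n is m.+1 then tmap idfun (insert_last W m) \o tassoc A (CHr A W m) A else swap W A.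
Lemma insert_last0 W w a : insert_last W 0 (w ⊗ a) = a ⊗ w. Proof. exact: swapE. Qed.
Lemma insert_lastS W n a1 x a : insert_last W n.+1 (a1 ⊗ x ⊗ a) = a1 ⊗ insert_last W n (x ⊗ a).
Proof. by rewrite /= tassocE tmapE. Qed.
Lemma insert_lastD W n x y : insert_last W n (x + y) = insert_last W n x + insert_last W n y.
Proof. exact: raddfD. Qed.
Lemma tassoc_bij X Y U : bijective (tassoc X Y U).
Proof. exists (tassocV X Y U); [exact: tassocK|exact: tassocVK]. Qed.
Lemma insert_last_bij W n : bijective (insert_last W n).
Proof.
elim: n => [|n IH]; first exact: swap_bij.
by apply: bij_comp (tassoc_bij _ _ _); apply: tmap_bij => //; exists id.
Qed.
Lemma insert_last_nat U W (f : {linear U -> W}) n x a :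
  CHrf f n.+1 (insert_last U n (x ⊗ a)) = insert_last W n (CHrf f n x ⊗ a).
Proof.
elim: n x => [|n IH] x; first by rewrite !insert_last0 CHrfS.
elim/CHr_ind: x => [a1 x|x y IHx IHy]; last by rewrite !(tlinD, insert_lastD, CHrfD) IHx IHy.
by rewrite insert_lastS !CHrfS insert_lastS IH.
Qed.

Fixpoint nest_right W q : {linear CH A W q -> CHr A W q} :=
  if q is n.+1 then insert_last W n \o tmap (nest_right W n) idfun else idfun.
Lemma nest_rightS W q x a : nest_right W q.+1 (x ⊗ a) = insert_last W q (nest_right W q x ⊗ a).
Proof. by rewrite /= tmapE. Qed.
Lemma nest_rightD W n x y : nest_right W n (x + y) = nest_right W n x + nest_right W n y.
Proof. exact: raddfD. Qed.
Lemma nest_right_bij W n : bijective (nest_right W n).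
Proof.
elim: n => [|n IH]; first by exists id.
by apply: bij_comp (insert_last_bij _ _) _; apply: tmap_bij => //; exists id.
Qed.
Lemma nest_right_nat U W (f : {linear U -> W}) q x :
  CHrf f q (nest_right U q x) = nest_right W q (CHf A f q x).
Proof.
elim: q x => [//|q IH] x; elim/CH_ind: x => [x a|x y IHx IHy]; last first.
  by rewrite !(nest_rightD, CHrfD, CHfD) IHx IHy.
by rewrite nest_rightS insert_last_nat IH CHfS nest_rightS.
Qed.

(** Takes a factor of [B] that stands next to [W] to the outside, without
    applying [R]. *)
Fixpoint split_off W q : {linear CHr A (tensor W B) q -> tensor (CHr A W q) B} :=
  if q is n.+1 then tassocV A (CHr A W n) B \o tmap idfun (split_off W n) else idfun.
Lemma split_offS W q a x : split_off W q.+1 (a ⊗ x) = tassocV A (CHr A W q) B (a ⊗ split_off W q x).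
Proof. by rewrite /= tmapE. Qed.
Lemma split_offD W n x y : split_off W n (x + y) = split_off W n x + split_off W n y.
Proof. exact: raddfD. Qed.
Lemma split_off_bij W n : bijective (split_off W n).
Proof.
elim: n => [|n IH]; first by exists id.
apply: bij_comp; first by exists (tassoc A (CHr A W n) B); [exact: tassocVK|exact: tassocK].
by apply: tmap_bij => //; exists id.
Qed.
Lemma split_off_nat U W (f : {linear U -> W}) q x :
  split_off W q (CHrf (tmap f idfun) q x) = tmap (CHrf f q) idfun (split_off U q x).
Proof.
elim: q x => [//|q IH] x; elim/CHr_ind: x => [a x|x y IHx IHy]; last first.
  by rewrite !(CHrfD, split_offD, tlinD) IHx IHy.
rewrite CHrfS !split_offS IH; elim/tens_ind: (split_off U q x) => [y b|t t' IHt IHt']; last first.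
  by rewrite !tlinD IHt IHt'.
by rewrite tassocVE !tmapE tassocVE.
Qed.
Lemma split_off_mulB W q x :
  split_off W q (CHrf (mulB B W) q x) = mulB B _ (tmap (split_off W q) idfun (split_off (tensor W B) q x)).
Proof.
elim: q x => [|q IH] x; first by rewrite [tmap _ _ _](tmap_id (f := idfun)).
elim/CHr_ind: x => [a x|x y IHx IHy]; last by rewrite !(CHrfD, split_offD, tlinD, mulBD) IHx IHy.
rewrite CHrfS !split_offS IH; elim/tens_ind: (split_off _ q x) => [y b'|t t' IHt IHt']; last first.
  by rewrite !(tlinD, mulBD) IHt IHt'.
rewrite tassocVE !tmapE split_offS; elim/tens_ind: (split_off W q y) => [z b|t t' IHt IHt']; last first.
  by rewrite !(tlinD, mulBD) IHt IHt'.
by rewrite mulBE !tassocVE mulBE.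
Qed.

Definition flip X : {linear tensor (tensor X B) A -> tensor (tensor X A) B} :=
  tassocV X A B \o tmap idfun (swap B A) \o tassoc X B A.
Lemma flipE X x b a : flip X (x ⊗ b ⊗ a) = x ⊗ a ⊗ b.
Proof. by rewrite /flip /= tassocE tmapE swapE tassocVE. Qed.
Lemma flipD X x y : flip X (x + y) = flip X x + flip X y. Proof. exact: raddfD. Qed.
Lemma split_off_insert_last W n y a :
  split_off W n.+1 (insert_last _ n (y ⊗ a)) = tmap (insert_last W n) idfun (flip _ (split_off W n y ⊗ a)).
Proof.
elim: n y => [|n IH] y.
  rewrite insert_last0 split_offS; have -> : split_off W 0 y = y by [].
  elim/tens_ind: y => [w b|x y IHx IHy].
    by rewrite tassocVE flipE tmapE swapE.
  by rewrite !(tlinD, flipD) IHx IHy.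
elim/CHr_ind: y => [a1 y|x y IHx IHy]; last first.
  by rewrite !(insert_lastD, split_offD, tlinD, flipD) IHx IHy.
rewrite insert_lastS !split_offS IH; elim/tens_ind: (split_off W n y) => [z b|t t' IHt IHt']; last first.
  by rewrite !(insert_lastD, split_offD, tlinD, flipD) IHt IHt'.
by rewrite !flipE tassocVE flipE !tmapE tassocVE insert_lastS.
Qed.

Section Left.
Variable R : distr_law A B.
(** The crossing of [b] with [a_1, ..., a_q] that underlies the left action of
    [B] on [CHr], stopped before [b] acts on [W]. *)
Fixpoint sweep_left W q : {linear tensor B (CHr A W q) -> tensor (CHr A W q) B} :=
  if q is n.+1 then
    tassocV A (CHr A W n) B \o tmap idfun (sweep_left W n) \o tassoc A B (CHr A W n)
    \o tmap R idfun \o tassocV B A (CHr A W n)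
  else swap B W.
Definition sweep_left_in W q (t : tensor A B) (x : CHr A W q) : tensor (CHr A W q.+1) B :=
  tassocV A (CHr A W q) B (tmap idfun (sweep_left W q) (tassoc A B _ (t ⊗ x))).
Lemma sweep_leftS W q b a x : sweep_left W q.+1 (b ⊗ (a ⊗ x)) = sweep_left_in (R (b ⊗ a)) x.
Proof. by rewrite /= tassocVE tmapE. Qed.
Lemma sweep_left_inE W q a b (x : CHr A W q) :
  sweep_left_in (a ⊗ b) x = tassocV A (CHr A W q) B (a ⊗ sweep_left W q (b ⊗ x)).
Proof. by rewrite /sweep_left_in tassocE tmapE. Qed.
Lemma sweep_left_inD W q t t' (x : CHr A W q) : sweep_left_in (t + t') x = sweep_left_in t x + sweep_left_in t' x.
Proof. by rewrite /sweep_left_in !tlinD. Qed.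
Lemma sweep_leftD W q x y : sweep_left W q (x + y) = sweep_left W q x + sweep_left W q y.
Proof. exact: raddfD. Qed.
Lemma sweep_left_insert_last W n b x a :
  sweep_left W n.+1 (b ⊗ insert_last W n (x ⊗ a)) =
  tmap (insert_last W n) idfun (cross R _ (sweep_left W n (b ⊗ x) ⊗ a)).
Proof.
elim: n x b => [|n IH] x b.
  rewrite insert_last0 sweep_leftS [sweep_left W 0 _]swapE crossE.
  elim/tens_ind: (R _) => [a' b'|t t' IHt IHt']; last by rewrite sweep_left_inD !tlinD IHt IHt'.
  by rewrite sweep_left_inE [sweep_left W 0 _]swapE !tassocVE tmapE insert_last0.
elim/CHr_ind: x => [a1 x|x y IHx IHy]; last first.
  by rewrite !(insert_lastD, sweep_leftD, tlinD, crossD) IHx IHy.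
rewrite insert_lastS !sweep_leftS; elim/tens_ind: (R (b ⊗ a1)) => [a' b'|t t' IHt IHt']; last first.
  by rewrite !sweep_left_inD !(tlinD, crossD) IHt IHt'.
rewrite !sweep_left_inE IH; elim/tens_ind: (sweep_left W n (b' ⊗ x)) => [z b2|t t' IHt IHt']; last first.
  by rewrite !(tlinD, crossD) IHt IHt'.
rewrite tassocVE !crossE; elim/tens_ind: (R (b2 ⊗ a)) => [a3 b3|t t' IHt IHt']; last first.
  by rewrite !tlinD IHt IHt'.
by rewrite !tassocVE !tmapE tassocVE insert_lastS.
Qed.
(** On left-nested chains, [b] starts inside, next to [W], and crosses the [a]'s
    outwards; on right-nested chains it starts at the outside and crosses them
    inwards. The order of the crossings is the same. *)
Lemma nest_right_sweep W q x :
  tmap (nest_right W q) idfun (sweep R W q x) = sweep_left W q (swap _ _ (split_off W q (nest_right _ q x))).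
Proof.
elim: q x => [|q IH] x.
  rewrite [LHS]tmap_id //=; elim/tens_ind: x => [w b|x y IHx IHy]; first by rewrite !swapE.
  by rewrite !swapD -IHx -IHy.
elim/CH_ind: x => [x a|x y IHx IHy]; last first.
  by rewrite !(sweepD, nest_rightD, split_offD, swapD, sweep_leftD, tlinD) IHx IHy.
rewrite sweepS nest_rightS split_off_insert_last.
transitivity (tmap (insert_last W q) idfun (cross R _ (tmap (nest_right W q) idfun (sweep R W q x) ⊗ a))).
  by rewrite -cross_nat tmap_comp; apply: eq_tmap.
rewrite IH; elim/tens_ind: (split_off W q _) => [y b|t t' IHt IHt']; last first.
  by rewrite !(swapD, sweep_leftD, tlinD, crossD, flipD) IHt IHt'.
by rewrite flipE tmapE !swapE sweep_left_insert_last.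
Qed.

Section Act.
Variables (W : lmodType k) (alpha : saction R W).
Fact lmul_bilin : bilin (fun b (w : W) => inr_act alpha b w).
Proof.
split=> [w|b]; last exact: linearP.
by move=> c b b'; rewrite /inr_act smash_inr_linear; apply: sact_linear.
Qed.
(** [CHr_lact] for a space [W] that need not be a [B]-bimodule. *)
Fixpoint lmul q : {linear tensor B (CHr A W q) -> CHr A W q} :=
  if q is n.+1 then
    tmap idfun (lmul n) \o tassoc A B (CHr A W n)
    \o tmap R idfun \o tassocV B A (CHr A W n)
  else tlift lmul_bilin.
Definition lmul_in q (t : tensor A B) (x : CHr A W q) : CHr A W q.+1 :=
  tmap idfun (lmul q) (tassoc A B _ (t ⊗ x)).
Lemma lmul0 b w : lmul 0 (b ⊗ w) = inr_act alpha b w. Proof. exact: tliftE. Qed.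
Lemma lmulS q b a x : lmul q.+1 (b ⊗ (a ⊗ x)) = lmul_in (R (b ⊗ a)) x.
Proof. by rewrite /= tassocVE tmapE. Qed.
Lemma lmul_inE q a b (x : CHr A W q) : lmul_in (a ⊗ b) x = a ⊗ lmul q (b ⊗ x).
Proof. by rewrite /lmul_in tassocE tmapE. Qed.
Lemma lmul_inD q t t' (x : CHr A W q) : lmul_in (t + t') x = lmul_in t x + lmul_in t' x.
Proof. by rewrite /lmul_in !tlinD. Qed.
Lemma lmulD q x y : lmul q (x + y) = lmul q x + lmul q y.
Proof. exact: raddfD. Qed.

Fact absorbr_bilin q : bilin (fun (x : CHr A W q) b => CHrf (inr_act alpha b) q x).
Proof.
split=> [b|x]; first exact: linearP.
by move=> c b b'; apply: CHrf_lin => w; apply: lmul_bilin.1.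
Qed.
Definition absorbr q : {linear tensor (CHr A W q) B -> CHr A W q} := tlift (absorbr_bilin q).
Lemma absorbrE q x b : absorbr q (x ⊗ b) = CHrf (inr_act alpha b) q x.
Proof. exact: tliftE. Qed.
Lemma absorbrD q x y : absorbr q (x + y) = absorbr q x + absorbr q y.
Proof. exact: raddfD. Qed.
Lemma absorbr_sweep_left q b x : absorbr q (sweep_left W q (b ⊗ x)) = lmul q (b ⊗ x).
Proof.
elim: q x b => [|q IH] x b; first by rewrite [sweep_left W 0 _]swapE absorbrE lmul0.
elim/CHr_ind: x => [a x|x y IHx IHy]; last by rewrite !(tlinD, sweep_leftD, absorbrD, lmulD) IHx IHy.
rewrite sweep_leftS lmulS; elim/tens_ind: (R _) => [a' b'|t t' IHt IHt']; last first.
  by rewrite sweep_left_inD lmul_inD absorbrD IHt IHt'.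
rewrite sweep_left_inE lmul_inE -IH; elim/tens_ind: (sweep_left _ _ _) => [y b2|t t' IHt IHt']; last first.
  by rewrite !(tlinD, absorbrD) IHt IHt'.
by rewrite tassocVE !absorbrE CHrfS.
Qed.
Lemma nest_right_absorb_absorbr q t : nest_right W q (absorb alpha q t) = absorbr q (tmap (nest_right W q) idfun t).
Proof.
elim/tens_ind: t => [x b|t t' IHt IHt']; last by rewrite !(absorbD, nest_rightD, tlinD, absorbrD) IHt IHt'.
by rewrite absorbE tmapE absorbrE nest_right_nat.
Qed.
Lemma nest_right_last U (i : {linear U -> tensor W B}) q x :
  nest_right W q (last_face alpha i q x) = lmul q (swap _ _ (split_off W q (CHrf i q (nest_right U q x)))).
Proof.
rewrite last_faceE nest_right_absorb_absorbr nest_right_sweep nest_right_nat.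
elim/tens_ind: (split_off W q _) => [y b|t t' IHt IHt']; last first.
  by rewrite !(swapD, sweep_leftD, absorbrD, lmulD) IHt IHt'.
by rewrite swapE absorbr_sweep_left.
Qed.
End Act.

(** The action of [b] on [A^q ⊗ (W ⊗ B)] crosses the factors of [A] and then acts
    on [W] alone, so it ignores the extra factor of [B]. *)
Lemma split_off_lmul U W (alpha : saction R U) (gamma : saction R W) (i : {linear U -> tensor W B}) q b x :
  (forall s u, i (alpha s u) = tmap (gamma s) idfun (i u)) ->
  split_off W q (CHrf i q (lmul alpha q (b ⊗ x))) =
  tmap (lmul gamma q) idfun (tassocV B _ B (b ⊗ split_off W q (CHrf i q x))).
Proof.
move=> ia; elim: q x b => [|q IH] x b.
  rewrite lmul0 [LHS]ia /=; elim/tens_ind: (i x) => [w b'|t t' IHt IHt'].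
    by rewrite tassocVE !tmapE lmul0.
  by rewrite !tlinD IHt IHt'.
elim/CHr_ind: x => [a x|x y IHx IHy]; last by rewrite !(tlinD, CHrfD, split_offD, lmulD) IHx IHy.
rewrite lmulS CHrfS split_offS.
transitivity (tassocV A (CHr A W q) B (tmap idfun (tmap (lmul gamma q) idfun \o tassocV B _ B)
    (tassoc A B _ (R (b ⊗ a) ⊗ split_off W q (CHrf i q x))))).
  elim/tens_ind: (R _) => [a' b'|t t' IHt IHt']; last by rewrite lmul_inD !(CHrfD, split_offD, tlinD) IHt IHt'.
  by rewrite lmul_inE CHrfS split_offS IH tassocE tmapE.
elim/tens_ind: (split_off W q _) => [y b'|t t' IHt IHt']; last by rewrite !tlinD IHt IHt'.
rewrite tassocVE tassocVE tmapE lmulS.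
elim/tens_ind: (R _) => [a' b2|t t' IHt IHt']; last by rewrite lmul_inD !tlinD IHt IHt'.
by rewrite tassocE tmapE /= tassocVE tmapE tassocVE lmul_inE.
Qed.
End Left.
End RightChains.

Section Rows.
Variables (k : fieldType) (A B : unitalAlgType k) (R : distr_law A B).
Local Notation S := (smash R : unitalAlgType k).
Variable V : bimodule S.
Local Notation X q := (CHr_bimodule R (resB V) q).

Definition vmul p : {linear CH B V p.+1 -> CH B V p} := mul_last (resB V) p.
Definition vbar p : {linear CH B V p.+1 -> CH B V p} := bar (resB V) p.

Lemma split_off_ract q (y : CHr A (CH B V 1) q) :
  CHrf A (vmul 0) q y = mul_last (X q) 0 (split_off A B V q y).
Proof.
elim: q y => [|q IH] y.
  change (vmul 0 y = mul_last (X 0) 0 y); elim/tens_ind: y => [v b|t t' IHt IHt'].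
    by rewrite -[RHS]/(rmul _ _) rmul0; exact: (rmul0 (W := resB V) v b).
  by rewrite (linearD (vmul 0)) IHt IHt' -(linearD (mul_last (X 0) 0)).
elim/CHr_ind: y => [a y|x y IHx IHy]; last first.
  by rewrite CHrfD split_offD IHx IHy -(linearD (mul_last (X q.+1) 0)).
rewrite CHrfS split_offS IH; elim/tens_ind: (split_off A B V q y) => [z b|t t' IHt IHt']; last first.
  rewrite (linearD (mul_last (X q) 0)) !tlinD IHt IHt'.
  by rewrite -(linearD (mul_last (X q.+1) 0)).
rewrite tassocVE -[RHS]/(rmul _ _) -[Y in _ ⊗ Y]/(rmul _ _) !rmul0.
exact: esym (@CHr_ractS k A B (resB V) q z a b).
Qed.

Lemma lmul_lact (alpha : saction R V) q b x :
  (forall s v, alpha s v = lact s v) -> lmul alpha q (b ⊗ x) = lact b (x : X q).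
Proof.
move=> alphaE; elim: q x b => [|q IH] x b; first by rewrite lmul0 [RHS]CHr_lact0 [LHS]alphaE.
elim/CHr_ind: x => [a x|x y IHx IHy]; last first.
  by rewrite tlinD lmulD IHx IHy; exact: esym (linearD (lact_by (X q.+1) b) x y).
rewrite lmulS [RHS]CHr_lactS; elim/tens_ind: (R _) => [a' b'|t t' IHt IHt']; last first.
  by rewrite lmul_inD CHr_slideD IHt IHt'.
by rewrite lmul_inE CHr_slideE IH.
Qed.

Section FixQ.
Variable q : nat.

Fixpoint unnest p : {linear CHr A (CH B V p) q -> CH B (X q) p} :=
  if p is n.+1 then tmap (unnest n) idfun \o split_off A B (CH B V n) q
  else (idfun : {linear CHr A V q -> CHr A V q}).
Lemma unnestD p x y : unnest p (x + y) = unnest p x + unnest p y.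
Proof. exact: raddfD. Qed.
Lemma unnestZ p c x : unnest p (c *: x) = c *: unnest p x.
Proof. exact: linearZ. Qed.
Lemma unnestS p x : unnest p.+1 x = tmap (unnest p) idfun (split_off A B (CH B V p) q x).
Proof. by []. Qed.
Lemma unnest_bij p : bijective (unnest p).
Proof.
elim: p => [|p IH]; first by exists id.
by apply: bij_comp (split_off_bij _ _ _ _); apply: tmap_bij => //; exists id.
Qed.

Lemma unnest_mul p y : unnest p (CHrf A (vmul p) q y) = mul_last (X q) p (unnest p.+1 y).
Proof.
case: p y => [|p] y; last first.
  rewrite !unnestS [split_off _ _ _ _ (CHrf _ _ _ _)](split_off_mulB y).
  rewrite -[RHS]/(mulB B _ _) -mulB_nat !tmap_comp.
  by apply: (congr1 (mulB B _)); apply: eq_tmap.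
rewrite unnestS [tmap _ _ _]tmap_id //; exact: split_off_ract.
Qed.

Lemma unnest_bar p y : unnest p (CHrf A (vbar p) q y) = bar (X q) p (unnest p.+1 y).
Proof.
have bar0E (W : bimodule B) (t : CH B W 1) : bar W 0 t = mul_last W 0 t.
  elim/tens_ind: t => [w b|t t' IHt IHt']; first by rewrite bar0.
  by rewrite barD IHt IHt' -(linearD (mul_last W 0)).
have barSE (W : bimodule B) n (t : CH B W n.+2) :
    bar W n.+1 t = (-1) ^+ n.+1 *: mul_last W n.+1 t + tmap (bar W n) idfun t.
  elim/tens_ind: t => [w b|t t' IHt IHt']; first by rewrite barS tmapE addrC.
  by rewrite barD IHt IHt' (linearD (mul_last W n.+1)) scalerDr tmapD addrACA.
elim: p y => [|p IH] y.
  rewrite bar0E -unnest_mul; congr (unnest 0 _); apply: eq_CHrf.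
  exact: (bar0E (resB V)).
rewrite barSE -unnest_mul.
rewrite (@CHrf_lin k A _ _ (vbar p.+1) (vmul p.+1) (tmap (vbar p) idfun) ((-1) ^+ p.+1)); last first.
  exact: (barSE (resB V)).
rewrite unnestD unnestZ; congr (_ + _).
rewrite !unnestS split_off_nat !tmap_comp; by apply: eq_tmap.
Qed.

Lemma unnest_lmul p b y :
  unnest p (lmul (aCH V p) q (b ⊗ y)) = CHf B (lact_by (X q) b) p (unnest p y).
Proof.
elim: p y => [|p IH] y; first exact: (@lmul_lact (aCH V 0)).
rewrite !unnestS.
have := @split_off_lmul k A B R _ _ (aCH V p.+1) (aCH V p) (idfun : {linear CH B V p.+1 -> tensor (CH B V p) B}) q b y (fun _ _ => erefl).
rewrite !CHrf_id // => ->.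
elim/tens_ind: (split_off A B _ q y) => [z b'|t t' IHt IHt']; last by rewrite !(tlinD, CHfD) IHt IHt'.
by rewrite tassocVE !tmapE IH.
Qed.

Definition row_iso p : {linear smash_dc V p q -> CH B (X q) p} := unnest p \o nest_right A (CH B V p) q.
Lemma row_isoE p x : row_iso p x = unnest p (nest_right A (CH B V p) q x).
Proof. by []. Qed.
(** [unnest_bar] matches the bar parts; [nest_right_last] and [unnest_lmul] match
    the last faces. *)
Lemma row_iso_d p x : row_iso p (smash_dh V p q x) = hoch_diff (row_iso p.+1 x).
Proof.
rewrite smash_dhE hoch_diffE (linearD (row_iso p)) [Y in _ + Y]linearZ_LR; congr (_ + _ *: _).
  by rewrite !row_isoE -(nest_right_nat (vbar p)) unnest_bar.
rewrite !row_isoE nest_right_last CHrf_id // unnestS.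
elim/tens_ind: (split_off A B _ q _) => [z b|t t' IHt IHt']; last first.
  by rewrite !(swapD, lmulD, tlinD, unnestD, cycD) IHt IHt'.
by rewrite swapE tmapE cycE unnest_lmul.
Qed.
Lemma smash_dc_row p :
  lin_iso (chom (dccol (dc_transpose (smash_dc V)) q) p) (HH (CHr_bimodule R (resB V) q) p).
Proof.
rewrite -hochc_chom.
apply: (@chain_iso_chom k (dccol (dc_transpose (smash_dc V)) q) (hochc (X q)) row_iso).
  exact: row_iso_d.
by move=> n; apply: bij_comp; [exact: unnest_bij|exact: nest_right_bij].
Qed.
End FixQ.
End Rows.

(** * The two spectral sequences *)
Theorem theorem2p2 (k : fieldType) (char0 : [pchar k] =i pred0)
    (A B : unitalAlgType k) (R : distr_law A B) (R_inv : bijective R)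
    (V : bimodule (smash R)) :
  (exists E : spectral_sequence k,
    [/\ first_quadrant E,
        forall p q : nat,
          lin_iso (E 1%N p%:Z q%:Z) (HH (CH_bimodule R (resA V) p) q) &
        converges_to E (HH V)]) /\
  (exists E' : spectral_sequence k,
    [/\ first_quadrant E',
        forall p q : nat,
          lin_iso (E' 1%N q%:Z p%:Z) (HH (CHr_bimodule R (resB V) q) p) &
        converges_to E' (HH V)]).
Proof.
split.
- exists (tot_ss (smash_dc V)); split.
  + apply: ss_first_quadrant; [exact: filt_neg|exact: filt_full].
  + by move=> p q; apply: lin_iso_trans (tot_ss_E1 _ _ _) (smash_dc_col _ _ _).
  + exact: tot_ss_converges (smash_tot_hoch V).
- exists (tot_ss (dc_transpose (smash_dc V))); split.
  + apply: ss_first_quadrant; [exact: filt_neg|exact: filt_full].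
  + by move=> p q; apply: lin_iso_trans (tot_ss_E1 _ _ _) (smash_dc_row _ _ _).
  + apply: tot_ss_converges => n.
    apply: lin_iso_trans (smash_tot_hoch V n); apply: lin_iso_sym.
    exact: chom_transpose.
Qed.
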